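(* Let $J$ be a simple Jordan superalgebra of type $P(n)$ over an algebraically closed field $F$ of characteristic zero, graded by a finite abelian group $G$. Then there exists a decomposition $2n=2^kq$ such that $J$, as a $G$-graded superalgebra, is isomorphic to the subsuperalgebra $$K(R,* )\otimes K(T,* )+H(R,* )\otimes H(T,* )$$ of $R\otimes T$, where $R=M_{2^k}(F)$ is a matrix algebra with an involution fine grading (as defined in the context), and $T=M_{s,r}(F)$, $s+r=q$, is a matrix superalgebra with an involution elementary $G$-grading. Moreover, $K(T,* )$ and $H(T,* )$ are of the transpose form described in the context.
   Context: $M_{a,b}(F)$ denotes the algebra $M_{a+b}(F)$ of block matrices $X=\begin{pmatrix}A&B\\ C&D\end{pmatrix}$ ($A$ of size $a\times a$, $D$ of size $b\times b$) with the $\mathbb{Z}_2$-grading whose even part is given by $B=0,C=0$ and odd part by $A=0,D=0$. Put $X^{\tau}=\begin{pmatrix}A&-B\\ C&D\end{pmatrix}^t$. A superinvolution on an associative superalgebra is a $\mathbb{Z}_2$-graded linear map $*$ of order 2 with $(xy)^*=(-1)^{|x||y|}y^*x^*$ for homogeneous $x,y$. $H(\cdot,* )=\{x:x^*=x\}$ and $K(\cdot,* )=\{x:x^*=-x\}$. The Jordan superalgebra of type $P(n)$ is $H(M_{n,n}(F),trp)$ with the super-symmetrized product $x\circ y=\frac12(xy+(-1)^{|x||y|}yx)$, where $trp$ is the transpose superinvolution $\begin{pmatrix}A&B\\ C&D\end{pmatrix}\mapsto\begin{pmatrix}D^t&-B^t\\ C^t&A^t\end{pmatrix}$. A $G$-grading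 of a superalgebra has homogeneous components that are $\mathbb{Z}_2$-graded subspaces. The subspace of $R\otimes T$ in the claim is regarded as a Jordan superalgebra under the super-symmetrized product, graded by the grading induced from the tensor product $R\otimes T$. An involution grading is one with all homogeneous components stable under the (super)involution $*$. Involution fine grading on $R=M_{2^k}(F)$: a fine grading (each nonzero homogeneous component is one-dimensional) with a graded involution $*$ such that, as a graded algebra with involution, $R\cong R_1\otimes\cdots\otimes R_k$, where $R_1,\ldots,R_k$ are graded subalgebras stable under $*$, each $R_i$ is $H_i$-graded with $H_i\cong\mathbb{Z}_2\times\mathbb{Z}_2$, and $R_1\otimes\cdots\otimes R_k$ is $H_1\times\cdots\times H_k$-graded. Elementary grading of $M_N(F)$ defined by $(g'_1,\dots,g'_N)\in G^N$: the matrix unit $E_{ij}$ has degree $(g'_i)^{-1}g'_j$. The notation $g^{(p)}$ in a tuple means $g$ repeated $p$ times; $p_i,q_i$ are nonnegative integers. Transpose form for $T=M_{s,r}(F)$: $s=r$; the grading is elementary, defined by $(g_1^{(p_1)},\ldots,g_\ell^{(p_\ell)},g_{i_1}^{(q_{i_1})},\ldots,g_{i_\ell}^{(q_{i_\ell})})$ with $g_i\neq g_j$ for $i\ne j$, $(i_1,\ldots,i_\ell)$ a permutation of $(1,\ldots,\ell)$, $\sum p_i=\sum q_i=s$, $g_1g_{i_1}=g_2g_{i_2}=\cdots=g_\ell g_{i_\ell}$; the superinvolution is $X^*=\Phi^{-1}X^\tau\Phi$ with $\Phi=\begin{pmatrix}0&I_s\\ I_s&0\end{pmatrix}$. Then $K(T,*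 )$ consists of all $\begin{pmatrix}A&B\\ C&-A^t\end{pmatrix}$ with $A$ any $s\times s$ matrix, $B$ symmetric, $C$ skew-symmetric, and $H(T,* )$ consists of all $\begin{pmatrix}A&B\\ C&A^t\end{pmatrix}$ with $A$ any $s\times s$ matrix, $B$ skew-symmetric, $C$ symmetric. *)

(* Defs.v *)
From HB Require Import structures.
From mathcomp Require Import all_boot all_order all_algebra all_fingroup.
From mathcomp Require Import falgebra mxtens.

Set Implicit Arguments.
Unset Strict Implicit.
Unset Printing Implicit Defensive.

Import GRing.Theory.
Local Open Scope ring_scope.

(* The degree in Z/2 is a bool (true = odd); addition of degrees is addb. *)
Record superalgebra (F : fieldType) := Superalgebra {
  scarrier :> vectType F;
  smul : scarrier -> scarrier -> scarrier;
  spart : bool -> {vspace scarrier};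
  smul_linearl : forall y, linear (smul^~ y);
  smul_linearr : forall x, linear (smul x);
  spart_sum : (spart false + spart true)%VS = fullv;
  spart_cap : (spart false :&: spart true)%VS = 0%VS;
  smul_spart : forall a b x y, x \in spart a -> y \in spart b ->
    smul x y \in spart (a (+) b)
}.

(* Simplicity is relative to Z/2-graded ideals. *)
Definition simple_superalgebra (F : fieldType) (J : superalgebra F) : Prop :=
  (exists x y : J, smul x y != 0) /\
  forall I : {vspace J},
    (I = (I :&: spart J false) + (I :&: spart J true))%VS ->
    (forall x y : J, y \in I -> smul x y \in I /\ smul y x \in I) ->
    I = 0%VS \/ I = fullv.

Section Gradings.
Variables (F : fieldType) (gT : finGroupType).

Definition is_grading (V : vectType F) (mul : V -> V -> V)
    (D : gT -> {vspace V}) : Prop :=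
  [/\ (\sum_(g : gT) D g)%VS = fullv,
      directv (\sum_(g : gT) D g)
    & forall (g h : gT) (x y : V), x \in D g -> y \in D h ->
        mul x y \in D (g * h)%g].

Definition is_super_grading (J : superalgebra F) (D : gT -> {vspace J}) : Prop :=
  is_grading (@smul F J) D /\
  forall g, D g = ((D g :&: spart J false) + (D g :&: spart J true))%VS.

Definition stable_grading (V : vectType F) (star : 'End(V))
    (D : gT -> {vspace V}) : Prop :=
  forall g, (star @: D g <= D g)%VS.

End Gradings.

Definition symv (F : fieldType) (V : vectType F) (star : 'End(V)) : {vspace V} :=
  fixedSpace star.

Definition skewv (F : fieldType) (V : vectType F) (star : 'End(V)) : {vspace V} :=
  lker (star + \1)%VF.

Lemma mem_symv (F : fieldType) (V : vectType F) (star : 'End(V)) x :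
  (x \in symv star) = (star x == x).
Proof. by apply/fixedSpaceP/eqP. Qed.

Lemma mem_skewv (F : fieldType) (V : vectType F) (star : 'End(V)) x :
  (x \in skewv star) = (star x == - x).
Proof. by rewrite memv_ker add_lfunE id_lfunE addr_eq0. Qed.

Section SuperMatrices.
Variable F : fieldType.

HB.instance Definition _ a b := GRing.Linear.copy
  (@ulsubmx F a b a b) (@lsubmx F _ a b \o @usubmx F a b (a + b)).
HB.instance Definition _ a b := GRing.Linear.copy
  (@ursubmx F a b a b) (@rsubmx F _ a b \o @usubmx F a b (a + b)).
HB.instance Definition _ a b := GRing.Linear.copy
  (@dlsubmx F a b a b) (@lsubmx F _ a b \o @dsubmx F a b (a + b)).
HB.instance Definition _ a b := GRing.Linear.copy
  (@drsubmx F a b a b) (@rsubmx F _ a b \o @dsubmx F a b (a + b)).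

Definition mxpart (a b : nat) (e : bool) : {vspace 'M[F]_(a + b)} :=
  (if e then lker (linfun (@ulsubmx F a b a b)) :&: lker (linfun (@drsubmx F a b a b))
   else lker (linfun (@ursubmx F a b a b)) :&: lker (linfun (@dlsubmx F a b a b)))%VS.

Lemma mem_mxpart a b e (X : 'M[F]_(a + b)) :
  X \in mxpart a b e =
  if e then (ulsubmx X == 0) && (drsubmx X == 0)
  else (ursubmx X == 0) && (dlsubmx X == 0).
Proof. by rewrite /mxpart; case: e; rewrite memv_cap !memv_ker !lfunE. Qed.

Definition trp_fun (n : nat) (X : 'M[F]_(n + n)) : 'M[F]_(n + n) :=
  block_mx (drsubmx X)^T (- (ursubmx X)^T) (dlsubmx X)^T (ulsubmx X)^T.

Fact trp_fun_linear n : linear (@trp_fun n).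
Proof.
move=> c X Y; rewrite /trp_fun scale_block_mx add_block_mx.
by congr block_mx; rewrite !linearP //= opprD scalerN.
Qed.
HB.instance Definition _ n :=
  GRing.isLinear.Build F 'M[F]_(n + n) 'M[F]_(n + n) _ (@trp_fun n)
    (@trp_fun_linear n).

Definition trp (n : nat) : 'End('M[F]_(n + n)) := linfun (@trp_fun n).

Definition supertr (a b : nat) (X : 'M[F]_(a + b)) : 'M[F]_(a + b) :=
  (block_mx (ulsubmx X) (- ursubmx X) (dlsubmx X) (drsubmx X))^T.

Definition swap_mx (s : nat) : 'M[F]_(s + s) := block_mx 0 1%:M 1%:M 0.

Definition tstar_fun (s : nat) (X : 'M[F]_(s + s)) : 'M[F]_(s + s) :=
  invmx (swap_mx s) *m supertr X *m swap_mx s.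

Fact tstar_fun_linear s : linear (@tstar_fun s).
Proof.
move=> c X Y; rewrite /tstar_fun.
have -> : supertr (c *: X + Y) = c *: supertr X + supertr Y.
  rewrite /supertr -linearP /=; congr (_^T).
  rewrite scale_block_mx add_block_mx.
  by congr block_mx; rewrite !linearP //= opprD scalerN.
by rewrite mulmxDr mulmxDl -scalemxAr -scalemxAl.
Qed.
HB.instance Definition _ s :=
  GRing.isLinear.Build F 'M[F]_(s + s) 'M[F]_(s + s) _ (@tstar_fun s)
    (@tstar_fun_linear s).

Definition tstar (s : nat) : 'End('M[F]_(s + s)) := linfun (@tstar_fun s).

Lemma tstarE s (A B C D : 'M[F]_s) :
  tstar s (block_mx A B C D) = block_mx D^T (- B^T) C^T A^T.
Proof.
have ss1 : swap_mx s *m swap_mx s = 1%:M.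
  by rewrite mulmx_block !mul0mx !mulmx0 !mul1mx !addr0 !add0r -scalar_mx_block.
have -> : tstar s (block_mx A B C D) = tstar_fun (block_mx A B C D).
  exact: lfunE.
rewrite /tstar_fun /supertr block_mxKul block_mxKur block_mxKdl block_mxKdr.
have -> : invmx (swap_mx s) = swap_mx s.
  have [u _] := mulmx1_unit ss1.
  by rewrite -[LHS]mulmx1 -ss1 mulmxA mulVmx ?mul1mx.
rewrite tr_block_mx !mulmx_block.
by rewrite !mul0mx !mulmx0 !mul1mx !mulmx1 !addr0 !add0r linearN.
Qed.

Lemma symv_tstarE s (A B C D : 'M[F]_s) :
  (block_mx A B C D \in symv (tstar s)) =
  [&& D == A^T, B^T == - B & C^T == C].
Proof.
rewrite mem_symv tstarE; apply/eqP/and3P.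
  case/eq_block_mx=> _ eB eC eD.
  by rewrite -eD eC -[in - B]eB opprK !eqxx.
by case=> /eqP-> /eqP-> /eqP->; rewrite trmxK opprK.
Qed.

Lemma skewv_tstarE s (A B C D : 'M[F]_s) :
  (block_mx A B C D \in skewv (tstar s)) =
  [&& D == - A^T, B^T == B & C^T == - C].
Proof.
rewrite mem_skewv tstarE opp_block_mx; apply/eqP/and3P.
  case/eq_block_mx=> _ /oppr_inj eB eC eD.
  by rewrite -[D]opprK -eD eB eC !eqxx.
by case=> /eqP-> /eqP-> /eqP->; rewrite linearN /= trmxK opprK.
Qed.

(* f identifies J with the subspace S of the associative superalgebra 'M_N
   (with even and odd parts P) under the super-symmetrized product; as smul is
   bilinear, it suffices to describe products of homogeneous elements. *)
Definition supersym_iso (J : superalgebra F) (N : nat)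
    (P : bool -> {vspace 'M[F]_N}) (S : {vspace 'M[F]_N})
    (f : 'Hom(J, 'M[F]_N)) : Prop :=
  [/\ lker f = 0%VS,
      limg f = S,
      forall e, (f @: spart J e)%VS = (S :&: P e)%VS
    & forall (d e : bool) (x y : J), x \in spart J d -> y \in spart J e ->
        f (smul x y) =
        2%:R^-1 *: (f x *m f y + (-1) ^+ (d && e) *: (f y *m f x))].

Definition type_P (n : nat) (J : superalgebra F) : Prop :=
  exists f : 'Hom(J, 'M[F]_(n + n)),
    supersym_iso (@mxpart n n) (symv (trp n)) f.

(* Tensor products of matrix spaces are realized by Kronecker products. *)
Definition tensv (m n : nat) (U : {vspace 'M[F]_m}) (V : {vspace 'M[F]_n}) :
    {vspace 'M[F]_(m * n)} :=
  <<[seq A *t B | A <- vbasis U, B <- vbasis V]>>%VS.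

(* Parts of R (x) T, where R = 'M_m is purely even and T = M_{a,b}. *)
Definition tenspart (m a b : nat) (e : bool) : {vspace 'M[F]_(m * (a + b))} :=
  tensv fullv (@mxpart a b e).

End SuperMatrices.

Section MatrixGradings.
Variables (F : fieldType) (gT : finGroupType).

Definition tens_grading (m n : nat) (D : gT -> {vspace 'M[F]_m})
    (E : gT -> {vspace 'M[F]_n}) (g : gT) : {vspace 'M[F]_(m * n)} :=
  (\sum_(h : gT) tensv (D h) (E (h^-1 * g)%g))%VS.

Definition elem_grading (N : nat) (t : N.-tuple gT) (g : gT) :
    {vspace 'M[F]_N} :=
  (\sum_(i < N) \sum_(j < N | ((tnth t i)^-1 * tnth t j)%g == g)
     <[delta_mx i j]>)%VS.

Definition is_involution (N : nat) (star : 'End('M[F]_N)) : Prop :=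
  (forall X, star (star X) = X) /\
  (forall X Y, star (X *m Y) = star Y *m star X).

Definition is_subalgebra (N : nat) (U : {vspace 'M[F]_N}) : Prop :=
  1%:M \in U /\ forall X Y, X \in U -> Y \in U -> X *m Y \in U.

(* 'M_N is the tensor product of its subalgebras U i: these commute with each
   other, and the multiplication map from the tensor product of the U i to 'M_N
   sends a basis to a basis. *)
Definition tensor_decomp (N k : nat) (U : 'I_k -> {vspace 'M[F]_N}) : Prop :=
  [/\ forall i, is_subalgebra (U i),
      forall i j X Y, i != j -> X \in U i -> Y \in U j -> X *m Y = Y *m X
    & basis_of fullv
        [seq \big[mulmx/1%:M]_(i < k) (vbasis (U i))`_(f i)
        | f : {dffun forall i : 'I_k, 'I_(\dim (U i))}]].

Definition involution_fine_grading (k : nat) (star : 'End('M[F]_(2 ^ k)))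
    (D : gT -> {vspace 'M[F]_(2 ^ k)}) : Prop :=
  [/\ is_grading mulmx D,
      forall g, D g != 0%VS -> \dim (D g) = 1%N,
      is_involution star,
      stable_grading star D
    & exists (U : 'I_k -> {vspace 'M[F]_(2 ^ k)}) (H : 'I_k -> {group gT})
             (K : {group gT}),
        [/\ tensor_decomp U,
            forall i, (star @: U i <= U i)%VS,
            forall i, (H i \isog [set: 'Z_2 * 'Z_2])%g /\
              U i = (\sum_(h in H i) (U i :&: D h))%VS
          & (\big[dprod/1]_(i < k) H i)%g = K :> {set gT} /\
            (\sum_(h in K) D h)%VS = fullv]].

Definition transpose_form (s : nat) (t : (s + s).-tuple gT) : Prop :=
  exists (l : nat) (g : 'I_l -> gT) (sigma : {perm 'I_l}) (p q : 'I_l -> nat),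
    [/\ injective g,
        (\sum_(j < l) p j)%N = s /\ (\sum_(j < l) q j)%N = s,
        forall i j, (g i * g (sigma i))%g = (g j * g (sigma j))%g
      & t = flatten [seq nseq (p j) (g j) | j <- enum 'I_l] ++
            flatten [seq nseq (q (sigma j)) (g (sigma j)) | j <- enum 'I_l]
          :> seq gT].

Definition graded_supersym_iso (J : superalgebra F) (N : nat)
    (D : gT -> {vspace J}) (P : bool -> {vspace 'M[F]_N})
    (E : gT -> {vspace 'M[F]_N}) (S : {vspace 'M[F]_N}) : Prop :=
  exists f : 'Hom(J, 'M[F]_N),
    supersym_iso P S f /\ forall g, (f @: D g)%VS = (S :&: E g)%VS.

End MatrixGradings.

(* Main.v *)
(* The characters of G act on J by automorphisms. Every automorphism of P(n) is
   A |-> P A P^-1, B |-> P B P^T, C |-> P^-T C P^-1 for some invertible P, unique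
   up to sign, so the grading is encoded by matrices P_chi that commute up to
   sign and have finite order. Such a family is conjugate to X_chi (x) L_chi with
   X_chi a product of k-fold tensor products of the Pauli matrices diag(1,-1) and
   the swap, and L_chi diagonal. In this basis the algebra of all n x n matrices
   is M_{2^k} (x) M_s, the X's span the factor R = M_{2^k}, which carries the
   transposition as involution since the X's are symmetric or skew, and the
   ratios and products of the diagonal entries of L_chi are characters of the
   dual group, i.e., they come from elements of G that define the elementary
   grading of T = M_{s,s}. *)

From HB Require Import structures.
Require Import Defs.
From mathcomp Require Import all_boot all_order all_algebra all_fingroup.
From mathcomp Require Import abelian cyclic cyclotomic falgebra mxtens separable.

Set Implicit Arguments.
Unset Strict Implicit.
Unset Printing Implicit Defensive.

Import GRing.Theory.
Local Open Scope ring_scope.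

(** * Matrices of finite order and characters *)

(** The sign ambiguity of P_chi is the obstacle: the matrices form only a projective family, so they
    cannot be diagonalized together. It also explains the exponent 4|G|: P_chi^|G| acts trivially
    and so is 1 or -1, and the factor 4 leaves room for the identity (xy)^4 = x^4 y^4 for matrices
    that commute up to sign. A noncommuting pair becomes a Pauli pair after division by square roots
    of the squares, chosen as polynomials in these squares so that they commute with the whole
    family. The same Pauli factor acts on both halves of T because a Pauli matrix equals its inverse
    transpose; only the diagonal factor is inverted there, whence the constancy of the products g_j
    g_{i_j}. The dual group is not formed: finitely many characters that separate the points of G
    suffice, and group elements with given character values are found as degrees of joint
    eigenvectors in J. The exponent vectors must span F_2^(2k), since this makes the homomorphism
    from F_2^(2k) to G injective and hence the grading of R fine. *)

Section FiniteOrder.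
Variables (F : closedFieldType) (charF : [pchar F] =i pred0).

Lemma natr_neq0 N : (0 < N)%N -> N%:R != 0 :> F.
Proof. by rewrite lt0n; move/pcharf0P: charF => ->. Qed.

Lemma unity_roots N : (0 < N)%N ->
  exists2 rs : seq F, uniq rs & \prod_(r <- rs) ('X - r%:P) = 'X^N - 1.
Proof.
move=> N0; have [rs] := closed_field_poly_normal ('X^N - 1 : {poly F}).
rewrite lead_coefXnsubC // scale1r => rsE; exists rs; last by rewrite rsE.
by rewrite -separable_prod_XsubC -rsE separable_Xn_sub_1 // natr_neq0.
Qed.

(** The minimal polynomial divides X^N - 1, which is a product of distinct linear factors. *)
Lemma diagonalizable_unity n (A : 'M[F]_n) N : (0 < N)%N -> A ^+ N = 1 ->
  diagonalizable A.
Proof.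
case: n A => [|n] A N0 AN; first by rewrite [A]flatmx0; exact: diagonalizable0.
have [rs urs rsE] := unity_roots N0.
apply/diagonalizableP; exists rs => //; rewrite rsE.
by apply: mxminpoly_min; rewrite rmorphB rmorphXn /= horner_mx_X rmorph1 AN subrr.
Qed.

Lemma codiagonalize_unity (I : finType) n (A : I -> 'M[F]_n) N : (0 < N)%N ->
    (forall i, A i ^+ N = 1) -> (forall i j, A i *m A j = A j *m A i) ->
  exists2 E : 'M[F]_n, E \in unitmx &
    exists d : I -> 'rV[F]_n, forall i, E *m A i = diag_mx (d i) *m E.
Proof.
move=> N0 AN AC.
have [] : codiagonalizable [seq A i | i <- enum I].
  apply/codiagonalizableP; split=> [_ _ /mapP[i _ ->] /mapP[j _ ->]|_ /mapP[i _ ->]].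
    exact: AC.
  exact: diagonalizable_unity (AN i).
move=> E Eu /allP /= Ed; exists E => //.
have Ed' i : {d : 'rV[F]_n | E *m A i == diag_mx d *m E}.
  apply: sigW; have /Ed /diagonalizable_forPex[d] : A i \in [seq A i | i <- enum I].
    by apply: map_f; rewrite mem_enum.
  by move=> /(simmxPp (stablemx_unit (A i) Eu)) h; exists d; apply/eqP.
by exists (fun i => sval (Ed' i)) => i; apply/eqP; exact: svalP (Ed' i).
Qed.

Lemma poly_interpolation (rs : seq F) (f : F -> F) : uniq rs ->
  exists p : {poly F}, {in rs, forall r, p.[r] = f r}.
Proof.
elim: rs => [|r rs IH] /=; first by exists 0.
case/andP=> rrs /IH[p pE]; pose v := \prod_(z <- rs) ('X - z%:P).
have vr : v.[r] != 0 by rewrite -/(root v r) root_prod_XsubC.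
exists (p + ((f r - p.[r]) / v.[r]) *: v) => z; rewrite inE.
have [-> _|_ /= zrs] := eqVneq z r.
  by rewrite hornerD hornerZ divfK // addrC subrK.
have /rootP v0 : root v z by rewrite root_prod_XsubC.
by rewrite hornerD hornerZ v0 mulr0 addr0 pE.
Qed.

(* The root is a polynomial in [A], so that it is central when [A] is. *)
Lemma sqrt_unity n (A : 'M[F]_n.+1) N : (0 < N)%N -> A ^+ N = 1 ->
  exists p : {poly F}, horner_mx A p ^+ 2 = A.
Proof.
move=> N0 AN; have [rs urs rsE] := unity_roots N0.
have sq (x : F) : {y | y ^+ 2 == x}.
  apply: sigW; have /closed_rootP[y] : size ('X^2 - x%:P) != 1%N.
    by rewrite size_XnsubC.
  by move/rootP; rewrite !hornerE => /eqP; rewrite subr_eq0; exists y.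
(* [p] sends every N-th root of unity to a chosen square root of it; hence X^N - 1, which
   annihilates [A], divides p^2 - X. *)
have [p pE] := poly_interpolation (fun x => sval (sq x)) urs.
exists p; rewrite -rmorphXn /=; apply/eqP;
  rewrite -subr_eq0 -[X in _ - X]horner_mx_X -rmorphB /=.
have : 'X^N - 1 %| p ^+ 2 - 'X.
  rewrite -rsE; apply: uniq_roots_dvdp; last by rewrite uniq_rootsE.
  apply/allP => r /pE pr; apply/rootP; rewrite !hornerE pr.
  by rewrite (eqP (svalP (sq r))) subrr.
case/dvdpP=> q ->; rewrite rmorphM /= rmorphB rmorphXn /= horner_mx_X rmorph1 AN subrr.
by rewrite mulr0.
Qed.

End FiniteOrder.

(** The regular representation consists of commuting matrices of finite order. Its diagonal entries
    in a common eigenbasis are characters, and they separate points because the representation is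
    faithful. *)
Lemma separating_characters (F : closedFieldType) (gT : finGroupType) :
    [pchar F] =i pred0 -> abelian [set: gT] ->
  exists (m : nat) (chi : 'I_m -> gT -> F),
    [/\ forall i g h, chi i (g * h)%g = chi i g * chi i h,
        forall i, chi i 1%g = 1
      & forall g h, (forall i, chi i g = chi i h) -> g = h].
Proof.
move=> charF abG; pose n := #|gT|.
pose T (g : gT) : 'M[F]_n :=
  \matrix_(i, j) ((enum_val i * g)%g == enum_val j)%:R.
have TM g h : T (g * h)%g = T g *m T h.
  apply/matrixP=> i j; rewrite !mxE (bigD1 (enum_rank (enum_val i * g)%g)) //=.
  rewrite big1 ?addr0 => [|l nl]; last first.
    rewrite mxE; case: ((enum_val i * g)%g =P enum_val l) nl => [->|_ _].
      by rewrite enum_valK eqxx.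
    by rewrite mul0r.
  by rewrite !mxE enum_rankK eqxx mul1r mulgA.
have T1 : T 1%g = 1.
  by apply/matrixP=> i j; rewrite !mxE mulg1 (inj_eq enum_val_inj).
have TX g k : T (g ^+ k)%g = T g ^+ k.
  by elim: k => [|k IH]; rewrite ?expg0 ?expr0 // expgS exprS TM IH.
have TN g : T g ^+ #|[set: gT]| = 1.
  by rewrite -TX expg_cardG ?inE.
have TC g h : T g *m T h = T h *m T g.
  by rewrite -!TM (centsP abG) ?inE.
have [E Eu [d Ed]] := codiagonalize_unity charF (cardG_gt0 [set: gT]) TN TC.
have dE g : diag_mx (d g) = E *m T g *m invmx E by rewrite Ed mulmxK.
exists n, (fun i g => d g 0 i); split=> [i g h|i|g h gh].
- have /matrixP/(_ i i) : diag_mx (d (g * h)%g) = diag_mx (d g) *m diag_mx (d h).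
    by rewrite [LHS]dE TM !mulmxA Ed [diag_mx (d h)]dE !mulmxA.
  by rewrite mulmx_diag !mxE !eqxx !mulr1n.
- have /matrixP/(_ i i) : diag_mx (d 1%g) = 1%:M by rewrite dE T1 mulmx1 mulmxV.
  by rewrite !mxE !eqxx !mulr1n.
have : T g = T h.
  have dgh : d g = d h by apply/rowP.
  by apply: (can_inj (mulKmx Eu)); rewrite !Ed dgh.
move/matrixP/(_ (enum_rank 1%g) (enum_rank g)); rewrite !mxE !enum_rankK !mul1g eqxx.
by case: eqP => // _ /eqP; rewrite oner_eq0.
Qed.

(** Lets a function built in the middle of a proof be used as a linear map. *)
Definition pack_linear (F : fieldType) (U V : lmodType F) (f : U -> V)
    (lf : linear f) : {linear U -> V} :=
  HB.pack f (GRing.isLinear.Build F U V _ f lf).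

(** * Automorphisms of P(n) *)

Section SymmetricMatrices.
Variables (F : closedFieldType) (n : nat).
Hypothesis two_neq0 : 2%:R != 0 :> F.
Implicit Types (A B C M : 'M[F]_n) (x u : 'rV[F]_n).

Lemma half_double (V : lmodType F) (v w : V) : v + v = w + w -> v = w.
Proof.
move=> h; apply: (scalerI two_neq0).
by rewrite !scaler_nat !mulr2n.
Qed.

Lemma sum_delta_sym C : C^T = C -> C + C =
  \sum_i \sum_j C i j *: ((delta_mx 0 i : 'rV_n)^T *m (delta_mx 0 j : 'rV_n)
                          + (delta_mx 0 j : 'rV_n)^T *m (delta_mx 0 i : 'rV_n)).
Proof.
move=> Csym; rewrite -[X in _ + X]Csym {1 2}(matrix_sum_delta C) linear_sum
  -big_split /=.
apply: eq_bigr => i _; rewrite linear_sum -big_split /=; apply: eq_bigr => j _.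
by rewrite linearZ /= !trmx_delta !mul_delta_mx scalerDr.
Qed.

(** Polarization: when 2 is invertible, the squares x^T x span the symmetric matrices. *)
Lemma sym_rank1_ext (f g : {linear 'M[F]_n -> 'M[F]_n}) :
  (forall x, f (x^T *m x) = g (x^T *m x)) -> forall C, C^T = C -> f C = g C.
Proof.
move=> fg C Csym; apply: half_double; rewrite -!linearD (sum_delta_sym Csym).
have fg2 x y : f (x^T *m y + y^T *m x) = g (x^T *m y + y^T *m x).
  have := fg (x + y); rewrite [(x + y)^T]raddfD /= mulmxDl !mulmxDr.
  rewrite [y^T *m x + _]addrC addrACA !(linearD f) !(linearD g) /= !fg.
  exact: addrI.
rewrite !linear_sum; apply: eq_bigr => i _; rewrite !linear_sum; apply: eq_bigr => j _.
by rewrite 2!linearZ fg2.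
Qed.

Lemma sym_form_eq0 C : C^T = C -> (forall x, x *m C *m x^T = 0) -> C = 0.
Proof.
move=> Csym xC; apply/matrixP=> i j; apply: (@half_double F^o); rewrite mxE addr0.
have h (x y : 'rV_n) : x *m C *m y^T + y *m C *m x^T = 0.
  have := xC (x + y); rewrite [(x + y)^T]raddfD /= !mulmxDl !mulmxDr !xC add0r addr0.
  by [].
have /matrixP/(_ 0 0) := h (delta_mx 0 i) (delta_mx 0 j).
by rewrite -!rowE !trmx_delta -!colE !mxE -[in C j i]Csym mxE.
Qed.

(* Embeds the skew matrices into the symmetric ones with zero diagonal, which
   shows that the symmetric matrices cannot be embedded into the skew ones. *)
Definition mirror M : 'M[F]_n :=
  \matrix_(i, j) if (i < j)%N then M i j else if (j < i)%N then M j i else 0.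

Lemma mirror_linear : linear mirror.
Proof.
move=> c A B; apply/matrixP=> i j; rewrite !mxE.
by case: ltnP => // _; case: ltnP => // _; rewrite mulr0 addr0.
Qed.

Lemma mirror_sym M : (mirror M)^T = mirror M.
Proof. by apply/matrixP=> i j; rewrite !mxE; case: ltngtP. Qed.

Lemma mirror_skew_eq0 B : B^T = - B -> mirror B = 0 -> B = 0.
Proof.
move=> Bskew /matrixP B0; apply/matrixP=> i j; rewrite mxE.
have Bji k l : B k l = - B l k by have /matrixP/(_ l k) := Bskew; rewrite !mxE.
have := B0 i j; rewrite !mxE; case: ltngtP => [//|_ Bji0|/val_inj -> _].
  by rewrite Bji Bji0 oppr0.
by apply: (@half_double F^o); rewrite [X in _ + X]Bji subrr addr0.
Qed.

Lemma sym_split A B : A^T = A -> B^T = - B -> A + B = 0 -> A = 0 /\ B = 0.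
Proof.
move=> As Bs AB; have /eqP := AB; rewrite addr_eq0 => /eqP AE.
have BB : B = - B by rewrite -Bs -[LHS]opprK -AE -As AE linearN /= opprK.
have B0 : B = 0 by apply: half_double; rewrite addr0 {2}BB subrr.
by rewrite AE B0 oppr0.
Qed.

(** An injective endomorphism of a finite-dimensional space is onto. To apply this to the full
    matrix space, [h] on the symmetric part is completed by the identity on the skew part. *)
Lemma sym_sum_skew_surj (h : {linear 'M[F]_n -> 'M[F]_n}) :
    (forall C, C^T = C -> (h C)^T = h C) ->
    (forall C, C^T = C -> h C = 0 -> C = 0) ->
  forall C, C^T = C -> exists2 M, M^T = M & h M = C.
Proof.
move=> hsym hinj C Csym.
have Gl : linear (fun M : 'M[F]_n => h (M + M^T) + (M - M^T)).
  move=> c A B /=; rewrite [(c *: A + B)^T]linearP /= [c *: A + B + _]addrACA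
    -scalerDr linearP /=.
  by rewrite opprD -scalerN [c *: A + B + _]addrACA -scalerDr [c *: (h _ +
    _)]scalerDr addrACA.
pose G := linfun (pack_linear Gl).
have GE M : G M = h (M + M^T) + (M - M^T) by rewrite lfunE.
have symD M : (M + M^T)^T = M + M^T by rewrite linearD /= trmxK addrC.
have skewB M : (M - M^T)^T = - (M - M^T) by rewrite linearB /= trmxK opprB.
have GT : limg G = fullv.
  apply: lker0_limgf; rewrite -subv0; apply/subvP=> M;
    rewrite memv_ker memv0 GE => /eqP.
  case/(sym_split (hsym _ (symD M)) (skewB M)) => /(hinj _ (symD M)) + /eqP.
  rewrite subr_eq0 => M0 /eqP MT; apply/eqP/half_double.
  by rewrite addr0 {2}MT.
have /memv_imgP[M _] : C \in limg G by rewrite GT memvf.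
rewrite GE => CE; exists (M + M^T) => //.
have [] := @sym_split (h (M + M^T) - C) (M - M^T) => //.
- by rewrite linearB /= hsym // Csym.
- by rewrite addrAC -CE subrr.
by move/eqP; rewrite subr_eq0 => /eqP.
Qed.

(** If [f] were injective, [mirror] after [f] would be an injective, hence surjective, endomorphism
    of the symmetric matrices; but its values have zero diagonal, so it misses the identity
    matrix. *)
Lemma sym_skew_not_injective (f : {linear 'M[F]_n -> 'M[F]_n}) : (0 < n)%N ->
    (forall C, C^T = C -> (f C)^T = - f C) ->
  ~ (forall C, C^T = C -> f C = 0 -> C = 0).
Proof.
move=> n0 fskew f_inj; pose h := (pack_linear mirror_linear \o f)%FUN.
have hsym C : C^T = C -> (h C)^T = h C by move=> _; exact: mirror_sym.
have hinj C : C^T = C -> h C = 0 -> C = 0.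
  by move=> Cs /(mirror_skew_eq0 (fskew _ Cs)); exact: f_inj.
have [M _ /matrixP/(_ (Ordinal n0) (Ordinal n0))] := sym_sum_skew_surj hsym hinj
  (trmx1 _ _).
by rewrite !mxE ltnn eqxx => /eqP; rewrite eq_sym oner_eq0.
Qed.

Lemma row_square_ext m (x y : 'rV[F]_m) : x^T *m x = y^T *m y -> x = y \/ x = - y.
Proof.
move=> /matrixP xy; have sq i j : x 0 i * x 0 j = y 0 i * y 0 j.
  by have := xy i j; rewrite !mxE !big_ord1 !mxE.
have [y0|/eqP/rowP] := altP (y =P 0).
  left; apply/rowP=> i; apply/eqP; rewrite y0 mxE -[_ == 0]orbb -mulf_eq0 sq.
  by rewrite y0 mxE mul0r.
move=> ny0; have [a ya] : exists a, y 0 a != 0.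
  apply/existsP; apply: contra_notT ny0 => /existsPn y0 i.
  by rewrite mxE; apply/eqP/negPn/y0.
have /eqP : x 0 a ^+ 2 = y 0 a ^+ 2 by rewrite !expr2 sq.
rewrite eqf_sqr => /orP[] /eqP xa; [left|right]; apply/rowP=> i.
  by apply: (mulfI ya); rewrite -{1}xa sq.
by rewrite mxE; apply: (mulfI ya); rewrite mulrN -sq xa mulNr opprK.
Qed.

(** A vector space is not the union of two proper subspaces, here the left kernels of [M] and
    [N]. *)
Lemma mul_row_eq0_or m (M N : 'M[F]_(m, n)) :
  (forall x : 'rV_m, x *m M = 0 \/ x *m N = 0) -> M = 0 \/ N = 0.
Proof.
have eq0 (K : 'M[F]_(m, n)) : (forall i, row i K = 0) -> K = 0.
  by move=> K0; apply/row_matrixP=> i; rewrite K0 row0.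
move=> MN; have [/forallP M0|/forallPn[i Mi]] := boolP [forall i, row i M == 0].
  by left; apply: eq0 => i; apply/eqP.
right; apply: eq0 => j; apply/eqP/negPn/negP => Nj.
have MNr k : row k M = 0 \/ row k N = 0 by rewrite !rowE.
case: (MNr i) => [/eqP|Ni]; first by rewrite (negPf Mi).
case: (MNr j) => [Mj|/eqP]; last by rewrite (negPf Nj).
case: (MN (delta_mx 0 i + delta_mx 0 j)); rewrite mulmxDl -!rowE ?Ni ?Mj ?addr0 ?add0r.
  by move/eqP; rewrite (negPf Mi).
by move/eqP; rewrite (negPf Nj).
Qed.

(** For C = x^T x both sides are squares of the rows xA and xB, so xA = xB or xA = -xB, with a sign
    that may depend on x. The lemma on two kernels makes the sign uniform. *)
Lemma sym_form_ext A B : (forall C, C^T = C -> A^T *m C *m A = B^T *m C *m B) ->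
  A = B \/ A = - B.
Proof.
move=> AB; have [] // := @mul_row_eq0_or n (A - B) (A + B).
- move=> x; have /AB : (x^T *m x)^T = x^T *m x by rewrite trmx_mul trmxK.
  rewrite -!mulmxA !mulmxA -!trmx_mul -!mulmxA => /row_square_ext[] xAB; [left|right].
    by rewrite mulmxBr xAB subrr.
  by rewrite mulmxDr xAB addNr.
- by move/eqP; rewrite subr_eq0 => /eqP; left.
by move/eqP; rewrite addr_eq0 => /eqP; right.
Qed.

Lemma col_ext m p (A B : 'M[F]_(m, p)) : (forall j, col j A = col j B) -> A = B.
Proof. by move=> AB; apply/matrixP=> i j; have /colP/(_ i) := AB j; rewrite !mxE. Qed.

(** With [u] not killed by psi(E_oo), column i of [P] is psi(E_io) u. If P x = 0, multiplying by
    psi(E_oi) leaves x_i psi(E_oo) u = 0, so [P] is invertible. *)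
Lemma skolem_noether (n0 : (0 < n)%N) (psi : {linear 'M[F]_n -> 'M[F]_n}) :
    (forall A B, psi (A *m B) = psi A *m psi B) ->
    (forall A, psi A = 0 -> A = 0) ->
  exists2 P : 'M[F]_n, P \in unitmx & forall A, psi A *m P = P *m A.
Proof.
move=> psiM psi_inj; pose o := Ordinal n0.
have [u pu] : exists u : 'cV[F]_n, psi (delta_mx o o) *m u != 0.
  have : psi (delta_mx o o) != 0.
    apply/eqP => /psi_inj/matrixP/(_ o o)/eqP; rewrite !mxE !eqxx oner_eq0 //.
  move=> p0; have [/forallP h|/forallPn[j]] := boolP [forall j, col j (psi (delta_mx
    o o)) == 0].
    case/eqP: p0; apply: col_ext => j; rewrite (eqP (h j)).
    by apply/colP=> i; rewrite !mxE.
  by rewrite colE => pj; exists (delta_mx j 0).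
pose P := \sum_i psi (delta_mx i o) *m u *m (delta_mx 0 i : 'rV_n).
have Pdelta (x : 'cV[F]_n) : P *m x = psi (x *m delta_mx 0 o) *m u.
  rewrite mulmx_suml {2}(matrix_sum_delta x) mulmx_suml linear_sum mulmx_suml.
  apply: eq_bigr => i _; rewrite big_ord1 -scalemxAl mul_delta_mx linearZ -scalemxAl /=.
  rewrite -mulmxA -rowE [row i x]mx11_scalar mul_mx_scalar mxE.
  by [].
exists P => [|A]; last first.
  apply: col_ext => j; rewrite !colE -!mulmxA !Pdelta.
  by rewrite mulmxA -psiM mulmxA.
rewrite -unitmx_tr -row_free_unit; apply: inj_row_free => x xP.
have Px : P *m x^T = 0 by rewrite -[P]trmxK -trmx_mul xP trmx0.
apply/rowP=> i; rewrite mxE.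
have : psi (delta_mx o i *m (x^T *m (delta_mx 0 o : 'rV_n))) *m u = 0.
  by rewrite psiM -mulmxA -Pdelta Px mulmx0.
rewrite mulmxA -[delta_mx o i](mul_delta_mx (0 : 'I_1)) -[_ *m x^T]mulmxA -rowE.
rewrite [row i _]mx11_scalar mul_mx_scalar -scalemxAl mul_delta_mx linearZ -scalemxAl
  !mxE.
by move/eqP; rewrite scaler_eq0 (negPf pu) orbF => /eqP.
Qed.

(** If L(C) = AC + CB, then L(L(C)) = A^2 C + C B^2 + 2 ACB. Intertwining the linear actions of A, B
    and of their squares therefore yields the quadratic action. *)
Lemma intertwine_square (f : {linear 'M[F]_n -> 'M[F]_n}) A B A' B' C :
    let C1 := A *m C + C *m B in
    f C1 = A' *m f C + f C *m B' ->
    f (A *m C1 + C1 *m B) = A' *m f C1 + f C1 *m B' ->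
    f (A *m A *m C + C *m (B *m B)) = A' *m A' *m f C + f C *m (B' *m B') ->
  f (A *m C *m B) = A' *m f C *m B'.
Proof.
move=> C1 f1 f2 f3; have dbl (x y : 'M[F]_n) z :
    x *m (x *m z + z *m y) + (x *m z + z *m y) *m y
    = (x *m x *m z + z *m (y *m y)) + (x *m z *m y + x *m z *m y).
  by rewrite mulmxDr mulmxDl !mulmxA -!addrA; congr (_ + _);
    rewrite addrC -addrA addrCA addrA.
apply: half_double; move: f2;
  rewrite /C1 dbl -/C1 f1 dbl linearD f3 [f (_ + _ *m B)]linearD.
by move/addrI.
Qed.

(* The restrictions of an automorphism of P(n): [psi] acts on the A-blocks and,
   say, [cb] is the B-component of the image of a C-block. *)
Section Components.
Variables psi cc cb bb bc : {linear 'M[F]_n -> 'M[F]_n}.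
Hypothesis n_gt0 : (0 < n)%N.
Hypothesis psi_jordan : forall A B,
  psi (A *m B + B *m A) = psi A *m psi B + psi B *m psi A.
Hypothesis psi_inj : forall A, psi A = 0 -> A = 0.
Hypothesis cc_sym : forall C, C^T = C -> (cc C)^T = cc C.
Hypothesis cb_skew : forall C, C^T = C -> (cb C)^T = - cb C.
Hypothesis bc_sym : forall B, B^T = - B -> (bc B)^T = bc B.
Hypothesis cc_act : forall A C, C^T = C ->
  cc (A^T *m C + C *m A) = (psi A)^T *m cc C + cc C *m psi A.
Hypothesis cb_act : forall A C, C^T = C ->
  cb (A^T *m C + C *m A) = psi A *m cb C + cb C *m (psi A)^T.
Hypothesis bc_act : forall A B, B^T = - B ->
  bc (A *m B + B *m A^T) = (psi A)^T *m bc B + bc B *m psi A.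
Hypothesis odd_inj : forall C, C^T = C -> cc C = 0 -> cb C = 0 -> C = 0.
Hypothesis odd_mul : forall B C, B^T = - B -> C^T = C ->
  psi (B *m C) = bb B *m cc C - cb C *m bc B.

Lemma psi_sq A : psi (A *m A) = psi A *m psi A.
Proof. by apply: half_double; rewrite -linearD psi_jordan. Qed.

Lemma sym_act A C : C^T = C -> (A^T *m C + C *m A)^T = A^T *m C + C *m A.
Proof. by move=> Cs; rewrite linearD /= !trmx_mul trmxK Cs addrC. Qed.

Lemma skew_act A B : B^T = - B -> (A *m B + B *m A^T)^T = - (A *m B + B *m A^T).
Proof.
by move=> Bs; rewrite linearD /= !trmx_mul trmxK Bs mulmxN mulNmx -opprD addrC.
Qed.

Lemma cc_quad A C : C^T = C -> cc (A^T *m C *m A) = (psi A)^T *m cc C *m psi A.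
Proof.
move=> Cs; apply: intertwine_square; [exact: cc_act| |].
  exact: cc_act (sym_act _ Cs).
by rewrite -!trmx_mul cc_act // psi_sq.
Qed.

Lemma cb_quad A C : C^T = C -> cb (A^T *m C *m A) = psi A *m cb C *m (psi A)^T.
Proof.
move=> Cs; apply: intertwine_square; [exact: cb_act| |].
  exact: cb_act (sym_act _ Cs).
by rewrite -!trmx_mul cb_act // psi_sq.
Qed.

Lemma bc_quad A B : B^T = - B -> bc (A *m B *m A^T) = (psi A)^T *m bc B *m psi A.
Proof.
move=> Bs; apply: intertwine_square; [exact: bc_act| |].
  exact: bc_act (skew_act _ Bs).
by rewrite -!trmx_mul bc_act // psi_sq.
Qed.

(** Congruence by a rank one matrix reduces [C] to the value of its quadratic form at [x]; most
    vanishing and scalar arguments below rest on this. *)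
Lemma rank1_form x u C : (x^T *m u)^T *m C *m (x^T *m u) = (x *m C *m x^T) 0 0 *:
  (u^T *m u).
Proof.
have -> : (x^T *m u)^T *m C *m (x^T *m u) = u^T *m ((x *m C *m x^T) *m u).
  by rewrite trmx_mul trmxK !mulmxA.
by rewrite {1}[x *m C *m x^T]mx11_scalar mul_scalar_mx scalemxAr.
Qed.

(** The kernel of [cb] on symmetric matrices is stable under C |-> A^T C A. A nonzero [C0] in it has
    a nonzero value at some x, so the kernel contains every u^T u and is everything. Thus [cb] is
    zero or injective, and injectivity is impossible as its values are skew. *)
Lemma cb_eq0 C : C^T = C -> cb C = 0.
Proof.
move=> Cs; apply/eqP/negPn/negP => /eqP cbC.
apply: (sym_skew_not_injective n_gt0 cb_skew) => C0 C0s cbC0.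
apply: sym_form_eq0 => // x; rewrite [LHS]mx11_scalar.
have [->|xC] := eqVneq ((x *m C0 *m x^T) 0 0) 0; first exact: raddf0.
case: cbC; rewrite -[RHS](scale0r C).
apply: (@sym_rank1_ext cb ( *:%R 0)) => // u /=; rewrite scale0r.
apply: (scalerI xC); rewrite scaler0 -linearZ -rank1_form cb_quad // cbC0.
by rewrite mulmx0 mul0mx.
Qed.

Lemma cc_inj C : C^T = C -> cc C = 0 -> C = 0.
Proof. by move=> Cs ccC; apply: odd_inj => //; exact: cb_eq0. Qed.

(** An injective endomorphism is onto, so 1 = psi(A) for some A, and the Jordan identity for A and 1
    reads 2 = 2 psi(1). *)
Lemma psi1 : psi 1%:M = 1%:M.
Proof.
have ker0 : lker (linfun psi) == 0%VS.
  by rewrite -subv0; apply/subvP=> A; rewrite memv_ker lfunE memv0 => /eqP/psi_inj->.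
have /memv_imgP[A _ AE] : 1%:M \in limg (linfun psi) by rewrite lker0_limgf ?memvf.
have := psi_jordan A 1%:M; rewrite lfunE in AE.
rewrite mulmx1 mul1mx linearD -AE mul1mx mulmx1 => h.
by apply: half_double.
Qed.

(* Comparing the two ways of computing [cc] on [(AB)^T C (AB)] gives the identity
   up to sign; replacing [B] by [B + 1] then rules out the minus sign. *)
Lemma psi_mul A B : psi (A *m B) = psi A *m psi B.
Proof.
have pm A' B' : psi (A' *m B') = psi A' *m psi B' \/ psi (A' *m B') = - (psi A' *m
  psi B').
  apply: sym_form_ext => C Cs.
  have [C' C's <-] := sym_sum_skew_surj cc_sym cc_inj Cs.
  have AC_sym : (A'^T *m C' *m A')^T = A'^T *m C' *m A' by rewrite !trmx_mul trmxK
    C's mulmxA.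
  rewrite -cc_quad //; have -> : (A' *m B')^T *m C' *m (A' *m B') = B'^T *m (A'^T *m
    C' *m A') *m B'.
    by rewrite trmx_mul !mulmxA.
  by rewrite !cc_quad // trmx_mul !mulmxA.
have [//|e0] := pm A B; have := pm A (B + 1%:M).
rewrite mulmxDr mulmx1 !(linearD psi) psi1 mulmxDr mulmx1 /= e0.
case=> [/addIr //|]; rewrite opprD => /addrI psiA.
have -> : A = 0.
  apply: psi_inj; apply: half_double; rewrite addr0 {2}psiA subrr //.
by rewrite !(mul0mx, linear0).
Qed.

(** Once [psi] is conjugation by [P], the map C |-> P^T cc(C) P commutes with all congruences, hence
    is a scalar, which rescaling [P] turns into 1. The images of the B-blocks are then forced by the
    product of B and C and by skewness. *)
Lemma component_conjugation : exists2 P : 'M[F]_n, P \in unitmx &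
  [/\ forall A, psi A *m P = P *m A,
      forall C, C^T = C -> cc C *m P = (invmx P)^T *m C,
      forall C, C^T = C -> cb C = 0,
      forall B, B^T = - B -> bb B *m (invmx P)^T = P *m B
    & forall B, B^T = - B -> bc B = 0].
Proof.
have [P Pu psiP] := skolem_noether n_gt0 psi_mul psi_inj.
have psiPT A : P^T *m (psi A)^T = A^T *m P^T by rewrite -!trmx_mul psiP.
pose e : 'rV[F]_n := delta_mx 0 (Ordinal n_gt0).
have ee1 : e *m e^T = 1%:M.
  by rewrite trmx_delta mul_delta_mx; apply/matrixP=> i j; rewrite !mxE !ord1.
have ee_sym : (e^T *m e)^T = e^T *m e by rewrite trmx_mul trmxK.
have ee_neq0 : e^T *m e != 0.
  by rewrite trmx_delta mul_delta_mx;
    apply/eqP=> /matrixP/(_ (Ordinal n_gt0) (Ordinal n_gt0))/eqP;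
    rewrite !mxE !eqxx oner_eq0.
have ee_form u : (e^T *m u)^T *m (e^T *m e) *m (e^T *m u) = u^T *m u.
  by rewrite rank1_form mulmxA ee1 mul1mx ee1 mxE eqxx scale1r.
(* Every u^T u is a congruence transform of e^T e, so [f] acts on all of them by the scalar it has
   on e^T e, which is itself fixed by the congruence with e^T e. *)
have [gam ccP] : exists gam, forall C, C^T = C -> P^T *m cc C *m P = gam *: C.
  pose f := (mulmxr P \o (mulmx P^T \o cc))%FUN.
  have fq A C : C^T = C -> f (A^T *m C *m A) = A^T *m f C *m A.
    move=> Cs; rewrite /f /= cc_quad // !mulmxA psiPT -!mulmxA psiP.
    by rewrite !mulmxA.
  have [g fe] : exists g, f (e^T *m e) = g *: (e^T *m e).
    by exists ((e *m f (e^T *m e) *m e^T) 0 0); rewrite -rank1_form -fq // ee_form.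
  exists g => C Cs; apply: (@sym_rank1_ext f ( *:%R g)) => // u.
  suff : f (u^T *m u) = g *: (u^T *m u) by [].
  by rewrite -{1}ee_form fq // fe -scalemxAr -scalemxAl ee_form.
have gam0 : gam != 0.
  apply: contra_neq ee_neq0 => g0; apply: cc_inj => //.
  have PuT : P^T \in unitmx by rewrite unitmx_tr.
  rewrite -[LHS](mulmxK Pu) -[_ *m P](mulKmx PuT) [P^T *m (_ *m _)]mulmxA ccP // g0
    scale0r.
  by rewrite mulmx0 mul0mx.
(* Replacing [P] by c P multiplies P^T cc(C) P by c^2, so a square root of [gam^-1] is required. *)
have /closed_rootP[c /rootP] : size ('X^2 - (gam^-1)%:P : {poly F}) != 1%N.
  by rewrite size_XnsubC.
rewrite !hornerE => /eqP; rewrite subr_eq0 => /eqP c2.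
have c0 : c != 0 by apply: contraTneq gam0 => c0;
  rewrite -[gam]invrK -c2 c0 expr0n /= invr0 eqxx.
have {gam0 gam ccP c2 psiPT P Pu psiP} [P [Pu psiP ccP]] : exists P' : 'M[F]_n, [/\
  P' \in unitmx,
    forall A, psi A *m P' = P' *m A & forall C, C^T = C -> P'^T *m cc C *m P' = C].
  exists (c *: P); split=> [|A|C Cs]; first by rewrite unitmxZ ?unitfE.
    by rewrite -scalemxAr psiP scalemxAl.
  rewrite [(c *: P)^T]linearZ /= -!scalemxAl -scalemxAr ccP // !scalerA -expr2 c2.
  by rewrite mulVf // scale1r.
have PuT : P^T \in unitmx by rewrite unitmx_tr.
have {}ccP C : C^T = C -> cc C *m P = (invmx P)^T *m C.
  by move=> Cs; rewrite -[in RHS](ccP C Cs) trmx_inv -mulmxA mulKmx // mulmxA.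
exists P => //; split=> // [|B Bs|B Bs]; first exact: cb_eq0.
  (* With C = 1 and cb(1) = 0 the odd product gives psi(B) = bb(B) cc(1), which determines bb(B). *)
  have := odd_mul Bs (trmx1 _ _); rewrite mulmx1 cb_eq0 ?trmx1 // mul0mx subr0 => psiB.
  by rewrite -psiP psiB -mulmxA ccP ?trmx1 // mulmx1.
have fB_sym : (P^T *m bc B *m P)^T = P^T *m bc B *m P.
  by rewrite !trmx_mul trmxK bc_sym // mulmxA.
suff fB0 : P^T *m bc B *m P = 0.
  rewrite -[LHS](mulmxK Pu) -[_ *m P](mulKmx PuT) [P^T *m (_ *m _)]mulmxA fB0.
  by rewrite mulmx0 mul0mx.
apply: sym_form_eq0 => // x; rewrite [LHS]mx11_scalar.
suff /eqP : (x *m (P^T *m bc B *m P) *m x^T) 0 0 *: (e^T *m e) = 0.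
  by rewrite scaler_eq0 (negPf ee_neq0) orbF => /eqP->; exact: raddf0.
(* The skew form B vanishes at e, so [bc_quad] for A = x^T e gives psi(A)^T bc(B) psi(A) = 0. After
   conjugation by [P] this is the value of P^T bc(B) P at x, times e^T e. *)
have eBe : (e *m B *m e^T) 0 0 = 0.
  apply: (@half_double F^o); rewrite addr0; apply/eqP; rewrite addr_eq0; apply/eqP.
  have : (e *m B *m e^T)^T = - (e *m B *m e^T).
    by rewrite !trmx_mul trmxK Bs mulNmx mulmxN mulmxA.
  by move: (e *m B *m e^T) => N /matrixP/(_ 0 0); rewrite !mxE.
have := bc_quad (x^T *m e) Bs.
have xe_tr : (x^T *m e)^T = e^T *m x by rewrite trmx_mul trmxK.
have {1}-> : x^T *m e = (e^T *m x)^T by rewrite -xe_tr trmxK.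
rewrite xe_tr rank1_form eBe scale0r linear0 => /esym psi0.
rewrite -rank1_form; move: (x^T *m e) psi0 => A psi0.
have -> : A^T *m (P^T *m bc B *m P) *m A = (psi A *m P)^T *m bc B *m (psi A *m P).
  by rewrite psiP trmx_mul !mulmxA.
by rewrite trmx_mul -!mulmxA [(psi A)^T *m _]mulmxA [_ *m (psi A *m P)]mulmxA psi0
  mul0mx mulmx0.
Qed.

End Components.

Lemma trpE A B C D : trp F n (block_mx A B C D) = block_mx D^T (- B^T) C^T A^T.
Proof.
by rewrite lfunE /= /trp_fun block_mxKul block_mxKur block_mxKdl block_mxKdr.
Qed.

Lemma symv_trpE A B C D :
  (block_mx A B C D \in symv (trp F n)) = [&& D == A^T, B^T == - B & C^T == C].
Proof. by rewrite -symv_tstarE !mem_symv trpE tstarE. Qed.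

Lemma mem_mxpart_block A B C D e :
  (block_mx A B C D \in mxpart F n n e) =
  if e then (A == 0) && (D == 0) else (B == 0) && (C == 0).
Proof.
by rewrite mem_mxpart block_mxKul block_mxKur block_mxKdl block_mxKdr.
Qed.

Definition even_block A : 'M[F]_(n + n) := block_mx A 0 0 A^T.
Definition odd_block B C : 'M[F]_(n + n) := block_mx 0 B C 0.
(* Conjugation by this matrix is A |-> P A P^-1, B |-> P B P^T and
   C |-> P^-T C P^-1 on the blocks, hence it commutes with [trp]. *)
Definition conj_block (P : 'M[F]_n) : 'M[F]_(n + n) := block_mx P 0 0 (invmx P)^T.

Lemma even_blockP X : X \in (symv (trp F n) :&: mxpart F n n false)%VS <->
  exists A, X = even_block A.
Proof.
rewrite -[X]submxK memv_cap symv_trpE mem_mxpart_block; split.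
  by case/andP=> /and3P[/eqP-> _ _] /andP[/eqP-> /eqP->]; eexists.
by case=> A /eq_block_mx[-> -> -> ->]; rewrite !trmx0 oppr0 !eqxx.
Qed.

Lemma odd_blockP X : X \in (symv (trp F n) :&: mxpart F n n true)%VS <->
  exists B C, [/\ B^T = - B, C^T = C & X = odd_block B C].
Proof.
rewrite -[X]submxK memv_cap symv_trpE mem_mxpart_block; split.
  case/andP=> /and3P[_ /eqP Bs /eqP Cs] /andP[/eqP-> /eqP->].
  by do 2!eexists; split; first exact: Bs; first exact: Cs.
by case=> B [C [Bs Cs /eq_block_mx[-> -> -> ->]]]; rewrite trmx0 Bs Cs !eqxx.
Qed.

Lemma even_block_linear : linear even_block.
Proof.
move=> c A B; rewrite /even_block scale_block_mx add_block_mx !scaler0 !addr0.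
by rewrite linearP.
Qed.

Lemma lower_block_linear : linear (odd_block 0).
Proof.
by move=> c A B; rewrite /odd_block scale_block_mx add_block_mx !scaler0 !addr0.
Qed.

Lemma upper_block_linear : linear (odd_block^~ 0).
Proof.
by move=> c A B; rewrite /odd_block scale_block_mx add_block_mx !scaler0 !addr0.
Qed.

Lemma odd_blockE B C : odd_block B C = odd_block B 0 + odd_block 0 C.
Proof. by rewrite /odd_block add_block_mx !addr0 add0r. Qed.

Lemma even_block0 : even_block 0 = 0.
Proof. by rewrite /even_block trmx0 -block_mx0. Qed.

Lemma odd_block0 : odd_block 0 0 = 0.
Proof. by rewrite /odd_block -block_mx0. Qed.

Lemma even_block_mul A B :
  even_block A *m even_block B + even_block B *m even_block A
  = even_block (A *m B + B *m A).
Proof.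
rewrite /even_block !mulmx_block !mul0mx !mulmx0 !addr0 !add0r add_block_mx !addr0.
by rewrite linearD /= !trmx_mul [_ + B^T *m _]addrC.
Qed.

Lemma even_odd_block_mul A B C :
  even_block A *m odd_block B C + odd_block B C *m even_block A
  = odd_block (A *m B + B *m A^T) (A^T *m C + C *m A).
Proof.
by rewrite /even_block /odd_block !mulmx_block !mul0mx !mulmx0 !addr0 !add0r
  add_block_mx !addr0.
Qed.

Lemma odd_block_mul B C B' C' : B^T = - B -> C^T = C -> B'^T = - B' -> C'^T = C' ->
  odd_block B C *m odd_block B' C' - odd_block B' C' *m odd_block B C
  = even_block (B *m C' - B' *m C).
Proof.
move=> Bs Cs Bs' Cs'; rewrite /even_block /odd_block !mulmx_block !mul0mx !mulmx0.
rewrite !addr0 !add0r opp_block_mx add_block_mx !oppr0 !addr0 linearB /= !trmx_mul.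
by rewrite Bs Cs Bs' Cs' !mulmxN opprK [- _ + _]addrC.
Qed.

Section Automorphism.
Hypothesis n_gt0 : (0 < n)%N.
Variable phi : {linear 'M[F]_(n + n) -> 'M[F]_(n + n)}.
Local Notation S e := (symv (trp F n) :&: mxpart F n n e)%VS.
Hypothesis phi_part : forall e X, X \in S e -> phi X \in S e.
Hypothesis phi_mul : forall d e X Y, X \in S d -> Y \in S e ->
  phi (X *m Y + (-1) ^+ (d && e) *: (Y *m X))
  = phi X *m phi Y + (-1) ^+ (d && e) *: (phi Y *m phi X).
Hypothesis phi_inj : forall e X, X \in S e -> phi X = 0 -> X = 0.

(** Read on blocks, the product of two even elements gives the Jordan identity for [psi], that of an
    even and an odd one the actions on B and C, and that of two odd ones, which is a commutator, the
    relation [odd_mul]. *)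
Lemma automorphism_conjugation : exists2 P : 'M[F]_n, P \in unitmx &
  forall e X, X \in S e -> phi X *m conj_block P = conj_block P *m X.
Proof.
pose psi : {linear 'M[F]_n -> 'M[F]_n} := (@ulsubmx F n n n n \o (phi \o pack_linear
  even_block_linear))%FUN.
pose cc : {linear 'M[F]_n -> 'M[F]_n} := (@dlsubmx F n n n n \o (phi \o pack_linear
  lower_block_linear))%FUN.
pose cb : {linear 'M[F]_n -> 'M[F]_n} := (@ursubmx F n n n n \o (phi \o pack_linear
  lower_block_linear))%FUN.
pose bb : {linear 'M[F]_n -> 'M[F]_n} := (@ursubmx F n n n n \o (phi \o pack_linear
  upper_block_linear))%FUN.
pose bc : {linear 'M[F]_n -> 'M[F]_n} := (@dlsubmx F n n n n \o (phi \o pack_linear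
  upper_block_linear))%FUN.
have evS A : even_block A \in S false by apply/even_blockP; exists A.
have odS B C : B^T = - B -> C^T = C -> odd_block B C \in S true.
  by move=> Bs Cs; apply/odd_blockP; exists B, C.
have sk0 : (0 : 'M[F]_n)^T = - 0 by rewrite trmx0 oppr0.
have sy0 : (0 : 'M[F]_n)^T = 0 by rewrite trmx0.
have psiE A : phi (even_block A) = even_block (psi A).
  have /even_blockP[A' E] := phi_part (evS A).
  by rewrite /psi /= E /even_block block_mxKul.
have ccE C : C^T = C -> [/\ phi (odd_block 0 C) = odd_block (cb C) (cc C),
    (cb C)^T = - cb C & (cc C)^T = cc C].
  move=> Cs; have /odd_blockP[B' [C' [Bs' Cs' E]]] := phi_part (odS _ _ sk0 Cs).
  by rewrite /cb /cc /= E /odd_block block_mxKur block_mxKdl.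
have bbE B : B^T = - B -> [/\ phi (odd_block B 0) = odd_block (bb B) (bc B),
    (bb B)^T = - bb B & (bc B)^T = bc B].
  move=> Bs; have /odd_blockP[B' [C' [Bs' Cs' E]]] := phi_part (odS _ _ Bs sy0).
  by rewrite /bb /bc /= E /odd_block block_mxKur block_mxKdl.
have even_inj A B : even_block A = even_block B -> A = B by case/eq_block_mx.
have odd_blk_inj A B A' B' : odd_block A B = odd_block A' B' -> A = A' /\ B = B'.
  by case/eq_block_mx.
have cc_act A C : C^T = C ->
    cb (A^T *m C + C *m A) = psi A *m cb C + cb C *m (psi A)^T /\
    cc (A^T *m C + C *m A) = (psi A)^T *m cc C + cc C *m psi A.
  move=> Cs; have := phi_mul (evS A) (odS _ _ sk0 Cs).
  rewrite andFb !expr0 !scale1r even_odd_block_mul mulmx0 mul0mx addr0.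
  have [-> _ _] := ccE _ (sym_act A Cs); have [-> _ _] := ccE _ Cs.
  by rewrite psiE even_odd_block_mul => /odd_blk_inj.
have bb_act A B : B^T = - B ->
    bb (A *m B + B *m A^T) = psi A *m bb B + bb B *m (psi A)^T /\
    bc (A *m B + B *m A^T) = (psi A)^T *m bc B + bc B *m psi A.
  move=> Bs; have := phi_mul (evS A) (odS _ _ Bs sy0).
  rewrite andFb !expr0 !scale1r even_odd_block_mul mulmx0 mul0mx addr0.
  have [-> _ _] := bbE _ (skew_act A Bs); have [-> _ _] := bbE _ Bs.
  by rewrite psiE even_odd_block_mul => /odd_blk_inj.
have [] := @component_conjugation psi cc cb bb bc n_gt0.
- move=> A B; apply: even_inj; rewrite -psiE -even_block_mul.
  have := phi_mul (evS A) (evS B); rewrite andbF !expr0 !scale1r => ->.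
  by rewrite !psiE even_block_mul.
- move=> A A0; have := phi_inj (evS A); rewrite psiE A0 even_block0.
  by move=> /(_ erefl); rewrite -even_block0 => /even_inj.
- by move=> C /ccE[].
- by move=> C /ccE[].
- by move=> B /bbE[].
- by move=> A C Cs; case: (cc_act A C Cs).
- by move=> A C Cs; case: (cc_act A C Cs).
- by move=> A B Bs; case: (bb_act A B Bs).
- move=> C Cs cc0 cb0; have [E _ _] := ccE _ Cs.
  have := phi_inj (odS _ _ sk0 Cs); rewrite E cc0 cb0 odd_block0.
  by move=> /(_ erefl); rewrite -odd_block0 => /odd_blk_inj[].
- move=> B C Bs Cs; have := phi_mul (odS _ _ Bs sy0) (odS _ _ sk0 Cs).
  rewrite andbT !expr1 !scaleN1r odd_block_mul // mul0mx subr0 psiE.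
  have [-> bbs bcs] := bbE _ Bs; have [-> cbs ccs] := ccE _ Cs.
  by rewrite odd_block_mul // => /even_inj.
move=> P Pu [psiP ccP cb0 bbP bc0]; exists P => // -[] X.
  case/odd_blockP=> B [C [Bs Cs ->]].
  rewrite odd_blockE linearD mulmxDl mulmxDr.
  have [-> _ _] := bbE _ Bs; have [-> _ _] := ccE _ Cs.
  rewrite bc0 // cb0 //.
  rewrite /odd_block /conj_block !mulmx_block !mul0mx !mulmx0 !addr0 !add0r.
  by rewrite bbP // ccP.
case/even_blockP=> A ->;
  rewrite psiE /even_block /conj_block !mulmx_block !mul0mx !mulmx0.
rewrite !addr0 !add0r psiP; congr block_mx.
rewrite -!trmx_mul; congr (_^T);
  by rewrite -[psi A](mulmxK Pu) psiP !mulmxA mulVmx // mul1mx.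
Qed.

End Automorphism.

End SymmetricMatrices.

(** * Matrices that commute up to sign *)

Section SignCommutation.
Variable R : pzRingType.
Implicit Types x y z : R.

Definition sign_comm x y := x * y = y * x \/ x * y = - (y * x).

Lemma sign_commC x y : sign_comm x y -> sign_comm y x.
Proof. by case=> xy; rewrite /sign_comm xy; [left|right; rewrite opprK]. Qed.

Lemma sign_commMl x y z : sign_comm x z -> sign_comm y z -> sign_comm (x * y) z.
Proof.
rewrite /sign_comm -mulrA => xz [->|->]; rewrite ?mulrN mulrA; case: xz => ->;
  rewrite ?mulNr ?opprK -?mulrA; by [left|right].
Qed.

Lemma sign_commXl x y n : sign_comm x y -> sign_comm (x ^+ n) y.
Proof.
move=> xy; elim: n => [|n IH]; last by rewrite exprS; exact: sign_commMl.
by left; rewrite expr0 mul1r mulr1.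
Qed.

Lemma sign_comm_sq x y : sign_comm x y -> GRing.comm (x ^+ 2) y.
Proof.
rewrite /GRing.comm expr2 => -[xy|xy].
  by rewrite -mulrA xy !mulrA xy.
by rewrite -mulrA xy mulrN !mulrA xy mulNr opprK.
Qed.

(** (xy)^2 is x^2 y^2 up to sign, a second squaring removes the sign, and x^2 commutes with y. This
    is why the common order is taken divisible by 4. *)
Lemma sign_comm_expr4 x y : sign_comm x y -> (x * y) ^+ 4 = x ^+ 4 * y ^+ 4.
Proof.
move=> xy; have yxy : y * x * y = x * y ^+ 2 \/ y * x * y = - (x * y ^+ 2).
  by case: (sign_commC xy) => ->; rewrite ?mulNr -mulrA; [left|right].
have sq : ((x * y) ^+ 2) ^+ 2 = (x ^+ 2 * y ^+ 2) ^+ 2.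
  have -> : (x * y) ^+ 2 = x * (y * x * y) by rewrite expr2 !mulrA.
  by case: yxy => ->; rewrite ?mulrN ?sqrrN mulrA -expr2.
rewrite -[4%N]/(2 * 2)%N exprM sq exprMn_comm ?exprM //.
by apply: commrX; exact: sign_comm_sq.
Qed.

End SignCommutation.

Section PauliDecomposition.
Variables (F : closedFieldType) (charF : [pchar F] =i pred0).
Variables (n' : nat) (I : finType).
Local Notation n := n'.+1.
Local Notation M := 'M[F]_n.
Variables (P : I -> M) (N : nat).
Hypothesis N_gt0 : (0 < N)%N.
Hypothesis N4 : (4 %| N)%N.

(** Generators and exponents are indexed by all of [nat], so that a family can be extended without
    casts; values at j >= k are junk. *)
Definition pauli_word (Z Y : nat -> M) (a b : nat -> bool) k : M :=
  \prod_(j < k) (Z j ^+ a j * Y j ^+ b j).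

Definition pauli_family (Z Y : nat -> M) k :=
  (forall j, (j < k)%N -> [/\ Z j ^+ 2 = 1, Y j ^+ 2 = 1 & Z j * Y j = - (Y j * Z
    j)]) /\
  (forall j l, (j < k)%N -> (l < k)%N -> j != l ->
    [/\ GRing.comm (Z j) (Z l), GRing.comm (Y j) (Y l) & GRing.comm (Z j) (Y l)]).

(** Centrality is meant within the family [L]. The number of these indices decreases along the
    construction. *)
Definition noncentral (L : I -> M) := [pred i | [exists j, L i * L j != L j * L i]].

(* The last clause makes the exponent vectors span F_2^(2k): it exhibits a
   block triangular system among them. *)
Definition pauli_stage k (Z Y : nat -> M) (a b : I -> nat -> bool) (L : I -> M) :=
  [/\ pauli_family Z Y k,
      forall i j, (j < k)%N -> GRing.comm (L i) (Z j) /\ GRing.comm (L i) (Y j),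
      (forall i, L i ^+ N = 1) /\ (forall i j, sign_comm (L i) (L j)),
      forall i, P i = pauli_word Z Y (a i) (b i) k * L i
    & forall j c, (j < k)%N -> exists i, [/\ a i j = c, b i j = ~~ c,
        forall l, (j < l < k)%N -> a i l = false /\ b i l = false
        & i \notin noncentral L]].

Lemma noncentralPn (L : I -> M) i :
  reflect (forall j, GRing.comm (L i) (L j)) (i \notin noncentral L).
Proof.
rewrite inE negb_exists; apply: (iffP forallP) => h j; first exact/eqP/negbNE/h.
by rewrite negbK; apply/eqP/h.
Qed.

(** [S] is a polynomial in A^2, hence commutes with whatever A^2 commutes with, in particular with
    every matrix that commutes with A up to sign; and A S^-1 is an involution. *)
Lemma unity_sqrt_inverse (A : M) : A ^+ N = 1 ->
  exists S : M, [/\ S ^+ 2 = A ^+ 2, S ^+ N = 1, S \is a GRing.unit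
    & forall B, GRing.comm (A ^+ 2) B -> GRing.comm S B].
Proof.
move=> AN; have Ne : (N = 2 * (N %/ 2))%N by rewrite mulnC divnK // (dvdn_trans _ N4).
have N2 : (0 < N %/ 2)%N by rewrite divn_gt0 // dvdn_leq // (dvdn_trans _ N4).
have [|p pE] := sqrt_unity charF N2 (A := A ^+ 2); first by rewrite -exprM -Ne.
exists (horner_mx (A ^+ 2) p).
have SN : horner_mx (A ^+ 2) p ^+ N = 1 by rewrite Ne exprM pE -exprM -Ne.
split=> // [|B AB]; last exact: comm_horner_mx.
by rewrite -(@unitrX_pos _ _ N) // SN unitr1.
Qed.

Lemma anticomm_step (x y : M) : sign_comm x y ->
  x * y = (-1) ^+ (x * y != y * x) * (y * x).
Proof.
move=> xy; have [->|nxy] := eqVneq; first by rewrite expr0 mul1r.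
by case: xy nxy => ->; rewrite ?eqxx // expr1 mulN1r.
Qed.

(** The factor y^b contributes the sign that [l] lacks against [z], and z^a the one it lacks against
    [y]; hence the crossing of the exponents. *)
Lemma comm_sign_absorb (z y l : M) (a b : bool) :
    z * y = - (y * z) -> z * l = (-1) ^+ b * (l * z) ->
    y * l = (-1) ^+ a * (l * y) ->
  GRing.comm (y ^+ b * z ^+ a * l) z /\ GRing.comm (y ^+ b * z ^+ a * l) y.
Proof.
move=> zy zl yl; rewrite /GRing.comm.
have lz : l * z = (-1) ^+ b * (z * l) by rewrite zl signrMK.
have ly : l * y = (-1) ^+ a * (y * l) by rewrite yl signrMK.
have absorb (w : M) (v : M) c : w * v = (-1) ^+ c * (v * w) -> l * v = (-1) ^+ c * (v
  * l) ->
    w * l * v = v * (w * l).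
  move=> wv lv; rewrite -mulrA lv [LHS]mulrA commr_sign -[LHS]mulrA [w * (v *
    l)]mulrA wv.
  by rewrite -[(_ * (v * w)) * l]mulrA signrMK -mulrA.
split; [apply: absorb lz|apply: absorb ly].
  have -> : y ^+ b * z ^+ a * z = y ^+ b * z * z ^+ a by rewrite -!mulrA -exprSr -exprS.
  have -> : y ^+ b * z = (-1) ^+ b * (z * y ^+ b).
    by case: (b); rewrite ?expr0 ?expr1 ?mul1r ?mulr1 // zy mulN1r opprK.
  by rewrite !mulrA.
rewrite -mulrA; have -> : z ^+ a * y = (-1) ^+ a * (y * z ^+ a).
  by case: (a); rewrite ?expr0 ?expr1 ?mul1r ?mulr1 // zy mulN1r.
by rewrite [LHS]mulrA commr_sign -[LHS]mulrA; congr (_ * _);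
  rewrite !mulrA -exprSr -exprS.

Qed.

(* Two anticommuting [L i1], [L i2], divided by square roots of their squares,
   give the next pair [Z k], [Y k]; [L i1] and [L i2] become central. *)
Lemma pauli_step k Z Y a b L : pauli_stage k Z Y a b L -> (0 < #|noncentral L|)%N ->
  exists Z' Y' a' b' L', pauli_stage k.+1 Z' Y' a' b' L' /\
    (#|noncentral L'| < #|noncentral L|)%N.
Proof.
case=> [[famq famc] Lcomm [LN Lsign] PE tri] /card_gt0P[i1 nc1].
have /existsP[i2 nc12] : [exists j, L i1 * L j != L j * L i1] by [].
have L12 : L i1 * L i2 = - (L i2 * L i1).
  by case: (Lsign i1 i2) nc12 => // ->; rewrite eqxx.
have Lu i : L i \is a GRing.unit by rewrite -(@unitrX_pos _ _ N) // LN unitr1.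
have [S1 [S1q S1N S1u S1c]] := unity_sqrt_inverse (LN i1).
have [S2 [S2q S2N S2u S2c]] := unity_sqrt_inverse (LN i2).
have S1Vc B : GRing.comm (L i1 ^+ 2) B -> GRing.comm S1^-1 B.
  by move=> /S1c S1B; apply/commr_sym/commrV/commr_sym.
have S2Vc B : GRing.comm (L i2 ^+ 2) B -> GRing.comm S2^-1 B.
  by move=> /S2c S2B; apply/commr_sym/commrV/commr_sym.
have S1L i : GRing.comm S1^-1 (L i) by apply/S1Vc/sign_comm_sq/Lsign.
have S2L i : GRing.comm S2^-1 (L i) by apply/S2Vc/sign_comm_sq/Lsign.
(* S1^-1 and S2^-1 commute with the whole family, so [z] and [y] are involutions with the same
   commutation signs as [L i1] and [L i2]. *)
pose z := L i1 * S1^-1; pose y := L i2 * S2^-1.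
have S2z : GRing.comm S2^-1 z.
  by apply: commrM => //; apply/commr_sym/S1Vc/commr_sym/commrX.
have zc B : (forall i, GRing.comm (L i) B) -> GRing.comm z B.
  move=> LB; apply/commr_sym/commrM; apply/commr_sym => //.
  by apply: S1Vc; apply/commr_sym/commrX/commr_sym.
have yc B : (forall i, GRing.comm (L i) B) -> GRing.comm y B.
  move=> LB; apply/commr_sym/commrM; apply/commr_sym => //.
  by apply: S2Vc; apply/commr_sym/commrX/commr_sym.
have zsq : z ^+ 2 = 1.
  by rewrite exprMn_comm; [rewrite -S1q exprVn divrr // unitrX|apply/commr_sym].
have ysq : y ^+ 2 = 1.
  by rewrite exprMn_comm; [rewrite -S2q exprVn divrr // unitrX|apply/commr_sym].
pose bb i := L i1 * L i != L i * L i1; pose aa i := L i2 * L i != L i * L i2.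
have zL i : z * L i = (-1) ^+ bb i * (L i * z).
  by rewrite -mulrA S1L mulrA (anticomm_step (Lsign i1 i)) -/(bb i) -!mulrA.
have yL i : y * L i = (-1) ^+ aa i * (L i * y).
  by rewrite -mulrA S2L mulrA (anticomm_step (Lsign i2 i)) -/(aa i) -!mulrA.
have zy : z * y = - (y * z).
  rewrite [z * y]mulrA zL /bb nc12 expr1 mulN1r mulNr; congr (- _).
  by rewrite -[LHS]mulrA -S2z mulrA.
(* As z and y are involutions, L i = z^(aa i) y^(bb i) L' i: the exponents removed here are the ones
   appended to the Pauli word. *)
pose L' i := y ^+ bb i * z ^+ aa i * L i.
have [L'z L'y] : (forall i, GRing.comm (L' i) z) /\ (forall i, GRing.comm (L' i) y).
  by split=> i; have [] := comm_sign_absorb zy (zL i) (yL i).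
have invol (x : M) (c : bool) : x ^+ 2 = 1 -> x ^+ c * x ^+ c = 1.
  by move=> x2; case: c; rewrite ?expr0 ?mulr1 // expr1 -expr2.
have zsL i : sign_comm z (L i).
  by rewrite /sign_comm zL mulr_sign; case: (bb i); [right|left].
have ysL i : sign_comm y (L i).
  by rewrite /sign_comm yL mulr_sign; case: (aa i); [right|left].
have zsy : sign_comm z y by right.
have zcj j : (j < k)%N -> GRing.comm z (Z j) /\ GRing.comm z (Y j).
  by move=> jk; split; apply: zc => i; have [] := Lcomm i _ jk.
have ycj j : (j < k)%N -> GRing.comm y (Z j) /\ GRing.comm y (Y j).
  by move=> jk; split; apply: yc => i; have [] := Lcomm i _ jk.
pose upd T (f : nat -> T) v j := if j == k then v else f j.
have updk T (f : nat -> T) v : upd T f v k = v by rewrite /upd eqxx.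
have updlt T (f : nat -> T) v j : (j < k)%N -> upd T f v j = f j.
  by rewrite /upd => jk; rewrite ltn_eqF.
have L'central i : i \notin noncentral L -> L' i = L i /\ i \notin noncentral L'.
  move=> ci; have := ci; move/noncentralPn => Lic.
  have aa0 : aa i = false by rewrite /aa -Lic eqxx.
  have bb0 : bb i = false by rewrite /bb -Lic eqxx.
  have L'i : L' i = L i by rewrite /L' aa0 bb0 !expr0 !mul1r.
  split=> //; apply/noncentralPn => j; rewrite L'i.
  apply: commrM => //; apply: commrM; apply: commrX; apply/commr_sym.
    by apply: yc => l; apply/commr_sym.
  by apply: zc => l; apply/commr_sym.
have L'c x j : GRing.comm x y -> GRing.comm x z -> (forall i, GRing.comm x (L i)) ->
    GRing.comm x (L' j).
  by move=> xy xz xL; apply: commrM => //; apply: commrM; apply: commrX.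
have central_i1 : i1 \notin noncentral L'.
  (* L' i1 = z L i1 = L i1^2 S1^-1, and L i1^2 = S1^2. *)
  have L'1 : L' i1 = S1.
    have b1 : bb i1 = false by rewrite /bb eqxx.
    have a1 : aa i1 = true by rewrite /aa eq_sym.
    by rewrite /L' b1 a1 expr0 mul1r expr1 /z -mulrA S1L mulrA -expr2 -S1q expr2 mulrK.
  apply/noncentralPn => j; rewrite L'1; apply: L'c => [||i];
    apply/S1c/sign_comm_sq => //.
    exact: sign_commC.
  exact: sign_commC.
have central_i2 : i2 \notin noncentral L'.
  have L'2 : L' i2 = S2.
    have a2 : aa i2 = false by rewrite /aa eqxx.
    have b2 : bb i2 = true by [].
    by rewrite /L' a2 b2 expr0 mulr1 expr1 /y -mulrA S2L mulrA -expr2 -S2q expr2 mulrK.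
  apply/noncentralPn => j; rewrite L'2; apply: L'c => [||i];
    apply/S2c/sign_comm_sq => //.
    exact: sign_commC.
  exact: sign_commC.
exists (upd _ Z z), (upd _ Y y), (fun i => upd _ (a i) (aa i)), (fun i => upd _ (b i)
  (bb i)), L'.
split; last first.
  apply/proper_card/properP; split; last by exists i1.
  by apply/subsetP=> i; apply: contraLR => /L'central[].
split.
- split=> [j|j l]; rewrite !ltnS.
    rewrite leq_eqVlt => /predU1P[->|jk]; first by rewrite !updk.
    by rewrite !updlt //; exact: famq.
  rewrite [(j <= k)%N]leq_eqVlt [(l <= k)%N]leq_eqVlt.
  case/predU1P=> [->|jk] /predU1P[->|lk]; rewrite ?eqxx // => njl;
    rewrite ?updk ?updlt //.
  - by have [? ?] := zcj l lk; have [_ ?] := ycj l lk.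
  - by have [? ?] := ycj j jk; have [? _] := zcj j jk; split; apply/commr_sym.
  - exact: famc.
- move=> i j; rewrite ltnS leq_eqVlt => /predU1P[->|jk]; first by rewrite !updk.
  rewrite !updlt //; have [LZ LY] := Lcomm i j jk; have [zZ zY] := zcj j jk;
    have [yZ yY] := ycj j jk.
  by split; apply/commr_sym/L'c => [||l]; try (by apply/commr_sym); apply/commr_sym;
    case: (Lcomm l j jk).
- split=> [i|i j].
    (* Fourth powers are multiplicative up to this kind of commutation, and the fourth power of a
       word in the involutions y and z is 1. *)
    have [m Nm] : exists m, N = (4 * m)%N by exists (N %/ 4)%N; rewrite mulnC divnK.
    have wL : sign_comm (y ^+ bb i * z ^+ aa i) (L i).
      by apply: sign_commMl; apply: sign_commXl.
    rewrite Nm exprM /L' sign_comm_expr4 //.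
    have -> : (y ^+ bb i * z ^+ aa i) ^+ 4 = 1.
      rewrite sign_comm_expr4; last by apply: sign_commXl; apply/sign_commC/sign_commXl.
      rewrite -!exprM ![(nat_of_bool _ * 4)%N]mulnC -[4%N]/(2 * 2)%N -!mulnA !exprM
        ysq zsq.
      by rewrite !expr1n mulr1.
    by rewrite mul1r -exprM -Nm.
  have yz : sign_comm y z by exact: sign_commC.
  have L'sl v : sign_comm v z -> sign_comm v y -> (forall l, sign_comm v (L l)) ->
    sign_comm v (L' j).
    move=> vz vy vL; apply/sign_commC; do 2?apply: sign_commMl; try apply: sign_commXl;
      exact: sign_commC.
  have xx v : sign_comm v v by left.
  do 2?apply: sign_commMl; try apply: sign_commXl; apply: L'sl => // *;
    exact: sign_commC.
- move=> i; rewrite PE /pauli_word big_ord_recr /= !updk.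
  rewrite -[RHS]mulrA; congr (_ * _).
    by apply: eq_bigr => j _; rewrite !updlt.
  by rewrite /L' !mulrA -[_ * y ^+ _ * y ^+ _]mulrA invol // mulr1 invol // mul1r.
move=> j c; rewrite ltnS leq_eqVlt => /predU1P[->|jk].
  (* [i1] has exponents (1, 0) at the new position and [i2] has (0, 1). *)
  exists (if c then i1 else i2); rewrite !updk; split.
  - by case: c; rewrite /aa ?eqxx // eq_sym.
  - by case: c; rewrite /bb ?eqxx // eq_sym.
  - by move=> l /andP[kl]; rewrite ltnS leqNgt kl.
  - by case: c.
(* An index used at an earlier position is already central, so its exponents at the new position
   vanish; this keeps the system triangular. *)
have [i [aij bij tr ci]] := tri j c jk; exists i; rewrite !updlt //.
have [_ ci'] := L'central _ ci; split=> // l /andP[jl];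
  rewrite ltnS leq_eqVlt => /predU1P[->|lk].
  by move/noncentralPn: ci => ci; rewrite !updk /aa /bb !ci !eqxx.
by rewrite !updlt //; apply: tr; rewrite jl.
Qed.

Lemma pauli_decomposition :
    (forall i, P i ^+ N = 1) -> (forall i j, sign_comm (P i) (P j)) ->
  exists k Z Y a b L, pauli_stage k Z Y a b L /\ forall i j, GRing.comm (L i) (L j).
Proof.
move=> PN Psign.
have : pauli_stage 0 (fun=> 1) (fun=> 1) (fun _ _ => false) (fun _ _ => false) P.
  by split=> // i; rewrite /pauli_word big_ord0 mul1r.
suff steps m k Z Y a b L : (#|noncentral L| < m)%N -> pauli_stage k Z Y a b L ->
    exists k Z Y a b L, pauli_stage k Z Y a b L /\ forall i j, GRing.comm (L i) (L j).
  by apply: steps (ltnSn _).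
elim: m k Z Y a b L => // m IH k Z Y a b L; rewrite ltnS => Lm st.
have [L0|Lnc] := posnP #|noncentral L|.
  exists k, Z, Y, a, b, L; split=> // i; apply/noncentralPn.
  by rewrite (card0_eq L0).
have [Z' [Y' [a' [b' [L' [st' L'L]]]]]] := pauli_step st Lnc.
exact: IH (leq_trans L'L Lm) st'.
Qed.

End PauliDecomposition.

(** * Bit vectors and the symplectic form over F_2 *)

Section BitVectors.
Variable k : nat.
Local Notation V := {ffun 'I_k -> bool}.
Implicit Types a b c x : V.

Lemma card_bitvec : #|{: V}| = (2 ^ k)%N.
Proof. by rewrite card_ffun card_bool card_ord. Qed.

(** Rows of 2^k x 2^k matrices are labelled by bit vectors through an enumeration; only its
    bijectivity matters. *)
Definition bits (r : 'I_(2 ^ k)) : V := enum_val (cast_ord (esym card_bitvec) r).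
Definition unbits x : 'I_(2 ^ k) := cast_ord card_bitvec (enum_rank x).

Lemma bitsK : cancel bits unbits.
Proof. by move=> r; rewrite /unbits enum_valK cast_ordKV. Qed.

Lemma unbitsK : cancel unbits bits.
Proof. by move=> x; rewrite /bits cast_ordK enum_rankK. Qed.

Definition xorv a b : V := [ffun j => a j (+) b j].
Definition zerov : V := [ffun=> false].
Definition dotv a b : bool := \big[addb/false]_j (a j && b j).

Lemma xorvA : associative xorv.
Proof. by move=> a b c; apply/ffunP=> j; rewrite !ffunE addbA. Qed.

Lemma xorvC : commutative xorv.
Proof. by move=> a b; apply/ffunP=> j; rewrite !ffunE addbC. Qed.

Lemma xorvK a b : xorv (xorv a b) b = a.
Proof. by apply/ffunP=> j; rewrite !ffunE addbK. Qed.

Lemma xor0v a : xorv zerov a = a.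
Proof. by apply/ffunP=> j; rewrite !ffunE. Qed.

Lemma xorvv a : xorv a a = zerov.
Proof. by apply/ffunP=> j; rewrite !ffunE addbb. Qed.

Lemma dotvC a b : dotv a b = dotv b a.
Proof. by apply: eq_bigr => j _; rewrite andbC. Qed.

Lemma dotvDr a b c : dotv a (xorv b c) = dotv a b (+) dotv a c.
Proof. by rewrite -big_split; apply: eq_bigr => j _; rewrite ffunE andb_addr. Qed.

Lemma dotvDl a b c : dotv (xorv a b) c = dotv a c (+) dotv b c.
Proof. by rewrite dotvC dotvDr ![dotv c _]dotvC. Qed.

Lemma dotv0 a : dotv a zerov = false.
Proof. by apply: big1 => j _; rewrite ffunE andbF. Qed.

(** The standard symplectic form on F_2^(2k), which gives the commutation sign of two Pauli
    matrices. *)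
Definition sympv (v w : V * V) : bool := dotv v.1 w.2 (+) dotv v.2 w.1.

End BitVectors.

Section Pauli.
Variable R : comNzRingType.

(* The action of Z^a Y^b, for v = (a, b), on the rows w Y^x with w Z = w. *)
Definition pauli k (v : {ffun 'I_k -> bool} * {ffun 'I_k -> bool}) : 'M[R]_(2 ^ k) :=
  \matrix_(x, y) ((-1) ^+ dotv v.1 (bits x) *+ (bits y == xorv (bits x) v.2)).

End Pauli.

Lemma commr_prod_seq (R : pzRingType) (T : eqType) (r : seq T) (f : T -> R) x :
  {in r, forall j, GRing.comm x (f j)} -> GRing.comm x (\prod_(j <- r) f j).
Proof.
elim: r => [|j r IH] xf; first by rewrite big_nil; exact: commr1.
rewrite big_cons; apply: commrM; first by apply: xf; rewrite mem_head.
by apply: IH => l lr; apply: xf; rewrite inE lr orbT.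
Qed.

Lemma prod_split_comm (R : pzRingType) (T : finType) (f g : T -> R) :
    (forall j l, j != l -> GRing.comm (g j) (f l)) ->
  \prod_j f j * \prod_j g j = \prod_j (f j * g j).
Proof.
move=> fg; elim: (index_enum T) (index_enum_uniq T) => [|j r IH] /=.
  by rewrite !big_nil mulr1.
case/andP=> jr /IH rE; rewrite !big_cons -rE -!mulrA; congr (_ * _).
rewrite !mulrA; congr (_ * _); apply/esym/commr_prod_seq => l lr.
by apply: fg; apply: contraNneq jr => ->.
Qed.

(** * Simultaneous normal form of a family commuting up to sign *)

Section NormalForm.
Variables (F : closedFieldType) (charF : [pchar F] =i pred0).
Variables (n' : nat) (I : finType).
Local Notation n := n'.+1.
Local Notation M := 'M[F]_n.

Section Family.
Variables (k : nat) (Z Y : nat -> M).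
Hypothesis famZY : pauli_family Z Y k.
Local Notation V := {ffun 'I_k -> bool}.
Implicit Types a b c x : V.

Definition zword a : M := \prod_(j < k) Z j ^+ a j.
Definition yword a : M := \prod_(j < k) Y j ^+ a j.

Let Zsq (j : 'I_k) : Z j ^+ 2 = 1. Proof. by have [] := famZY.1 _ (ltn_ord j). Qed.
Let Ysq (j : 'I_k) : Y j ^+ 2 = 1. Proof. by have [] := famZY.1 _ (ltn_ord j). Qed.
Let ZY (j : 'I_k) : Z j * Y j = - (Y j * Z j).
Proof. by have [] := famZY.1 _ (ltn_ord j). Qed.
Let comms (j l : 'I_k) : j != l ->
  [/\ GRing.comm (Z j) (Z l), GRing.comm (Y j) (Y l), GRing.comm (Z j) (Y l)
   & GRing.comm (Y j) (Z l)].
Proof.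
move=> jl; have [? ? ?] := famZY.2 _ _ (ltn_ord j) (ltn_ord l) jl.
have [_ _ ?] := famZY.2 _ _ (ltn_ord l) (ltn_ord j) (contra_neq esym jl).
by split=> //; apply/commr_sym.
Qed.

Lemma exprb_involution (x : M) (c d : bool) : x ^+ 2 = 1 -> x ^+ c * x ^+ d = x ^+ (c
  (+) d).
Proof.
by move=> x2; case: c; case: d; rewrite ?expr0 ?mulr1 ?mul1r // -expr2 x2.
Qed.

Lemma ywordD a b : yword a * yword b = yword (xorv a b).
Proof.
rewrite prod_split_comm => [|j l /comms[_ c _ _]]; last first.
  by apply: commrX; apply/commr_sym/commrX/commr_sym.
by apply: eq_bigr => j _; rewrite exprb_involution // ffunE.
Qed.

Lemma yword0 : yword (zerov k) = 1.
Proof. by apply: big1 => j _; rewrite ffunE expr0. Qed.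

(** Only [Z j] and [Y j] with the same index anticommute, so moving Y^x past Z^a costs the sign of
    a.x. On a row fixed by all [Z j] this is the formula defining [pauli]. *)
Lemma yword_mul_word a b x : yword x * (\prod_(j < k) (Z j ^+ a j * Y j ^+ b j)) =
  (-1) ^+ dotv a x *: (zword a * yword (xorv x b)).
Proof.
have cX (u v : M) (c d : bool) : GRing.comm u v -> GRing.comm (u ^+ c) (v ^+ d).
  by move=> uv; apply: commrX; apply/commr_sym/commrX/commr_sym.
rewrite prod_split_comm => [|j l /comms[_ ? ? _]]; last first.
  by apply/commr_sym/commrM; apply/commr_sym; exact: cX.
have -> : zword a * yword (xorv x b) = \prod_(j < k) (Z j ^+ a j * Y j ^+ (xorv x b j)).
  by rewrite prod_split_comm => // j l /comms[_ _ _ ?]; exact: cX.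
have -> : (-1) ^+ dotv a x = \prod_(j < k) (-1) ^+ (a j && x j) :> F.
  by rewrite /dotv (big_morph (fun b : bool => (-1) ^+ b : F) (signr_addb F)
    (expr0 (-1) : (-1) ^+ false = 1 :> F)).
rewrite -scaler_prod; apply: eq_bigr => j _.
rewrite ffunE -exprb_involution // !mulrA scalerAl; congr (_ * _).
case: (a j); case: (x j); rewrite ?expr0 ?expr1 ?mul1r ?mulr1 ?scale1r //.
by rewrite ZY scaleN1r opprK.
Qed.

Lemma row_zword (u : 'rV[F]_n) a : (forall j : 'I_k, u *m Z j = u) -> u *m zword a = u.
Proof.
move=> uZ; apply: (big_ind (fun z : M => u *m z = u)) => [|x y ux uy|j _].
- exact: mulmx1.
- by rewrite mulmxA ux uy.
by case: (a j); rewrite ?expr0 ?expr1 ?mulmx1.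
Qed.

(** Consequently Y^x carries a row fixed by all [Z j] to a joint eigenvector whose pattern of signs
    is x. *)
Lemma yword_Z x (j : 'I_k) : yword x * Z j = (-1) ^+ x j *: (Z j * yword x).
Proof.
pose a : V := [ffun l => l == j].
have ZE : zword a = Z j.
  rewrite /zword (big_only1 j) // => [|l lj _]; first by rewrite ffunE eqxx.
  by rewrite ffunE (negPf lj).
have WE : \prod_(l < k) (Z l ^+ a l * Y l ^+ zerov k l) = Z j.
  by rewrite -ZE; apply: eq_bigr => l _; rewrite !ffunE expr0 mulr1.
rewrite -{1}WE yword_mul_word ZE xorvC xor0v; congr (_ *: _).
rewrite /dotv (big_only1 j) // => [|l lj _]; first by rewrite ffunE eqxx.
by rewrite ffunE (negPf lj).
Qed.

End Family.

Variables (P : I -> M) (N : nat).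
Hypothesis N_gt0 : (0 < N)%N.
Hypothesis N4 : (4 %| N)%N.
Hypothesis P_unity : forall i, P i ^+ N = 1.
Hypothesis P_sign : forall i j, sign_comm (P i) (P j).

Lemma sign_sq (K : fieldType) (x : K) : x ^+ 2 = 1 -> x = (-1) ^+ (x != 1).
Proof.
by move=> /eqP; rewrite sqrf_eq1 => /orP[] /eqP->; [rewrite eqxx|case: eqP].
Qed.

(* The rows of [Q] are w Y^x, for [w] in a basis of joint eigenvectors of the
   [L i] on the space of row vectors fixed by all [Z j]. *)
Theorem pauli_normal_form : exists k s (v : I -> {ffun 'I_k -> bool} * {ffun 'I_k ->
  bool})
    (lam : I -> 'rV[F]_s) (Q : 'M[F]_(2 ^ k * s, n)) (Q' : 'M[F]_(n, 2 ^ k * s)),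
  [/\ Q *m Q' = 1%:M, Q' *m Q = 1%:M,
      forall i, Q *m P i = (pauli F (v i) *t diag_mx (lam i)) *m Q
    & forall w, w != (zerov k, zerov k) -> exists i, sympv (v i) w].
Proof.
have [k [Z [Y [a [b [L [[fam LZY [LN _] PE tri] LC]]]]]]] :=
  pauli_decomposition charF N_gt0 N4 P_unity P_sign.
pose av i : {ffun 'I_k -> bool} := [ffun j : 'I_k => a i j].
pose bv i : {ffun 'I_k -> bool} := [ffun j : 'I_k => b i j].
pose A (x : 'I_k + I) := match x with inl j => Z j | inr i => L i end.
have Ne : (2 %| N)%N by rewrite (dvdn_trans _ N4).
have AN x : A x ^+ N = 1.
  case: x => [j|i] //=; have [Z2 _ _] := fam.1 _ (ltn_ord j).
  by rewrite -(divnK Ne) mulnC exprM Z2 expr1n.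
have AC x y : A x *m A y = A y *m A x.
  case: x y => [j|i] [l|h] /=.
  - have [->//|jl] := eqVneq j l.
    by have [] := fam.2 _ _ (ltn_ord j) (ltn_ord l) jl.
  - by have [Lj _] := LZY h j (ltn_ord j); apply/esym.
  - by have [] := LZY i l (ltn_ord l).
  - exact: LC.
have [E Eu [d Ed]] := codiagonalize_unity charF N_gt0 AN AC.
pose e r := row r E.
have rowM (u : 'rV[F]_n) (x y : M) : u *m (x * y) = u *m x *m y by rewrite mulmxA.
have eA r x : e r *m A x = d x 0 r *: e r.
  by rewrite -row_mul Ed row_mul row_diag_mx -scalemxAl -rowE.
(* The eigenvectors fixed by all [Z j] span the multiplicity space; their number becomes the size of
   the diagonal factor. *)
pose R0 := [pred r | [forall j, d (inl j) 0 r == 1]].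
pose s := #|R0|; pose w (l : 'I_s) := e (enum_val l).
have wZ l (j : 'I_k) : w l *m Z j = w l.
  have /forallP/(_ j)/eqP dj := enum_valP l.
  by have := eA (enum_val l) (inl j); rewrite /= dj scale1r.
pose yw := @yword k Y.
pose q (x : 'I_(2 ^ k)) l := w l *m yw (bits x).
pose Q := \matrix_(r < 2 ^ k * s) q (mxtens_unindex r).1 (mxtens_unindex r).2.
have Qrow x l : row (mxtens_index (x, l)) Q = q x l by rewrite rowK mxtens_indexK.
have QP i : Q *m P i = (pauli F (av i, bv i) *t diag_mx (\row_l d (inr i) 0 (enum_val
  l))) *m Q.
  apply/row_matrixP => r; case: (mxtens_indexP r) => x l; rewrite row_mul Qrow.
  rewrite row_mul [RHS]mulmx_sum_row.
  rewrite (bigD1 (mxtens_index (unbits (xorv (bits x) (bv i)), l))) //= big1 => [|r'];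
    last first.
    case: (mxtens_indexP r') => y m;
      rewrite (can_eq (@mxtens_indexK _ _)) xpair_eqE negb_and => nyl.
    rewrite mxE tensmxE !mxE /=.
    have [yE|] := eqVneq (bits y) (xorv (bits x) (bv i));
      last by rewrite mulr0n mul0r scale0r.
    by move: nyl; rewrite -yE bitsK eqxx /= eq_sym => /negPf->;
      rewrite mulr0n mulr0 scale0r.
  rewrite addr0 mxE tensmxE !mxE !unbitsK !eqxx !mulr1n /= Qrow /q unbitsK.
  have PEi : P i = (\prod_(j < k) (Z j ^+ av i j * Y j ^+ bv i j)) * L i.
    by rewrite PE; congr (_ * _); apply: eq_bigr => j _; rewrite !ffunE.
  have -> : w l *m yw (bits x) *m P i = w l *m (yw (bits x) *
      \prod_(j < k) (Z j ^+ av i j * Y j ^+ bv i j)) *m L i.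
    by rewrite PEi !rowM.
  rewrite (yword_mul_word fam) -scalemxAr rowM row_zword // -scalemxAl.
  have YL : yw (xorv (bits x) (bv i)) *m L i = L i *m yw (xorv (bits x) (bv i)).
    apply/esym/commr_prod_seq => j _; apply: commrX.
    by have [] := LZY i _ (ltn_ord j).
  by rewrite -mulmxA YL mulmxA (eA _ (inr i)) -scalemxAl scalerA.
have e_inv r : e r *m invmx E = delta_mx 0 r by rewrite /e rowE -mulmxA mulmxV //
  mulmx1.
have Z2 (j : 'I_k) : Z j * Z j = 1 by have [] := fam.1 _ (ltn_ord j); rewrite expr2.
have sgn r (j : 'I_k) : d (inl j) 0 r = (-1) ^+ (d (inl j) 0 r != 1).
  apply: sign_sq; have : e r *m Z j *m Z j = e r by rewrite -rowM Z2 mulmx1.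
  rewrite (eA r (inl j)) -scalemxAl (eA r (inl j)) scalerA -expr2 => /eqP.
  rewrite -subr_eq0 -[X in _ - X]scale1r -scalerBl scaler_eq0 subr_eq0 =>
    /orP[/eqP//|/eqP er0].
  by have /eqP := e_inv r; rewrite er0 mul0mx eq_sym => /eqP/rowP/(_ r)/eqP;
    rewrite !mxE !eqxx oner_eq0.
(* The projector onto the joint eigenspace of the [Z j] with sign pattern [bits c]. *)
pose pr (c : 'I_(2 ^ k)) : M := \prod_(j < k) (2%:R^-1 *: (1 + (-1) ^+ bits c j *: Z
  j)).
have q_pr x l c : q x l *m pr c = (x == c)%:R *: q x l.
  have two0 : 2%:R != 0 :> F by rewrite natr_neq0.
  have -> : (x == c)%:R = \prod_(j < k) (bits x j == bits c j)%:R :> F.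
    have [->|xc] := eqVneq x c; first by rewrite big1 // => j _; rewrite eqxx.
    have [j xcj] : exists j, bits x j != bits c j.
      apply/existsP; apply: contraNT xc => /existsPn h; apply/eqP/(can_inj (@bitsK k)).
      by apply/ffunP=> j; apply/eqP/negPn/h.
    by rewrite (bigD1 j) //= (negPf xcj) mul0r.
  apply: (big_rec2 (fun (z : M) t => q x l *m z = t *: q x l)) => [|j z t _ qz].
    by rewrite mulmx1 scale1r.
  rewrite rowM -scalemxAr mulmxDr mulmx1 -scalemxAr.
  have -> : q x l *m Z j = (-1) ^+ bits x j *: q x l.
    by rewrite /q -rowM (yword_Z fam) -scalemxAr rowM wZ.
  rewrite scalerA -signr_addb -[X in X + _]scale1r -scalerDl scalerA -scalemxAl qz
    mulrC scalerA.
  congr (_ * _ *: _); case: (bits x j); case: (bits c j);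
    by rewrite /= ?expr0 ?expr1 ?subrr ?mul0r // divff.
(* Column (c, m) of the inverse: project to the pattern c, undo Y^c, which is an involution, and
   read off the coordinate of [w m] in the eigenbasis. *)
pose R := \matrix_(i < n, r < 2 ^ k * s)
  ((pr (mxtens_unindex r).1 * yw (bits (mxtens_unindex r).1)) *m invmx E) i (enum_val
    (mxtens_unindex r).2).
have ywK x : yw x * yw x = 1 by rewrite (ywordD fam) xorvv yword0.
have QR : Q *m R = 1%:M.
  apply/matrixP=> r1 r2; case: (mxtens_indexP r1) => x l;
    case: (mxtens_indexP r2) => c m.
  have -> : (Q *m R) (mxtens_index (x, l)) (mxtens_index (c, m)) =
      (q x l *m (pr c *m yw (bits c) *m invmx E)) 0 (enum_val m).
    rewrite -Qrow mxE [RHS]mxE; apply: eq_bigr => i _.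
    by rewrite [row _ _ _ _]mxE [R _ _]mxE mxtens_indexK.
  rewrite !mulmxA q_pr -!scalemxAl mxE [RHS]mxE (can_eq (@mxtens_indexK _ _)) xpair_eqE.
  have [->|_] := eqVneq x c; last by rewrite mul0r.
  by rewrite mul1r /q -[w l *m _ *m _]rowM ywK mulmx1 e_inv mxE eqxx (inj_eq
    enum_val_inj) eq_sym.
have Qfull : row_full Q.
  suff EQ : (E <= Q)%MS by rewrite -sub1mx -(mulVmx Eu) mulmx_sub.
  apply/row_subP => r; rewrite -/(e r).
  (* [x] is the sign pattern of [e r]. Hence e_r Y^x is fixed by all [Z j] and combines only
     eigenvectors from [R0]; a second multiplication by Y^x returns to e_r. *)
  pose x : {ffun 'I_k -> bool} := [ffun j : 'I_k => d (inl j) 0 r != 1].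
  pose u := e r *m yw x; pose al := u *m invmx E.
  have uZ (j : 'I_k) : u *m Z j = u.
    rewrite /u -rowM (yword_Z fam) -scalemxAr rowM (eA r (inl j)) -scalemxAl sgn
      ffunE scalerA.
    by rewrite -signr_addb addbb scale1r.
  have alE : u = al *m E by rewrite mulmxKV.
  have al0 r' : r' \notin R0 -> al 0 r' = 0.
    rewrite inE negb_forall => /existsP[j dj].
    have /rowP/(_ r') : al *m diag_mx (d (inl j)) = al.
      by rewrite -[LHS](mulmxK Eu) -[al *m _ *m E]mulmxA -Ed mulmxA -alE /= uZ.
    rewrite mul_mx_diag mxE => /eqP;
      rewrite -subr_eq0 -[X in _ - X]mulr1 -mulrBr mulf_eq0.
    by rewrite subr_eq0 (negPf dj) orbF => /eqP.
  have -> : e r = u *m yw x by rewrite /u -rowM ywK mulmx1.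
  rewrite alE [al *m E]mulmx_sum_row mulmx_suml summx_sub // => r' _;
    rewrite -scalemxAl.
  have [r'0|/al0->] := boolP (r' \in R0); last by rewrite scale0r sub0mx.
  apply: scalemx_sub; have -> : row r' E *m yw x = row (mxtens_index (unbits x,
    enum_rank_in r'0 r')) Q.
    by rewrite Qrow /q unbitsK /w enum_rankK_in.
  exact: row_sub.
have RQ : R *m Q = 1%:M.
  have /row_fullP[K KQ] := Qfull.
  by rewrite -[R]mul1mx -KQ -[K *m Q *m R]mulmxA QR mulmx1 KQ.
exists k, s, (fun i => (av i, bv i)), (fun i => \row_l d (inr i) 0 (enum_val l)), Q, R.
split=> // -[x y] xy0.
have [l0 xyl0] : exists l, x l || y l.
  apply/existsP; apply: contraNT xy0 => /existsPn h; rewrite xpair_eqE.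
  by apply/andP; split; apply/eqP/ffunP=> j; move: (h j);
    rewrite negb_or ffunE => /andP[/negPf ? /negPf ?].
(* Minimality of [l] kills the terms below l, and the triangular clause those above. The exponents
   (y_l, not y_l) at l make the remaining term y_l or x_l, which is 1. *)
have [l xyl lmin] := @arg_minnP _ l0 (fun l => x l || y l) (@nat_of_ord k) xyl0.
have [i [ail bil ab0 _]] := tri l (y l) (ltn_ord l); exists i.
have away j : j != l -> (av i j && y j = false) /\ (bv i j && x j = false).
  move=> jl; case: (ltngtP j l) => [jl'|lj|/val_inj/eqP]; last by rewrite (negPf jl).
    have : ~~ (x j || y j) by apply: contraL jl' => /lmin; rewrite -leqNgt.
    by rewrite negb_or => /andP[/negPf-> /negPf->]; rewrite !andbF.
  by rewrite !ffunE; have [-> ->] := ab0 j (introT andP (conj lj (ltn_ord j))).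
rewrite /sympv /dotv /= !(big_only1 l) // => [|j jl _|j jl _];
  try by have [] := away j jl.
by rewrite !ffunE ail bil; case: (y l) xyl; rewrite ?orbF.
Qed.

End NormalForm.

(** * Pauli matrices and involution fine gradings *)

Ltac dotv_cases :=
  repeat match goal with |- context [@dotv ?k ?a ?b] => case: (@dotv k a b) end.

Section PauliMatrices.
Variables (F : fieldType) (k : nat).
Local Notation V := {ffun 'I_k -> bool}.
Local Notation W := (V * V)%type.
Local Notation X := (@pauli F k).
Implicit Types (v w : W) (i j : 'I_k) (p q : bool * bool).

Definition addw v w : W := (xorv v.1 w.1, xorv v.2 w.2).
Definition zerow : W := (zerov k, zerov k).

Lemma addww v : addw v v = zerow.
Proof. by rewrite /addw !xorvv. Qed.

Lemma addwC v w : addw v w = addw w v.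
Proof. by rewrite /addw xorvC [xorv v.2 _]xorvC. Qed.

Lemma addwA u v w : addw u (addw v w) = addw (addw u v) w.
Proof. by rewrite /addw !xorvA. Qed.

Lemma add0w v : addw zerow v = v.
Proof. by case: v => a b; rewrite /addw !xor0v. Qed.

Lemma sympvDr u v w : sympv u (addw v w) = sympv u v (+) sympv u w.
Proof. by rewrite /sympv !dotvDr; dotv_cases. Qed.

Lemma pauliM v w : X v *m X w = (-1) ^+ dotv w.1 v.2 *: X (addw v w).
Proof.
apply/matrixP=> x y; rewrite !mxE (bigD1 (unbits (xorv (bits x) v.2))) //= big1 =>
  [|z nz].
  rewrite !mxE unbitsK eqxx mulr1n addr0 -xorvA !mulrnAr; congr (_ *+ _).
  by rewrite -!signr_addb dotvDr dotvDl; congr (_ ^+ nat_of_bool _); dotv_cases.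
rewrite mxE; case: (bits z =P xorv (bits x) v.2) nz => [<-|_ _];
  first by rewrite bitsK eqxx.
by rewrite mulr0n mul0r.
Qed.

Lemma pauli0 : X zerow = 1%:M.
Proof.
apply/matrixP=> x y; rewrite !mxE dotvC dotv0 xorvC xor0v (can_eq (@bitsK k)) eq_sym.
by [].
Qed.

Lemma pauli_comm v w : X v *m X w = (-1) ^+ sympv v w *: (X w *m X v).
Proof.
rewrite !pauliM addwC scalerA -signr_addb /sympv [dotv v.2 _]dotvC.
by congr (_ ^+ nat_of_bool _ *: _); dotv_cases.
Qed.

Lemma pauli_tr v : (X v)^T = (-1) ^+ dotv v.1 v.2 *: X v.
Proof.
apply/matrixP=> x y; rewrite !mxE mulrnAr -signr_addb.
have -> : (bits x == xorv (bits y) v.2) = (bits y == xorv (bits x) v.2).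
  by apply/eqP/eqP => ->; rewrite xorvK.
by case: eqP => [->|//]; rewrite dotvDr; congr (_ ^+ nat_of_bool _ *+ _); dotv_cases.
Qed.

Lemma pauli_tr_mul v : (X v)^T *m X v = 1%:M.
Proof.
by rewrite pauli_tr -scalemxAl pauliM addww pauli0 scalerA -signr_addb addbb scale1r.
Qed.

Lemma pauli_neq0 v : X v != 0.
Proof.
apply/eqP=> X0; have := pauli_tr_mul v; rewrite X0 mulmx0.
move/matrixP/(_ (unbits (zerov k)) (unbits (zerov k)))/eqP.
by rewrite !mxE eqxx eq_sym oner_eq0.
Qed.

(** Orthogonality of characters: if x is nonzero, translating by [e] with e.x = 1 turns the sum into
    its negative. *)
Lemma sum_sign_dotv (x : V) : 2%:R != 0 :> F ->
  \sum_(a : V) (-1) ^+ dotv a x = (2 ^ k)%:R * (x == zerov k)%:R :> F.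
Proof.
move=> two0; have [->|nx] := eqVneq.
  rewrite (eq_bigr (fun=> 1)) => [|a _]; last by rewrite dotv0 expr0.
  by rewrite sumr_const card_bitvec mulr1.
have [j xj] : exists j, x j.
  by apply/existsP; apply: contraNT nx => /existsPn h; apply/eqP/ffunP=> j;
    rewrite ffunE; apply/negbTE.
pose e : V := [ffun l => l == j].
have ex : dotv e x = true.
  rewrite /dotv (big_only1 j) // => [|l lj _]; first by rewrite ffunE eqxx.
  by rewrite ffunE (negPf lj).
apply: (mulfI two0); rewrite !mulr0 mulr_natl mulr2n.
have e_inj : injective (fun a : V => xorv a e).
  by move=> a b ab; rewrite -[a](xorvK _ e) ab xorvK.
rewrite [X in X + _](reindex_inj e_inj) /= -big_split big1 // => a _.
by rewrite /= dotvDl ex signr_addb expr1 mulrN1 addNr.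
Qed.

(** Fourier inversion: for fixed b, the average of X(a, b) over a with signs (-1)^(a.x) retains only
    row x, whose single entry is in column x + b. *)
Lemma pauli_span : 2%:R != 0 :> F -> (\sum_v <[X v]>)%VS = fullv.
Proof.
move=> two0; apply/eqP; rewrite eqEsubv subvf; apply/subvP=> A _;
  rewrite (matrix_sum_delta A).
apply: memv_suml => x _; apply: memv_suml => y _; apply: memvZ.
pose b := xorv (bits x) (bits y).
have -> : delta_mx x y = \sum_(a : V) ((2 ^ k)%:R^-1 * (-1) ^+ dotv a (bits x)) *: X
  (a, b).
  apply/matrixP=> x' y'; rewrite mxE summxE.
  under eq_bigr => a _ do rewrite !mxE /= mulrnAr -mulrA -signr_addb -dotvDr -mulrnAr.
  rewrite -mulr_sumr sumrMnl sum_sign_dotv // -mulrnAr mulrA mulVf ?mul1r; last first.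
    by rewrite natrX expf_neq0.
  have -> : (xorv (bits x) (bits x') == zerov k) = (x' == x).
    rewrite -(can_eq (@bitsK k)); apply/eqP/eqP => [xx|->]; last exact: xorvv.
    by rewrite -[RHS](xorvK _ (bits x')) xx xor0v.
  have [->|] := eqVneq x' x; last by rewrite mul0rn.
  rewrite /b xorvA xorvv xor0v (can_eq (@bitsK k)); by case: eqP.
apply: memv_suml => a _; apply: memvZ; apply: (sumv_sup (a, b)) => //; exact: memv_line.
Qed.

End PauliMatrices.

Lemma memv_sum_lines (F : fieldType) (vT : vectType F) (T : finType) (A : pred T)
    (e : T -> vT) (x : vT) :
  x \in (\sum_(t | A t) <[e t]>)%VS -> exists c : T -> F, x = \sum_(t | A t) c t *: e t.
Proof.
case/memv_sumP=> u ue ->.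
have c t : {a | A t ==> (u t == a *: e t)}.
  apply: sigW; case: (boolP (A t)) => [/ue/vlineP[a ->]|_]; first by exists a;
    rewrite eqxx.
  by exists 0.
by exists (fun t => sval (c t)); apply: eq_bigr => t /(implyP (svalP (c t)))/eqP.
Qed.

(** Exhibits a noncommutative product as linear in one chosen factor. *)
Lemma prod_update_linear (R : pzRingType) (T : finType) (t : T) (f : T -> R) :
  exists L M, forall x, \prod_i (if i == t then x else f i) = L * x * M.
Proof.
have := mem_index_enum t; move: (index_enum_uniq T).
elim: (index_enum T) => //= i r IH /andP[ir ur]; rewrite inE => /predU1P[ti|tr].
  rewrite -ti in ir *; exists 1, (\prod_(j <- r) f j) => x;
    rewrite big_cons eqxx mul1r; congr (_ * _).
  rewrite big_seq [RHS]big_seq; apply: eq_bigr => j jr.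
  by case: eqP jr => // -> tr; rewrite tr in ir.
have [L [M LM]] := IH ur tr; exists (f i * L), M => x.
rewrite big_cons LM; case: eqP => [it|_]; last by rewrite !mulrA.
by rewrite it tr in ir.
Qed.

Section FineGrading.
Variables (F : fieldType) (k : nat) (gT : finGroupType).
Hypothesis two0 : 2%:R != 0 :> F.
Local Notation V := {ffun 'I_k -> bool}.
Local Notation W := (V * V)%type.
Local Notation X := (@pauli F k).
Hypothesis abG : abelian [set: gT].
Variable h : W -> gT.
Hypothesis hD : forall v w, h (addw v w) = (h v * h w)%g.
Hypothesis h_inj : injective h.
Implicit Types (v w : W) (i j : 'I_k) (p q : bool * bool).

Definition pauli_grading (g : gT) : {vspace 'M[F]_(2 ^ k)} :=
  (\sum_(v | h v == g) <[X v]>)%VS.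

Definition transposition : 'End('M[F]_(2 ^ k)) := linfun trmx.

Lemma transpositionE A : transposition A = A^T.
Proof. exact: lfunE. Qed.

Lemma pauli_in_grading v : X v \in pauli_grading (h v).
Proof. by apply: (sumv_sup v) => //; exact: memv_line. Qed.

Lemma pauli_grading_line v : pauli_grading (h v) = <[X v]>%VS.
Proof. by rewrite /pauli_grading (eq_bigl _ _ (fun w => inj_eq h_inj w v))
  big_pred1_eq. Qed.

Lemma pauli_grading_sum : (\sum_g pauli_grading g)%VS = fullv.
Proof.
apply/eqP; rewrite eqEsubv subvf -(pauli_span k two0); apply/subv_sumP => v _.
by apply: (sumv_sup (h v)) => //; rewrite pauli_grading_line.
Qed.

Lemma pauli_grading_dim g : \dim (pauli_grading g) = #|[pred v | h v == g]|.
Proof.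
have [v hv|h0] := pickP [pred v | h v == g].
  rewrite -(eqP hv) pauli_grading_line dim_vline pauli_neq0.
  by rewrite (eq_card (fun w => inj_eq h_inj w v)) card1.
by rewrite /pauli_grading big_pred0 // dimv0 eq_card0.
Qed.

Lemma pauli_gradingP : is_grading mulmx pauli_grading.
Proof.
split=> [||g g' x y]; first exact: pauli_grading_sum.
  (* Directness by counting: the dimensions of the components add up to the number 4^k of Pauli
     matrices, which is the dimension of the algebra. *)
  rewrite directvEgeq /= pauli_grading_sum dimvf /dim /=.
  under eq_bigr do rewrite pauli_grading_dim.
  have -> : (\sum_g #|[pred v | h v == g]| = #|{: W}|)%N.
    rewrite -[RHS]sum1_card (partition_big h predT) //=; apply: eq_bigr => g _.
    by rewrite -sum1_card.
  by rewrite card_prod !card_bitvec.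
case/memv_sum_lines=> c -> /memv_sum_lines[d ->].
rewrite mulmx_suml; apply: memv_suml => v /eqP hv.
rewrite mulmx_sumr; apply: memv_suml => w /eqP hw.
rewrite -scalemxAl -scalemxAr; do 2!apply: memvZ.
by rewrite pauliM; apply: memvZ; rewrite -hv -hw -hD pauli_in_grading.
Qed.

Lemma transposition_stable : stable_grading transposition pauli_grading.
Proof.
move=> g; rewrite limg_sum; apply/subv_sumP => v /eqP hv.
by rewrite limg_line transpositionE pauli_tr -memvE; apply: memvZ;
  rewrite -hv pauli_in_grading.
Qed.

(** The hyperbolic plane at coordinate [i]; its four vectors index the Pauli matrices of the i-th
    tensor factor. *)
Definition plane i p : W := ([ffun j => (j == i) && p.1], [ffun j => (j == i) && p.2]).

Lemma planeD i p q : addw (plane i p) (plane i q) = plane i (p.1 (+) q.1, p.2 (+) q.2).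
Proof.
by congr (_, _); apply/ffunP=> j; rewrite !ffunE /=; case: (j == i).
Qed.

Lemma plane_inj i : injective (plane i).
Proof.
move=> [p1 p2] [q1 q2] [/ffunP/(_ i) + /ffunP/(_ i)].
by rewrite !ffunE eqxx /= => -> ->.
Qed.

Lemma plane0 i : plane i (false, false) = zerow k.
Proof. by congr (_, _); apply/ffunP=> j; rewrite !ffunE andbF. Qed.

Definition plane_space i : {vspace 'M[F]_(2 ^ k)} := (\sum_p <[X (plane i p)]>)%VS.

Lemma mem_plane_space i p : X (plane i p) \in plane_space i.
Proof. by apply: (sumv_sup p) => //; exact: memv_line. Qed.

Lemma hset_group (A : {set W}) : zerow k \in A ->
  (forall v w, v \in A -> w \in A -> addw v w \in A) -> group_set [set h v | v in A].
Proof.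
move=> A0 AD; apply/group_setP; split.
  apply/imsetP; exists (zerow k) => //; apply: (mulgI (h (zerow k))).
  by rewrite mulg1 -hD add0w.
move=> _ _ /imsetP[v Av ->] /imsetP[w Aw ->]; rewrite -hD.
by apply/imset_f/AD.
Qed.

Lemma plane_set_group i : group_set [set h v | v in [set plane i p | p : bool * bool]].
Proof.
apply: hset_group; first by apply/imsetP; exists (false, false); rewrite ?plane0.
move=> _ _ /imsetP[p _ ->] /imsetP[q _ ->]; rewrite planeD.
exact: imset_f.
Qed.

Definition plane_group i : {group gT} := Group (plane_set_group i).

Lemma all_set_group : group_set [set h v | v in [set: W]].
Proof. by apply: hset_group; rewrite ?inE // => v w; rewrite !inE. Qed.

Definition support_group : {group gT} := Group all_set_group.

Lemma abelian_sub (A : {group gT}) : abelian A.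
Proof. exact: abelianS (subsetT _) abG. Qed.

Lemma plane_group_isog i : (plane_group i \isog [set: 'Z_2 * 'Z_2])%g.
Proof.
have elH : (2.-abelem (plane_group i))%g.
  apply/abelemP => //; split=> [|_ /imsetP[v _ ->]]; first exact: abelian_sub.
  rewrite expgS expg1 -hD addww; apply: (mulgI (h (zerow k))).
  by rewrite mulg1 -hD add0w.
rewrite (isog_abelem_card _ elH); apply/andP; split.
  apply/abelemP => //; split.
    by apply/centsP => -[a b] _ [c d] _; congr (_, _); exact: Zp_mulgC.
  by case=> [[[|[|//]] ?] [[|[|//]] ?]] _; congr (_, _); apply/val_inj.
rewrite cardsT card_prod card_ord !card_imset //; last exact: plane_inj.
by rewrite card_prod card_bool.
Qed.

Lemma mem_plane_group i p : h (plane i p) \in plane_group i.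
Proof. exact/imset_f/imset_f. Qed.

Lemma plane_space_graded i :
  plane_space i = (\sum_(g in plane_group i) (plane_space i :&: pauli_grading g))%VS.
Proof.
apply/eqP; rewrite eqEsubv; apply/andP; split; apply/subv_sumP; last by move=> g _;
  exact: capvSl.
move=> p _; apply: (sumv_sup (h (plane i p))); first exact: mem_plane_group.
by rewrite -memvE memv_cap mem_plane_space pauli_in_grading.
Qed.

Lemma support_sum : (\sum_(g in support_group) pauli_grading g)%VS = fullv.
Proof.
apply/eqP; rewrite eqEsubv subvf -(pauli_span k two0); apply/subv_sumP => v _.
apply: (sumv_sup (h v)); first exact/imset_f.
by rewrite pauli_grading_line.
Qed.

Lemma transposition_involution : is_involution transposition.
Proof.
by split=> [A|A B]; rewrite !transpositionE ?trmxK // trmx_mul.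
Qed.

Lemma plane_space_stable i : (transposition @: plane_space i <= plane_space i)%VS.
Proof.
rewrite limg_sum; apply/subv_sumP => p _.
by rewrite limg_line transpositionE pauli_tr -memvE; apply/memvZ/mem_plane_space.
Qed.

Lemma sympv_plane i j p q : i != j -> sympv (plane i p) (plane j q) = false.
Proof.
move=> ij; rewrite /sympv /dotv !big1 // => l _; rewrite !ffunE;
by case: (eqVneq l i) => [->|] //=; rewrite (negPf ij) ?andbF.
Qed.

Lemma plane_space_subalgebra i : is_subalgebra (plane_space i).
Proof.
split=> [|A B]; first by rewrite -pauli0 -(plane0 i) mem_plane_space.
case/memv_sum_lines=> c -> /memv_sum_lines[d ->].
rewrite mulmx_suml; apply: memv_suml => p _; rewrite mulmx_sumr;
  apply: memv_suml => q _.
rewrite -scalemxAl -scalemxAr; do 2!apply: memvZ.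
by rewrite pauliM planeD; apply/memvZ/mem_plane_space.
Qed.

Lemma plane_space_comm i j A B : i != j -> A \in plane_space i -> B \in plane_space j ->
  A *m B = B *m A.
Proof.
move=> ij /memv_sum_lines[c ->] /memv_sum_lines[d ->].
rewrite mulmx_suml mulmx_sumr; under eq_bigr do rewrite mulmx_sumr.
under [RHS]eq_bigr do rewrite mulmx_suml.
apply: eq_bigr => p _; apply: eq_bigr => q _ /=.
rewrite -!scalemxAl -!scalemxAr pauli_comm sympv_plane // scale1r !scalerA.
by rewrite mulrC.
Qed.

(** This subgroup contains the group of every plane other than the i-th and meets the i-th
    trivially, which makes the product of the plane groups direct. *)
Lemma avoid_set_group i : group_set [set h v | v in [set v : W | ~~ v.1 i && ~~ v.2 i]].
Proof.
apply: hset_group; first by rewrite inE !ffunE.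
by move=> v w; rewrite !inE !ffunE => /andP[/negPf-> /negPf->] /andP[/negPf-> /negPf->].
Qed.

(** Partial sums of the decomposition of [v] into planes, for inductions along the enumeration of
    coordinates. *)
Definition restrict (r : seq 'I_k) v : W :=
  ([ffun j => (j \in r) && v.1 j], [ffun j => (j \in r) && v.2 j]).

Lemma restrict_nil v : restrict [::] v = zerow k.
Proof. by congr (_, _); apply/ffunP=> j; rewrite !ffunE in_nil. Qed.

Lemma restrict_cons i r v : i \notin r ->
  restrict (i :: r) v = addw (plane i (v.1 i, v.2 i)) (restrict r v).
Proof.
move=> ir; congr (_, _); apply/ffunP=> j; rewrite !ffunE inE /=;
by case: (eqVneq j i) => [->|//]; rewrite (negPf ir) addbF.
Qed.

Lemma restrict_full v : restrict (index_enum 'I_k) v = v.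
Proof.
by case: v => a b; congr (_, _); apply/ffunP=> j; rewrite ffunE mem_index_enum.
Qed.

Lemma h0 : h (zerow k) = 1%g.
Proof. by apply: (mulgI (h (zerow k))); rewrite mulg1 -hD add0w. Qed.

Lemma prod_plane v : (\prod_i h (plane i (v.1 i, v.2 i)))%g = h v.
Proof.
rewrite -[in RHS](restrict_full v).
elim: (index_enum 'I_k) (index_enum_uniq 'I_k) => [_|i r IH /andP[ir /IH{}IH]] /=.
  by rewrite big_nil restrict_nil h0.
by rewrite big_cons IH restrict_cons // hD.
Qed.

Lemma prod_pauli_plane v :
  exists e : bool, \prod_i X (plane i (v.1 i, v.2 i)) = (-1) ^+ e *: X v.
Proof.
rewrite -[v in X v](restrict_full v).
elim: (index_enum 'I_k) (index_enum_uniq 'I_k) => [_|i r IH /andP[ir /IH[e eE]]] /=.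
  by exists false; rewrite big_nil restrict_nil pauli0 scale1r.
rewrite big_cons restrict_cons // eE.
pose d := dotv (restrict r v).1 (plane i (v.1 i, v.2 i)).2.
exists (e (+) d); rewrite -[LHS]scalemxAr pauliM scalerA signr_addb.
by [].
Qed.

Lemma planes_dprod : (\big[dprod/1]_(i < k) plane_group i)%g = support_group.
Proof.
have dP : (\big[dprod/1]_(i < k) plane_group i)%g = (\prod_(i < k) plane_group i)%G.
  apply/eqP/bigdprodYP => i _; rewrite subsetD; apply/andP; split.
    exact: sub_abelian_cent2 abG (subsetT _) (subsetT _).
  rewrite bigprodGE -setI_eq0; apply/eqP/setP => g; rewrite [in RHS]inE; apply/negP.
  case/setIP => gU /setD1P[g1 /imsetP[_ /imsetP[p _ ->] gE]].
  have : <<\bigcup_(j | j != i) plane_group j>>%g \subset Group (avoid_set_group i).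
    rewrite gen_subG; apply/bigcupsP => j ji;
      apply/subsetP => _ /imsetP[_ /imsetP[q _ ->] ->].
    by apply/imset_f; rewrite inE !ffunE eq_sym (negPf ji).
  move/subsetP/(_ _ gU)/imsetP=> [v]; rewrite inE gE => /andP[v1 v2] /h_inj vE.
  move: v1 v2 g1; rewrite -vE gE !ffunE eqxx /=; case: (p) => [[] []] //= _ _.
  by rewrite plane0 => /eqP; apply; exact: h0.
rewrite dP bigprodGE; apply/eqP; rewrite eqEsubset; apply/andP; split.
  rewrite gen_subG; apply/bigcupsP => j _; apply/subsetP => _ /imsetP[v _ ->].
  exact: imset_f.
apply/subsetP => _ /imsetP[v _ ->].
rewrite -prod_plane; apply: group_prod => i _; apply/mem_gen/bigcupP.
by exists i; rewrite ?mem_plane_group.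
Qed.

Lemma plane_space_dim i : (\dim (plane_space i) <= 4)%N.
Proof.
apply: leq_trans (dimv_leq_sum _ _ _) _.
apply: (@leq_trans (\sum_(p : bool * bool) 1)%N);
  last by rewrite sum1_card card_prod card_bool.
by apply: leq_sum => p _; rewrite dim_vline; case: (_ != 0).
Qed.

Local Notation basis_words :=
  [seq \big[mulmx/1%:M]_(i < k) (vbasis (plane_space i))`_(f i)
  | f : {dffun forall i : 'I_k, 'I_(\dim (plane_space i))}].

(** A spanning list with no more elements than the dimension is a basis, so the bound 4 for each
    factor settles independence. *)
Lemma basis_words_size : (size basis_words <= \dim {: 'M[F]_(2 ^ k)})%N.
Proof.
rewrite size_image dimvf /dim /= card_dep_ffun -expnD addnn -mul2n expnM.
have bound (r : seq 'I_k) :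
    (foldr muln 1 [seq #|'I_(\dim (plane_space i))| | i <- r] <= (2 ^ 2) ^ size r)%N.
  by elim: r => //= i r IH; rewrite expnS card_ord leq_mul // plane_space_dim.
by apply: leq_trans (bound (enum 'I_k)) _; rewrite -cardE card_ord.
Qed.

(** Multilinear expansion of the product in the bases of the factors, one factor at a time. *)
Lemma prod_in_basis_words (u : 'I_k -> 'M[F]_(2 ^ k)) : (forall i, u i \in
  plane_space i) ->
  \prod_i u i \in <<basis_words>>%VS.
Proof.
(* Factors with index at least [m] are already basis vectors; at m = k the condition is vacuous. *)
move=> uP; suff step m u' : (forall i, u' i \in plane_space i) ->
    (forall i : 'I_k, (m <= i)%N -> exists j : 'I_(\dim (plane_space i)), u' i =
      (vbasis (plane_space i))`_j) ->
    \prod_i u' i \in <<basis_words>>%VS.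
  by apply: (step k) => // i; rewrite leqNgt ltn_ord.
elim: m u' => [|m IH] u' u'P u'b.
  have jP i : {j : 'I_(\dim (plane_space i)) | u' i == (vbasis (plane_space i))`_j}.
    by apply: sigW; have [j ->] := u'b i isT; exists j.
  pose f : {dffun forall i : 'I_k, 'I_(\dim (plane_space i))} := [ffun i => sval (jP
    i)].
  apply: memv_span; apply/imageP; exists f => //.
  by apply: eq_bigr => i _; rewrite ffunE; exact/eqP/(svalP (jP i)).
have [mk|km] := ltnP m k; last first.
  by apply: IH => // i mi; have := leq_trans (ltn_ord i) (leq_trans km mi);
    rewrite ltnn.
pose i0 := Ordinal mk; have [L [M LM]] := prod_update_linear i0 u'.
have -> : \prod_i u' i = L * u' i0 * M by rewrite -LM; apply: eq_bigr => i _;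
  case: eqP => [->|].
rewrite (coord_vbasis (u'P i0)) mulr_sumr mulr_suml; apply: memv_suml => j _.
rewrite -[L * _]scalemxAr -[_ * M]scalemxAl; apply: memvZ; rewrite -[_ *m M]LM.
apply: IH => i; case: eqP => [->|ne] //.
- by apply/vbasis_mem/mem_nth; rewrite size_tuple.
- by move=> _; exists j.
move=> mi; apply: u'b; rewrite ltn_neqAle mi andbT; apply/eqP=> mE; case: ne;
  exact/val_inj.
Qed.

Lemma plane_tensor_decomp : tensor_decomp plane_space.
Proof.
split=> [i|i j A B|]; [exact: plane_space_subalgebra|exact: plane_space_comm|].
rewrite basisEdim basis_words_size andbT -(pauli_span k two0); apply/subv_sumP => v _.
rewrite -memvE; have [e eE] := prod_pauli_plane v.
have -> : X v = (-1) ^+ e *: \prod_i X (plane i (v.1 i, v.2 i)).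
  by rewrite eE scalerA -signr_addb addbb scale1r.
by apply/memvZ/prod_in_basis_words => i; exact: mem_plane_space.
Qed.

Lemma transposition_fine_grading : involution_fine_grading transposition pauli_grading.
Proof.
split.
- exact: pauli_gradingP.
- move=> g; have [v /eqP<-|h0] := pickP [pred v | h v == g].
    by rewrite pauli_grading_line dim_vline pauli_neq0.
  by rewrite /pauli_grading big_pred0 ?eqxx.
- exact: transposition_involution.
- exact: transposition_stable.
exists plane_space, plane_group, support_group; split=> [|i|i|].
- exact: plane_tensor_decomp.
- exact: plane_space_stable.
- by split; [exact: plane_group_isog|exact: plane_space_graded].
by split; [exact: planes_dprod|exact: support_sum].
Qed.

End FineGrading.

(** * The superalgebra R (x) T *)

Section TensorSpaces.
Variable F : fieldType.

Lemma tensmx_linearl m n p q (B : 'M[F]_(p, q)) : linear (fun A : 'M[F]_(m, n) => A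
  *t B).
Proof.
by move=> c A A'; apply/matrixP=> i j; rewrite !mxE mulrDl mulrA.
Qed.

Lemma tensmx_linearr m n p q (A : 'M[F]_(m, n)) : linear (fun B : 'M[F]_(p, q) => A
  *t B).
Proof.
by move=> c B B'; apply/matrixP=> i j; rewrite !mxE mulrDr mulrCA.
Qed.

Lemma tensmxZl m n p q c (A : 'M[F]_(m, n)) (B : 'M[F]_(p, q)) : (c *: A) *t B = c *:
  (A *t B).
Proof. by apply/matrixP=> i j; rewrite !mxE mulrA. Qed.

Lemma tensmxZr m n p q c (A : 'M[F]_(m, n)) (B : 'M[F]_(p, q)) : A *t (c *: B) = c *:
  (A *t B).
Proof. by apply/matrixP=> i j; rewrite !mxE mulrCA. Qed.

Lemma tensmxNr m n p q (A : 'M[F]_(m, n)) (B : 'M[F]_(p, q)) : A *t (- B) = - (A *t B).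
Proof. by rewrite -scaleN1r tensmxZr scaleN1r. Qed.

Lemma tensmxNl m n p q (A : 'M[F]_(m, n)) (B : 'M[F]_(p, q)) : (- A) *t B = - (A *t B).
Proof. by rewrite -scaleN1r tensmxZl scaleN1r. Qed.

Lemma tensmxDl m n p q (A A' : 'M[F]_(m, n)) (B : 'M[F]_(p, q)) :
  (A + A') *t B = A *t B + A' *t B.
Proof. exact: (linearD (pack_linear (tensmx_linearl B))). Qed.

Lemma tensmxDr m n p q (A : 'M[F]_(m, n)) (B B' : 'M[F]_(p, q)) :
  A *t (B + B') = A *t B + A *t B'.
Proof. exact: (linearD (pack_linear (tensmx_linearr A))). Qed.

Lemma tensmx_suml (I : finType) (P : pred I) m n p q (f : I -> 'M[F]_(m, n)) (B :
  'M[F]_(p, q)) :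
  (\sum_(i | P i) f i) *t B = \sum_(i | P i) f i *t B.
Proof. exact: (linear_sum (pack_linear (tensmx_linearl B))). Qed.

Lemma tensmx_sumr (I : finType) (P : pred I) m n p q (A : 'M[F]_(m, n)) (f : I ->
  'M[F]_(p, q)) :
  A *t (\sum_(i | P i) f i) = \sum_(i | P i) A *t f i.
Proof. exact: (linear_sum (pack_linear (tensmx_linearr A))). Qed.

Lemma mem_tensv m n (U : {vspace 'M[F]_m}) (V : {vspace 'M[F]_n}) A B :
  A \in U -> B \in V -> A *t B \in tensv U V.
Proof.
move=> AU BV; rewrite (coord_vbasis AU) (coord_vbasis BV) tensmx_suml.
apply: memv_suml => i _; rewrite tensmx_sumr; apply: memv_suml => j _.
rewrite tensmxZl tensmxZr; do 2!apply: memvZ; apply: memv_span.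
by apply: allpairs_f; apply: mem_nth; rewrite size_tuple.
Qed.

Lemma tensv_subv m n (U : {vspace 'M[F]_m}) (V : {vspace 'M[F]_n})
    (K : {vspace 'M[F]_(m * n)}) :
  (forall A B, A \in U -> B \in V -> A *t B \in K) -> (tensv U V <= K)%VS.
Proof.
move=> UVK; apply/span_subvP => _ /allpairsP[[A B] [/= AU BV ->]].
by apply: UVK; exact: vbasis_mem.
Qed.

Lemma tensv_full m n (K : {vspace 'M[F]_(m * n)}) :
  (forall A B, A *t B \in K) -> K = fullv.
Proof.
move=> AB; apply/eqP; rewrite eqEsubv subvf; apply/subvP => Y _.
rewrite (matrix_sum_delta Y); apply: memv_suml => r _; apply: memv_suml => c _;
  apply: memvZ.
case: (mxtens_indexP r) => i i'; case: (mxtens_indexP c) => j j'.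
have -> : delta_mx (mxtens_index (i, i')) (mxtens_index (j, j')) = delta_mx i j *t
  delta_mx i' j' :> 'M[F]_(m * n).
  apply/matrixP=> r' c'; case: (mxtens_indexP r') => a a';
    case: (mxtens_indexP c') => b b'.
  rewrite tensmxE !mxE !(can_eq (@mxtens_indexK _ _)) !xpair_eqE -natrM mulnb.
  by rewrite andbACA.
exact: AB.
Qed.

End TensorSpaces.

Section Transport.
Variables (F : closedFieldType) (n k s : nat).
Hypothesis two0 : 2%:R != 0 :> F.
Variables (Q : 'M[F]_(2 ^ k * s, n)) (Q' : 'M[F]_(n, 2 ^ k * s)).
Hypothesis QQ' : Q *m Q' = 1%:M.
Hypothesis Q'Q : Q' *m Q = 1%:M.
Local Notation R := 'M[F]_(2 ^ k).

(** Indices of R (x) T are pairs (x, i) with i in s + s, whereas the blocks of P(n) have index set n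
    + n. [in1] and [in2] select the pairs with i in the first and in the second half. *)
Definition in1 : 'M[F]_(2 ^ k * s, 2 ^ k * (s + s)) := (1%:M : R) *t row_mx 1%:M 0.
Definition in2 : 'M[F]_(2 ^ k * s, 2 ^ k * (s + s)) := (1%:M : R) *t row_mx 0 1%:M.

Lemma in1T : in1^T = (1%:M : R) *t col_mx 1%:M 0.
Proof. by rewrite trmx_tens trmx1 tr_row_mx trmx1 trmx0. Qed.

Lemma in2T : in2^T = (1%:M : R) *t col_mx 0 1%:M.
Proof. by rewrite trmx_tens trmx1 tr_row_mx trmx1 trmx0. Qed.

Lemma in_tens (A : R) (T : 'M[F]_(s + s)) :
  [/\ in1 *m (A *t T) *m in1^T = A *t ulsubmx T, in1 *m (A *t T) *m in2^T = A *t
    ursubmx T,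
      in2 *m (A *t T) *m in1^T = A *t dlsubmx T & in2 *m (A *t T) *m in2^T = A *t
        drsubmx T].
Proof.
rewrite in1T in2T /in1 /in2 !tensmx_mul !mulmx1 !mul1mx -{1 3 5 7}[T]submxK.
split; rewrite !mul_row_block ?mul0mx ?mul1mx ?addr0 ?add0r mul_row_col;
  by rewrite !mulmx0 mulmx1 ?addr0 ?add0r.
Qed.

Lemma tens11 (p q : nat) : (1%:M : 'M[F]_p) *t (1%:M : 'M[F]_q) = 1%:M.
Proof.
apply/matrixP=> r c; case: (mxtens_indexP r) => i i'; case: (mxtens_indexP c) => j j'.
by rewrite tensmxE !mxE (can_eq (@mxtens_indexK _ _)) xpair_eqE -natrM mulnb.
Qed.

Lemma in_orthogonal : [/\ in1 *m in1^T = 1%:M, in1 *m in2^T = 0, in2 *m in1^T = 0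
  & in2 *m in2^T = 1%:M].
Proof.
rewrite in1T in2T /in1 /in2 !tensmx_mul !mulmx1 !mul_row_col !mulmx1 !mulmx0.
by rewrite !addr0 !add0r !tensmx0 tens11.
Qed.

Lemma in_complete : in1^T *m in1 + in2^T *m in2 = 1%:M.
Proof.
rewrite in1T in2T /in1 /in2 !tensmx_mul !mulmx1 -tensmxDr !mul_col_row.
rewrite !mulmx1 !mulmx0 add_block_mx !addr0 !add0r.
by rewrite -scalar_mx_block tens11.
Qed.

(** Up to the reordering of indices this is the block diagonal matrix of Q and its inverse
    transpose, the shape of [conj_block], and hence compatible with [trp]. *)
Definition basis_mx : 'M[F]_(2 ^ k * (s + s), n + n) := row_mx (in1^T *m Q) (in2^T *m
  Q'^T).
Definition cobasis_mx : 'M[F]_(n + n, 2 ^ k * (s + s)) := col_mx (Q' *m in1) (Q^T *m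
  in2).
Local Notation U := basis_mx.
Local Notation U' := cobasis_mx.

Lemma basisK : U *m U' = 1%:M.
Proof.
rewrite mul_row_col !mulmxA -[_ *m Q *m Q']mulmxA QQ' mulmx1.
by rewrite -[_ *m Q'^T *m Q^T]mulmxA -trmx_mul QQ' trmx1 mulmx1 in_complete.
Qed.

Lemma cobasisK : U' *m U = 1%:M.
Proof.
have [e11 e12 e21 e22] := in_orthogonal.
have assoc p q r t u (A : 'M[F]_(p, q)) (B : 'M[F]_(q, r)) (C : 'M[F]_(r, t)) (D :
  'M[F]_(t, u)) :
  (A *m B) *m (C *m D) = A *m (B *m C) *m D by rewrite !mulmxA.
rewrite mul_col_row !assoc e11 e12 e21 e22 !mulmx0 !mul0mx !mulmx1 -trmx_mul Q'Q trmx1.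
by rewrite -scalar_mx_block.
Qed.

Definition untens (Y : 'M[F]_(2 ^ k * (s + s))) : 'M[F]_(n + n) := U' *m Y *m U.
Definition intens (M : 'M[F]_(n + n)) : 'M[F]_(2 ^ k * (s + s)) := U *m M *m U'.

Lemma untens_linear : linear untens.
Proof. by move=> c A B; rewrite /untens mulmxDr mulmxDl -scalemxAr -scalemxAl. Qed.
Lemma intens_linear : linear intens.
Proof. by move=> c A B; rewrite /intens mulmxDr mulmxDl -scalemxAr -scalemxAl. Qed.
HB.instance Definition _ := GRing.isLinear.Build F _ _ _ untens untens_linear.
HB.instance Definition _ := GRing.isLinear.Build F _ _ _ intens intens_linear.

Lemma untensK : cancel untens intens.
Proof.
move=> Y; rewrite /intens /untens !mulmxA basisK mul1mx -mulmxA basisK.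
exact: mulmx1.
Qed.

Lemma intensK : cancel intens untens.
Proof.
move=> Y; rewrite /intens /untens !mulmxA cobasisK mul1mx -mulmxA cobasisK.
exact: mulmx1.
Qed.

Lemma intensM A B : intens (A *m B) = intens A *m intens B.
Proof. by rewrite /intens !mulmxA -[_ *m U' *m U]mulmxA cobasisK mulmx1. Qed.

Lemma untens_tens (A : R) (T : 'M[F]_(s + s)) : untens (A *t T) =
  block_mx (Q' *m (A *t ulsubmx T) *m Q) (Q' *m (A *t ursubmx T) *m Q'^T)
           (Q^T *m (A *t dlsubmx T) *m Q) (Q^T *m (A *t drsubmx T) *m Q'^T).
Proof.
have [<- <- <- <-] := in_tens A T.
by rewrite /untens mul_col_mx mul_col_row !mulmxA.
Qed.

(** As the second half carries the inverse transpose of Q, transposing each block exchanges Q and Q'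
    exactly as the block positions require. So [trp] becomes the tensor product of transposition and
    [tstar]. *)
Lemma trp_untens (A : R) (T : 'M[F]_(s + s)) :
  trp F n (untens (A *t T)) = untens (A^T *t tstar F s T).
Proof.
rewrite !untens_tens trpE -{5 6 7 8}[T]submxK tstarE.
rewrite block_mxKul block_mxKur block_mxKdl block_mxKdr !trmx_mul !trmx_tens !trmxK.
by rewrite tensmxNr mulmxN mulNmx !mulmxA.
Qed.

Local Notation S := (tensv (skewv (transposition F k)) (skewv (tstar F s))
  + tensv (symv (transposition F k)) (symv (tstar F s)))%VS.

Definition tens_star (Y : 'M[F]_(2 ^ k * (s + s))) := intens (trp F n (untens Y)).

Lemma tens_star_linear : linear tens_star.
Proof. by move=> c A B; rewrite /tens_star !linearP. Qed.
HB.instance Definition _ := GRing.isLinear.Build F _ _ _ tens_star tens_star_linear.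

Lemma tens_starE (A : R) (T : 'M[F]_(s + s)) : tens_star (A *t T) = A^T *t tstar F s T.
Proof. by rewrite /tens_star trp_untens untensK. Qed.

Lemma tstarK (T : 'M[F]_(s + s)) : tstar F s (tstar F s T) = T.
Proof.
by rewrite -[T]submxK !tstarE !trmxK linearN /= trmxK opprK.
Qed.

Lemma half_sum (Y Z : 'M[F]_(2 ^ k * (s + s))) : Y = Z -> Y = 2%:R^-1 *: (Y + Z).
Proof. by move=> <-; rewrite -mulr2n -scaler_nat scalerA mulVf // scale1r. Qed.

(** On A (x) T the symmetrization is half of (A - A^T) (x) (T - t) + (A + A^T) (x) (T + t), where t
    is the image of T under [tstar]. *)
Lemma star_sum_mem Y : Y + tens_star Y \in S.
Proof.
pose f := (\1 + linfun tens_star)%VF.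
have fE Z : f Z = Z + tens_star Z by rewrite add_lfunE id_lfunE lfunE.
rewrite -fE memv_preim; suff -> : (f @^-1: S)%VS = fullv by exact: memvf.
apply: tensv_full => A T; rewrite -memv_preim fE tens_starE.
pose t := tstar F s T.
have -> : A *t T + A^T *t t = 2%:R^-1 *: ((A - A^T) *t (T - t) + (A + A^T) *t (T + t)).
  transitivity (2%:R^-1 *: ((A *t T + A^T *t t) + (A *t T + A^T *t t)));
    first exact: half_sum.
  congr (_ *: _); rewrite !tensmxDl !tensmxDr !tensmxNl !tensmxNr opprK.
  move: (A *t T) (A *t t) (A^T *t T) (A^T *t t) => a b c d.
  rewrite [RHS]addrACA [a - b + (a + b)]addrACA addNr addr0 [- c + d + (c +
    d)]addrACA addNr add0r.
  by rewrite [LHS]addrACA.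
apply: memvZ; apply: memv_add; apply: mem_tensv.
- by rewrite mem_skewv transpositionE linearB /= trmxK opprB.
- by rewrite mem_skewv linearB /= tstarK opprB.
- by rewrite mem_symv transpositionE linearD /= trmxK addrC.
- by rewrite mem_symv linearD /= tstarK addrC.
Qed.

(** Fixed points of a tensor product of two involutions: symmetric with symmetric and skew with
    skew. Every fixed point is half of its own symmetrization. *)
Lemma mem_star Y : (Y \in S) = (untens Y \in symv (trp F n)).
Proof.
have -> : (untens Y \in symv (trp F n)) = (tens_star Y == Y).
  rewrite mem_symv /tens_star -(inj_eq (can_inj intensK)) untensK.
  by [].
apply/idP/eqP => [|Ys]; last by rewrite (half_sum (esym Ys)); apply/memvZ/star_sum_mem.
have lfE Z : linfun tens_star Z = tens_star Z by exact: lfunE.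
have sub : (S <= symv (linfun tens_star))%VS.
  rewrite subv_add; apply/andP; split; apply: tensv_subv => A B.
    rewrite mem_skewv => /eqP As; rewrite mem_skewv => /eqP Bs.
    rewrite mem_symv lfE tens_starE.
    by rewrite -transpositionE As Bs tensmxNr tensmxNl opprK.
  rewrite mem_symv => /eqP As; rewrite mem_symv => /eqP Bs;
    rewrite mem_symv lfE tens_starE.
  by rewrite -transpositionE As Bs.
by move/(subvP sub); rewrite mem_symv lfE => /eqP.
Qed.

Lemma untens_part e Y : Y \in @tenspart F (2 ^ k) s s e -> untens Y \in mxpart F n n e.
Proof.
suff sub : (tenspart F (2 ^ k) s s e <= linfun untens @^-1: mxpart F n n e)%VS.
  by move/(subvP sub); rewrite -memv_preim lfunE.
apply: tensv_subv => A T _;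
  rewrite -memv_preim lfunE /= untens_tens mem_mxpart_block mem_mxpart.
by case: e => /andP[/eqP-> /eqP->]; rewrite !tensmx0 !mulmx0 !mul0mx !eqxx.
Qed.

Lemma mxpart_cap a b e X : X \in mxpart F a b e -> X \in mxpart F a b (~~ e) -> X = 0.
Proof.
rewrite !mem_mxpart -[X]submxK block_mxKul block_mxKur block_mxKdl block_mxKdr.
by case: e => /andP[/eqP-> /eqP->] /andP[/eqP-> /eqP->]; rewrite -block_mx0.
Qed.

(** The two parts span R (x) T and [untens] preserves parity. The component of the wrong parity then
    has an image of both parities, so it vanishes. *)
Lemma mem_tenspart e Y : (Y \in @tenspart F (2 ^ k) s s e) = (untens Y \in mxpart F n
  n e).
Proof.
apply/idP/idP => [|YP]; first exact: untens_part.
have full : (tenspart F (2 ^ k) s s e + tenspart F (2 ^ k) s s (~~ e))%VS = fullv.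
  apply: tensv_full => A T; rewrite -[T]submxK.
  have -> : block_mx (ulsubmx T) (ursubmx T) (dlsubmx T) (drsubmx T) =
    (if e then block_mx 0 (ursubmx T) (dlsubmx T) 0 else block_mx (ulsubmx T) 0 0
      (drsubmx T)) +
    (if ~~ e then block_mx 0 (ursubmx T) (dlsubmx T) 0 else block_mx (ulsubmx T) 0 0
      (drsubmx T)).
    by case: (e); rewrite add_block_mx !addr0 !add0r.
  rewrite tensmxDr; apply: memv_add; apply: mem_tensv (memvf _) _.
    by case: (e); rewrite mem_mxpart_block !eqxx.
  by case: (e); rewrite mem_mxpart_block !eqxx.
have /memv_addP[Y0 Y0e [Y1 Y1e YE]] : Y \in (tenspart F (2 ^ k) s s e + tenspart F (2
  ^ k) s s (~~ e))%VS.
  by rewrite full memvf.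
have : untens Y1 = 0.
  apply: (@mxpart_cap _ _ e); last exact: untens_part.
  have -> : Y1 = Y - Y0 by rewrite YE addrC addKr.
  by rewrite linearB; apply: rpredB => //; exact: untens_part.
by move/(congr1 intens); rewrite untensK linear0 YE => ->; rewrite addr0.
Qed.

Section Conjugation.
Variables (P : 'M[F]_n) (v : {ffun 'I_k -> bool} * {ffun 'I_k -> bool}) (lam :
  'rV[F]_s).
Hypothesis Pu : P \in unitmx.
Hypothesis QP : Q *m P = (pauli F v *t diag_mx lam) *m Q.

Lemma weight_neq0 j : lam 0 j != 0.
Proof.
apply/eqP=> l0; pose r := mxtens_index (unbits (zerov k), j).
have : row r (Q *m P) = 0.
  rewrite QP row_mul; have -> : row r (pauli F v *t diag_mx lam) = 0.
    apply/rowP=> c; case: (mxtens_indexP c) => x i; rewrite mxE tensmxE !mxE.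
    by rewrite l0 mul0rn mulr0.
  exact: mul0mx.
move/(congr1 (fun u => u *m invmx P *m Q'));
  rewrite row_mul mulmxK // -row_mul QQ' !mul0mx.
by move/rowP/(_ r)/eqP; rewrite !mxE eqxx oner_eq0.
Qed.

Definition weights : 'rV[F]_(s + s) := row_mx lam (map_mx GRing.inv lam).

Lemma weights_neq0 i : weights 0 i != 0.
Proof.
rewrite /weights; case: (split_ordP i) => j ->; rewrite ?row_mxEl ?row_mxEr ?mxE.
  exact: weight_neq0.
by rewrite invr_eq0 weight_neq0.
Qed.

Lemma diag_weights : diag_mx weights = block_mx (diag_mx lam) 0 0 (diag_mx (map_mx
  GRing.inv lam)).
Proof. exact: diag_mx_row. Qed.

(** Since X^T X = 1 for a Pauli matrix, the inverse transpose of X (x) diag(lam) is X (x)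
    diag(1/lam). The two halves thus share the factor X, and [weights] collects lam and 1/lam. *)
Lemma basis_conj : U *m conj_block P = (pauli F v *t diag_mx weights) *m U.
Proof.
rewrite /basis_mx /conj_block mul_row_block !mulmx0 addr0 add0r mul_mx_row;
  congr row_mx.
  rewrite -mulmxA QP !mulmxA; congr (_ *m _).
  rewrite in1T diag_weights !tensmx_mul mulmx1 mul1mx mul_block_col mul_col_mx.
  by rewrite ?mulmx1 ?mul1mx ?mulmx0 ?mul0mx ?addr0 ?mul1mx.
pose D := pauli F v *t diag_mx lam;
  pose D' := pauli F v *t diag_mx (map_mx GRing.inv lam).
have DD : D^T *m D' = 1%:M.
  rewrite trmx_tens tensmx_mul pauli_tr_mul tr_diag_mx mulmx_diag.
  rewrite -[RHS]tens11; congr (_ *t _); apply/matrixP=> i j; rewrite !mxE.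
  by rewrite mulfV ?weight_neq0.
have QPD : Q *m P *m Q' = D by rewrite QP -mulmxA QQ' mulmx1.
have PD : invmx P *m Q' *m D = Q'.
  by rewrite -QPD !mulmxA -[invmx P *m Q' *m Q]mulmxA Q'Q mulmx1 mulVmx // mul1mx.
have inD : (pauli F v *t diag_mx weights) *m in2^T = in2^T *m D'.
  rewrite in2T diag_weights !tensmx_mul mulmx1 mul1mx mul_block_col mul_col_mx.
  by rewrite ?mulmx1 ?mul1mx ?mulmx0 ?mul0mx ?add0r ?addr0.
rewrite mulmxA inD -!mulmxA -trmx_mul; congr (_ *m _).
by rewrite -[Q' in RHS]PD [in RHS]trmx_mul mulmxA (mulmx1C DD) mul1mx.
Qed.

End Conjugation.

End Transport.

(** * Gradings and the action of characters *)

Section ConjBlock.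
Variables (F : closedFieldType) (n : nat).
Hypothesis two0 : 2%:R != 0 :> F.
Implicit Types P Q : 'M[F]_n.

Lemma invmx_mul P Q : P \in unitmx -> Q \in unitmx ->
  invmx (P *m Q) = invmx Q *m invmx P.
Proof.
move=> Pu Qu; have PQu : P *m Q \in unitmx by rewrite unitmx_mul Pu.
apply: (can_inj (mulKmx PQu)); rewrite mulmxV // mulmxA -[_ *m Q *m _]mulmxA mulmxV //.
by rewrite mulmx1 mulmxV.
Qed.

Lemma conj_blockM P Q : P \in unitmx -> Q \in unitmx ->
  conj_block (P *m Q) = conj_block P *m conj_block Q.
Proof.
move=> Pu Qu; rewrite /conj_block mulmx_block !mulmx0 !mul0mx !addr0 !add0r.
by rewrite -trmx_mul invmx_mul.
Qed.

Lemma conj_block1 : conj_block (1%:M : 'M[F]_n) = 1%:M.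
Proof. by rewrite /conj_block invmx1 trmx1 -scalar_mx_block. Qed.

Lemma conj_block_unit P : P \in unitmx -> conj_block P \in unitmx.
Proof.
move=> Pu; have [] // := @mulmx1_unit _ _ (conj_block P) (conj_block (invmx P)).
by rewrite -conj_blockM ?unitmx_inv // mulmxV // conj_block1.
Qed.

(** On C-blocks conjugation is the congruence by P^-1, and congruences of symmetric matrices
    determine the matrix up to sign. *)
Lemma conj_block_sign P Q : P \in unitmx -> Q \in unitmx ->
    (forall C, C^T = C -> exists Y, Y *m conj_block P = conj_block P *m odd_block 0 C
                           /\ Y *m conj_block Q = conj_block Q *m odd_block 0 C) ->
  P = Q \/ P = - Q.
Proof.
move=> Pu Qu PQ; have : invmx P = invmx Q \/ invmx P = - invmx Q.
  apply: sym_form_ext => C Cs; have [Y [YP YQ]] := PQ C Cs.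
  have dl (R : 'M[F]_n) : R \in unitmx -> Y *m conj_block R = conj_block R *m
    odd_block 0 C ->
      dlsubmx Y = (invmx R)^T *m C *m invmx R.
    move=> Ru; rewrite -[Y]submxK /conj_block /odd_block !mulmx_block !mulmx0 !mul0mx
      !addr0 !add0r.
    by case/eq_block_mx=> _ _ <- _; rewrite block_mxKdl mulmxK.
  by rewrite -dl // -dl.
have inv_inj (R R' : 'M[F]_n) : invmx R = invmx R' -> R = R' by move/(congr1 invmx);
  rewrite !invmxK.
case=> [/inv_inj|]; first by left.
move=> PN; right; rewrite -[P]invmxK PN -scaleN1r invmxZ ?unitmxZ ?unitrN1
  ?unitmx_inv //.
by rewrite invmxK invrN1 scaleN1r.
Qed.

End ConjBlock.

Section GradedSuperalgebra.
Variables (F : closedFieldType) (gT : finGroupType) (n : nat).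
Hypothesis charF : [pchar F] =i pred0.
Variables (J : superalgebra F) (D : gT -> {vspace J}) (f : 'Hom(J, 'M[F]_(n + n))).
Hypothesis n_gt0 : (0 < n)%N.
Hypothesis gradJ : is_super_grading D.
Hypothesis isoJ : supersym_iso (@mxpart F n n) (symv (trp F n)) f.

Let two0 : 2%:R != 0 :> F. Proof. exact: natr_neq0. Qed.
Let sumD : (\sum_g D g)%VS = fullv. Proof. by case: gradJ => -[]. Qed.
Let dirD : directv (\sum_g D g). Proof. by case: gradJ => -[]. Qed.
Let mulD g h x y : x \in D g -> y \in D h -> smul x y \in D (g * h)%g.
Proof. by case: gradJ => -[_ _ h0 _]; exact: h0. Qed.

Lemma grading_unique (u w : gT -> J) : (forall g, u g \in D g) -> (forall g, w g \in
  D g) ->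
  \sum_g u g = \sum_g w g -> forall g, u g = w g.
Proof.
move=> uD wD /eqP; rewrite (directv_sum_unique dirD) // => /forall_inP h g.
exact/eqP/h.
Qed.

Definition component g : 'End(J) := sumv_pi_for (esym sumD) g.

Lemma component_mem g x : component g x \in D g.
Proof. exact: memv_sum_pi. Qed.

Lemma component_sum x : \sum_g component g x = x.
Proof. by apply: sumv_pi_sum; exact: memvf. Qed.

Lemma component_unique (u : gT -> J) x : (forall g, u g \in D g) -> x = \sum_g u g ->
  forall g, component g x = u g.
Proof.
move=> uD xE; apply: grading_unique => // [g|]; first exact: component_mem.
by rewrite component_sum.
Qed.

Lemma component_hom g h x : x \in D g -> component h x = if h == g then x else 0.
Proof.
move=> xg; apply: (component_unique (u := fun h => if h == g then x else 0)).
  by move=> h'; case: eqP => [->//|_]; exact: mem0v.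
by rewrite (big_only1 g) // ?eqxx // => j /negPf->.
Qed.

(** Every [D g] is spanned by its even and odd parts, so J is the sum of the intersections. The part
    of [x] of the wrong parity is the difference of two elements of parity e and vanishes. *)
Lemma component_part g e x : x \in spart J e -> component g x \in spart J e.
Proof.
have sub a : (\sum_g (D g :&: spart J a) <= spart J a)%VS.
  by apply/subv_sumP => h _; exact: capvSr.
have full : (\sum_g (D g :&: spart J e) + \sum_g (D g :&: spart J (~~ e)))%VS = fullv.
  have -> : (\sum_g (D g :&: spart J e) + \sum_g (D g :&: spart J (~~ e)))%VS =
    (\sum_g (D g :&: spart J false) + \sum_g (D g :&: spart J true))%VS.
    by case: (e); rewrite // addvC.
  rewrite -big_split -[RHS]sumD; apply: eq_bigr => h _ /=.
  by have [_ pD] := gradJ; rewrite [RHS]pD.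
move=> xe; have /memv_addP[a aP [b bP xE]] : x \in (\sum_g (D g :&: spart J e) +
  \sum_g (D g :&: spart J (~~ e)))%VS.
  by rewrite full memvf.
have b0 : b = 0.
  have be : b \in spart J e.
    have -> : b = x - a by rewrite xE addrC addKr.
    by apply: memvB => //; exact: (subvP (sub e)).
  have bne := subvP (sub (~~ e)) _ bP.
  apply/eqP; rewrite -memv0 -(spart_cap J) memv_cap.
  by case: (e) be bne => /= -> ->.
move: aP; rewrite xE b0 addr0 => /memv_sumP[u uP aE].
rewrite (component_unique (u := u)) //; first by have := uP g isT;
  rewrite memv_cap => /andP[].
by move=> h; have := uP h isT; rewrite memv_cap => /andP[].
Qed.

(* The automorphism of [J] by which a character [c] of the group acts. *)
Definition twist (c : gT -> F) : 'End(J) := (\sum_g c g *: component g)%R.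

Lemma twistE c x : twist c x = \sum_g c g *: component g x.
Proof. by rewrite /twist sum_lfunE; apply: eq_bigr => g _; rewrite scale_lfunE. Qed.

Lemma component_twist c g x : component g (twist c x) = c g *: component g x.
Proof.
apply: (component_unique (u := fun g => c g *: component g x)) => [h|].
  exact/memvZ/component_mem.
exact: twistE.
Qed.

Lemma twist_hom c g x : x \in D g -> twist c x = c g *: x.
Proof.
move=> xg; rewrite twistE (big_only1 g) // => [|h hg _];
  rewrite (component_hom _ xg) ?eqxx //.
by rewrite (negPf hg) scaler0.
Qed.

Lemma component_ext x y : (forall g, component g x = component g y) -> x = y.
Proof. by move=> xy; rewrite -[x]component_sum -[y]component_sum; apply: eq_bigr. Qed.

Lemma twist_part c e x : x \in spart J e -> twist c x \in spart J e.
Proof.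
by move=> xe; rewrite twistE; apply: memv_suml => g _; exact/memvZ/component_part.
Qed.

Lemma twist_inj c x : (forall g, c g != 0) -> twist c x = 0 -> x = 0.
Proof.
move=> c0 tx; apply: component_ext => g; rewrite linear0; apply: (scalerI (c0 g)).
by rewrite -component_twist tx linear0 scaler0.
Qed.

Lemma smul_suml (u : gT -> J) y : smul (\sum_g u g) y = \sum_g smul (u g) y.
Proof. exact: (linear_sum (pack_linear (smul_linearl y))). Qed.

Lemma smul_sumr x (u : gT -> J) : smul x (\sum_g u g) = \sum_g smul x (u g).
Proof. exact: (linear_sum (pack_linear (smul_linearr x))). Qed.

Lemma smulZl c (x y : J) : smul (c *: x) y = c *: smul x y.
Proof. exact: (linearZZ (pack_linear (smul_linearl y))). Qed.

Lemma smulZr c (x y : J) : smul x (c *: y) = c *: smul x y.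
Proof. exact: (linearZZ (pack_linear (smul_linearr x))). Qed.

Lemma twist_mul c x y : (forall g h, c (g * h)%g = c g * c h) ->
  twist c (smul x y) = smul (twist c x) (twist c y).
Proof.
move=> cM; rewrite -{1}[x]component_sum -{1}[y]component_sum [twist c x]twistE [twist
  c y]twistE.
rewrite !smul_suml linear_sum; apply: eq_bigr => g _.
rewrite !smul_sumr linear_sum; apply: eq_bigr => h _.
rewrite /= (twist_hom _ (mulD (component_mem g x) (component_mem h y))) cM.
by rewrite smulZl smulZr scalerA.
Qed.

Let f_inj : lker f == 0%VS. Proof. by case: isoJ => ->. Qed.
Let f_lim : limg f = symv (trp F n). Proof. by case: isoJ. Qed.

Lemma mem_S e x : x \in spart J e -> f x \in (symv (trp F n) :&: mxpart F n n e)%VS.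
Proof. by move=> xe; case: isoJ => _ _ <- _; exact: memv_img. Qed.

Lemma S_img e X : X \in (symv (trp F n) :&: mxpart F n n e)%VS ->
  exists2 x, x \in spart J e & X = f x.
Proof. by case: isoJ => _ _ <- _ => /memv_imgP[x]; exists x. Qed.

Lemma twist_conjugation c : (forall g h, c (g * h)%g = c g * c h) -> (forall g, c g
  != 0) ->
  exists2 P : 'M[F]_n, P \in unitmx &
    forall x, f (twist c x) *m conj_block P = conj_block P *m f x.
Proof.
(* [f^-1] inverts [f] on its image; [phi] is used only there. *)
move=> cM c0; pose phi : 'End('M[F]_(n + n)) := (f \o (twist c \o f^-1))%VF.
have phiE x : phi (f x) = f (twist c x) by rewrite !comp_lfunE lker0_lfunK.
have fM d e x y : x \in spart J d -> y \in spart J e ->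
    f x *m f y + (-1) ^+ (d && e) *: (f y *m f x) = 2%:R *: f (smul x y).
  by case: isoJ => _ _ _ fm xd ye; rewrite (fm d e) // scalerA divff // scale1r.
have [] := @automorphism_conjugation F n two0 n_gt0 phi.
- by move=> e _ /S_img[x xe ->]; rewrite /= phiE; exact/mem_S/twist_part.
- move=> d e _ _ /S_img[x xd ->] /S_img[y ye ->];
  rewrite (fM d e) //= !phiE (fM d e) ?twist_part //.
  by rewrite linearZ /= phiE twist_mul.
- move=> e _ /S_img[x xe ->]; rewrite /= phiE => /eqP;
  rewrite -[_ == 0]memv_ker (eqP f_inj) memv0 => /eqP.
  by move/(twist_inj c0) ->; rewrite linear0.
move=> P Pu phiP; exists P => // x.
have : x \in (spart J false + spart J true)%VS by rewrite spart_sum memvf.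
case/memv_addP=> x0 x00 [x1 x11 ->];
  rewrite [twist c _]linearD ![f (_ + _)]linearD mulmxDl mulmxDr /= -!phiE.
by rewrite (phiP false) ?(phiP true) ?mem_S.
Qed.

Section Characters.
Variables (m : nat) (chi : 'I_m -> gT -> F).
Hypothesis chiM : forall l g h, chi l (g * h)%g = chi l g * chi l h.
Hypothesis chi1 : forall l, chi l 1%g = 1.
Hypothesis chi_sep : forall g h, (forall l, chi l g = chi l h) -> g = h.

Lemma chiX l g j : chi l (g ^+ j)%g = chi l g ^+ j.
Proof. by elim: j => [|j IH]; rewrite ?expg0 ?expr0 // expgS exprS chiM IH. Qed.

Lemma chi_neq0 l g : chi l g != 0.
Proof.
by apply/eqP=> c0; have := chiM l g g^-1; rewrite mulgV chi1 c0 mul0r => /eqP;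
  rewrite oner_eq0.
Qed.

Lemma chiV l g : chi l g^-1%g = (chi l g)^-1.
Proof. by apply: (mulfI (chi_neq0 l g)); rewrite -chiM mulgV chi1 mulfV ?chi_neq0. Qed.

(** Any nonzero homogeneous component of [x] has a degree with the prescribed character values. *)
Lemma joint_eigenvector_degree x (c : 'I_m -> F) : x != 0 ->
  (forall l, twist (chi l) x = c l *: x) -> exists g, forall l, chi l g = c l.
Proof.
move=> x0 xc; have [g xg] : exists g, component g x != 0.
  apply/existsP; apply: contraNT x0 => /existsPn x0; apply/eqP.
  by rewrite -[x]component_sum big1 // => g _; apply/eqP/negPn/x0.
exists g => l; have /eqP := congr1 (component g) (xc l).
rewrite component_twist linearZ -subr_eq0 -scalerBl scaler_eq0 (negPf xg) orbF subr_eq0.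
by move/eqP.
Qed.

(** As the characters separate points, no component of degree other than [g] survives. *)
Lemma joint_eigenvector_mem x g : (forall l, twist (chi l) x = chi l g *: x) -> x \in
  D g.
Proof.
move=> xc; have <- : component g x = x; last exact: component_mem.
rewrite -[RHS]component_sum [RHS](big_only1 g) // => h hg _; apply/eqP/negPn/negP => xh.
case/eqP: hg; apply: chi_sep => l; have /eqP := congr1 (component h) (xc l).
rewrite component_twist linearZ -subr_eq0 -scalerBl scaler_eq0 (negPf xh) orbF subr_eq0.
by move/eqP.
Qed.

(** The twists commute, so P_l P_j and P_j P_l induce the same conjugation and agree up to sign. The
    |G|-th iterate of a twist is the identity, so P_l^|G| is 1 or -1. *)
Lemma character_conjugations : exists P : 'I_m -> 'M[F]_n,
  [/\ forall l, P l \in unitmx,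
      forall l x, f (twist (chi l) x) *m conj_block (P l) = conj_block (P l) *m f x,
      forall l, P l ^+ (4 * #|[set: gT]|) = 1
    & forall l j, sign_comm (P l) (P j)].
Proof.
have /fin_all_exists2[P Pu PH] l := twist_conjugation (chiM l) (chi_neq0 l).
exists P; split=> // [l|l j]; last first.
  have PM i i' : P i *m P i' \in unitmx by rewrite unitmx_mul !Pu.
  apply: (conj_block_sign (PM l j) (PM j l)) => C Cs.
  have [|x xe ->] := @S_img true (odd_block 0 C); first by apply/odd_blockP;
    exists 0, C; rewrite trmx0 oppr0.
  have tw i i' y : component y (twist (chi i) (twist (chi i') x)) = (chi i y * chi i'
    y) *: component y x.
    by rewrite !component_twist scalerA.
  exists (f (twist (chi l) (twist (chi j) x))).
  have tC : twist (chi l) (twist (chi j) x) = twist (chi j) (twist (chi l) x).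
    by apply: component_ext => g; rewrite !tw mulrC.
  by split; [|rewrite tC]; rewrite conj_blockM // mulmxA PH -!mulmxA PH.
have PX i : P l ^+ i \in unitmx /\ forall x,
    f (iter i (twist (chi l)) x) *m conj_block (P l ^+ i) = conj_block (P l ^+ i) *m
      f x.
  elim: i => [|i [Piu IH]]; first by rewrite expr0 unitmx1 conj_block1; split=> // x;
    rewrite mulmx1 mul1mx.
  rewrite exprS; split=> [|x]; first by rewrite unitmx_mul Pu.
  by rewrite conj_blockM // mulmxA /= PH -!mulmxA IH.
have [PNu PN] := PX #|[set: gT]|.
have : P l ^+ #|[set: gT]| = 1 \/ P l ^+ #|[set: gT]| = - 1.
  apply: (conj_block_sign PNu (unitmx1 _ _)) => C Cs.
  have [|x xe ->] := @S_img true (odd_block 0 C); first by apply/odd_blockP;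
    exists 0, C; rewrite trmx0 oppr0.
  exists (f x); rewrite conj_block1 mulmx1 mul1mx; split=> //; rewrite -PN;
    congr (f _ *m _).
  apply: component_ext => g;
    have -> i : component g (iter i (twist (chi l)) x) = chi l g ^+ i *: component g x.
    by elim: i => [|i IH];
      rewrite ?expr0 ?scale1r //= component_twist IH scalerA -exprS.
  by rewrite -chiX expg_cardG ?inE // chi1 scale1r.
by rewrite mulnC exprM => -[] ->;
  rewrite ?expr1n // -[4%N]/(2 * 2)%N exprM sqrrN !expr1n.
Qed.

End Characters.

End GradedSuperalgebra.

Lemma matrix_neq0 (F : fieldType) m n (A : 'M[F]_(m, n)) :
  A != 0 -> exists i j, A i j != 0.
Proof.
move=> A0; suff /existsP[i /existsP[j Aij]] : [exists i, [exists j, A i j != 0]] by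
  exists i, j.
apply: contraNT A0 => /existsPn h; apply/eqP/matrixP => i j; rewrite mxE;
  apply/eqP/negPn.
by have /existsPn := h i; apply.
Qed.

Lemma tensmx_neq0 (F : fieldType) m n p q (A : 'M[F]_(m, n)) (B : 'M[F]_(p, q)) :
  A != 0 -> B != 0 -> A *t B != 0.
Proof.
move=> /matrix_neq0[i [j Aij]] /matrix_neq0[i' [j' Bij]].
apply/eqP=> /matrixP/(_ (mxtens_index (i, i')) (mxtens_index (j, j'))).
by rewrite tensmxE mxE => /eqP; rewrite mulf_eq0 (negPf Aij) (negPf Bij).
Qed.

Lemma mem_elem_grading (F : fieldType) (gT : finGroupType) N (t : N.-tuple gT) g (B :
  'M[F]_N) :
  reflect (forall i j, B i j != 0 -> ((tnth t i)^-1 * tnth t j)%g = g) (B \in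
    elem_grading F t g).
Proof.
apply: (iffP idP) => [Bg i j Bij|Bg].
  apply/eqP/negPn/negP => ng; case/eqP: Bij.
  have el : linear (fun B : 'M[F]_N => B i j : F^o) by move=> c A A'; rewrite !mxE.
  suff /subvP/(_ _ Bg) : (elem_grading F t g <= lker (linfun (pack_linear el)))%VS.
    by rewrite memv_ker lfunE => /eqP.
  apply/subv_sumP => a _; apply/subv_sumP => b /eqP gab.
  rewrite -memvE memv_ker lfunE /= mxE; case: (i =P a) => //= ia;
    case: (j =P b) => //= jb.
  by move: ng; rewrite ia jb gab eqxx.
rewrite (matrix_sum_delta B); apply: memv_suml => i _; apply: memv_suml => j _.
have [->|Bij] := eqVneq (B i j) 0; first by rewrite scale0r mem0v.
apply: memvZ; apply: (sumv_sup i) => //; apply: (sumv_sup j); first exact/eqP/Bg.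
exact: memv_line.
Qed.

(** * Degrees read off from joint eigenvectors, and the graded isomorphism *)

Section NormalizedGrading.
Variables (F : closedFieldType) (gT : finGroupType) (n : nat).
Hypothesis charF : [pchar F] =i pred0.
Hypothesis abG : abelian [set: gT].
Variables (J : superalgebra F) (D : gT -> {vspace J}) (f : 'Hom(J, 'M[F]_(n + n))).
Hypothesis n_gt0 : (0 < n)%N.
Hypothesis gradJ : is_super_grading D.
Hypothesis isoJ : supersym_iso (@mxpart F n n) (symv (trp F n)) f.
Variables (m : nat) (chi : 'I_m -> gT -> F).
Hypothesis chiM : forall l g h, chi l (g * h)%g = chi l g * chi l h.
Hypothesis chi1 : forall l, chi l 1%g = 1.
Hypothesis chi_sep : forall g h, (forall l, chi l g = chi l h) -> g = h.
Variables (P : 'I_m -> 'M[F]_n).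
Hypothesis Pu : forall l, P l \in unitmx.
Hypothesis PH : forall l x, f (twist gradJ (chi l) x) *m conj_block (P l) =
  conj_block (P l) *m f x.
Variables (k s : nat).
Local Notation V := {ffun 'I_k -> bool}.
Local Notation W := (V * V)%type.
Variables (v : 'I_m -> W) (lam : 'I_m -> 'rV[F]_s).
Variables (Q : 'M[F]_(2 ^ k * s, n)) (Q' : 'M[F]_(n, 2 ^ k * s)).
Hypothesis QQ' : Q *m Q' = 1%:M.
Hypothesis Q'Q : Q' *m Q = 1%:M.
Hypothesis QP : forall l, Q *m P l = (pauli F (v l) *t diag_mx (lam l)) *m Q.
Hypothesis nondeg : forall w, w != zerow k -> exists l, sympv (v l) w.

Let two0 : 2%:R != 0 :> F. Proof. exact: natr_neq0. Qed.
Local Notation from_tens := (untens Q Q').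
Local Notation to_tens := (intens Q Q').
Local Notation X w := (pauli F w).
Local Notation mu l := (weights (lam l)).
Local Notation op l := (X (v l) *t diag_mx (mu l)).

Let f_inj : lker f == 0%VS. Proof. by case: isoJ => ->. Qed.
Let f_lim : limg f = symv (trp F n). Proof. by case: isoJ. Qed.

Lemma intens_conj l : to_tens (conj_block (P l)) = op l.
Proof. by rewrite /intens (basis_conj QQ' Q'Q (Pu l) (QP l)) -mulmxA basisK //
  mulmx1. Qed.

Lemma op_unit l : op l \in unitmx.
Proof.
have [] // := @mulmx1_unit _ _ (op l) (to_tens (invmx (conj_block (P l)))).
rewrite -intens_conj -intensM // mulmxV ?conj_block_unit //.
by rewrite /intens mulmx1 basisK.
Qed.

Lemma twist_eigenP l c x :
  twist gradJ (chi l) x = c *: x <->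
  op l *m to_tens (f x) = c *: (to_tens (f x) *m op l).
Proof.
have E : to_tens (f (twist gradJ (chi l) x)) *m op l = op l *m to_tens (f x).
  by rewrite -intens_conj -!(intensM Q'Q) PH.
split=> [xc|opc]; first by rewrite -E xc linearZ /= linearZ /= -scalemxAl.
apply: (lker0P f_inj); apply: (can_inj (intensK Q'Q)).
apply: (can_inj (mulmxK (op_unit l))).
by rewrite E opc linearZ /= linearZ /= -scalemxAl.
Qed.

(* Degrees in the group are obtained without duality: a joint eigenvector of all
   characters in [J] is homogeneous. *)
Lemma eigen_degree Y (c : 'I_m -> F) : Y != 0 -> from_tens Y \in symv (trp F n) ->
  (forall l, op l *m Y = c l *: (Y *m op l)) -> exists g, forall l, chi l g = c l.
Proof.
move=> Y0; rewrite -f_lim => /memv_imgP[x _ xE] Yc.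
have YE : Y = to_tens (f x) by rewrite -xE untensK.
apply: (@joint_eigenvector_degree F gT J D gradJ m chi x c) => [|l].
  by apply: contra_neq Y0 => x0; rewrite YE x0 !linear0.
by apply/twist_eigenP; rewrite -YE.
Qed.

Lemma tens_fixed (A : 'M[F]_(2 ^ k)) T : A^T *t tstar F s T = A *t T ->
  from_tens (A *t T) \in symv (trp F n).
Proof. by move=> AT; rewrite mem_symv trp_untens AT. Qed.

Lemma op_tens l (A : 'M[F]_(2 ^ k)) T a b :
    X (v l) *m A = a *: (A *m X (v l)) -> diag_mx (mu l) *m T = b *: (T *m diag_mx
      (mu l)) ->
  op l *m (A *t T) = (a * b) *: ((A *t T) *m op l).
Proof. by move=> Aa Tb; rewrite !tensmx_mul Aa Tb tensmxZl tensmxZr scalerA. Qed.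

Lemma diag_delta (w : 'rV[F]_s) i j : diag_mx w *m (delta_mx i j : 'M_s) = w 0 i *:
  delta_mx i j.
Proof.
by apply/matrixP=> a b; rewrite mul_diag_mx !mxE; case: eqP => [->|_] //=;
  rewrite !mulr0.
Qed.

Lemma delta_diag (w : 'rV[F]_s) i j : (delta_mx i j : 'M_s) *m diag_mx w = w 0 j *:
  delta_mx i j.
Proof.
apply/matrixP=> a b; rewrite mul_mx_diag !mxE mulrC; case: (b =P j) => [->|_] //=.
by rewrite andbF !mulr0.
Qed.

(** The eigenvector is X_w (x) diag(1, e), with e the sign of X_w under transposition: the second
    factor is then in H or K along with X_w, and it commutes with all diagonal weights. Injectivity
    is the nondegeneracy of the exponent vectors. *)
Lemma pauli_degree (j0 : 'I_s) : exists h : W -> gT,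
  [/\ forall l w, chi l (h w) = (-1) ^+ sympv (v l) w,
      forall w w', h (addw w w') = (h w * h w')%g & injective h].
Proof.
have /fin_all_exists[h hE] w : exists g, forall l, chi l g = (-1) ^+ sympv (v l) w.
  pose e : F := (-1) ^+ dotv w.1 w.2.
  pose T : 'M[F]_(s + s) := block_mx 1%:M 0 0 e%:M.
  apply: (@eigen_degree (X w *t T) (fun l => (-1) ^+ sympv (v l) w)).
  - apply: tensmx_neq0; first exact: pauli_neq0.
    apply/eqP=> /matrixP/(_ (lshift s j0) (lshift s j0))/eqP.
    by rewrite block_mxEul !mxE eqxx oner_eq0.
  - apply: tens_fixed; rewrite pauli_tr tstarE !trmx0 oppr0 !tr_scalar_mx tensmxZl
    -tensmxZr.
    by rewrite scale_block_mx !scaler0 !scale_scalar_mx -expr2 sqrr_sign mulr1.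
  move=> l; rewrite -[(-1) ^+ _]mulr1; apply: op_tens; first exact: pauli_comm.
  rewrite scale1r diag_weights !mulmx_block !mul0mx !mulmx0 !addr0 !add0r mulmx1 mul1mx.
  by rewrite scalar_mxC.
exists h; split=> [l w|w w'|w w' hw]; first exact: hE.
  by apply: chi_sep => l; rewrite chiM !hE sympvDr signr_addb.
have [ww|/nondeg[l]] := eqVneq (addw w w') (zerow k).
  by rewrite -[w]add0w -(addww w') -addwA [addw w' w]addwC ww addwC add0w.
rewrite sympvDr; have := hE w l; rewrite hw hE.
case: (sympv (v l) w); case: (sympv (v l) w') => //= /eqP; rewrite ?expr0 ?expr1.
  by rewrite -subr_eq0 opprK -mulr2n (negPf two0).
by rewrite eq_sym -subr_eq0 opprK -mulr2n (negPf two0).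
Qed.

(** Degrees for the first half come from E_{j0 j} in the A-block. Those for the second half are
    inverses of degrees of E_{j0 j} + E_{j j0} in the C-block; a skew matrix in the B-block would
    vanish for j = j0. *)
Lemma weight_degree (j0 : 'I_s) : exists t : 'I_(s + s) -> gT,
  forall i l, chi l (t i) = lam l 0 j0 / mu l 0 i.
Proof.
have lam0 l j : lam l 0 j != 0 by have := weight_neq0 QQ' (Pu l) (QP l).
apply: (@fin_all_exists _ (fun=> gT) (fun i g => forall l, chi l g = lam l 0 j0 / mu
  l 0 i)) => i.
have ns : (1%:M : 'M[F]_(2 ^ k)) != 0 by rewrite -(pauli0 F k) pauli_neq0.
case: (split_ordP i) => j -> .
  suff [g gE] : exists g, forall l, chi l g = lam l 0 j0 / lam l 0 j.
    by exists g => l; rewrite gE row_mxEl.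
  apply: (@eigen_degree (1%:M *t block_mx (delta_mx j0 j) 0 0 (delta_mx j0 j)^T) (fun
    l => lam l 0 j0 / lam l 0 j)).
  - apply: tensmx_neq0 => //; apply/eqP=> /matrixP/(_ (lshift s j0) (lshift s j))/eqP.
    by rewrite block_mxEul !mxE !eqxx oner_eq0.
  - by apply: tens_fixed; rewrite trmx1 tstarE !trmx0 oppr0 trmxK.
  move=> l; rewrite -[_ / _]mul1r; apply: op_tens;
    first by rewrite mulmx1 mul1mx scale1r.
  rewrite diag_weights !mulmx_block !mul0mx !mulmx0 !addr0 !add0r trmx_delta
    !diag_delta !delta_diag.
  rewrite scale_block_mx !scaler0 !scalerA !mxE.
  by rewrite mulfVK // mulrAC mulfV // mul1r.
have [g gE] : exists g, forall l, chi l g = (lam l 0 j0)^-1 / lam l 0 j.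
  apply: (@eigen_degree (1%:M *t block_mx 0 0 (delta_mx j0 j + (delta_mx j0 j)^T) 0)
    (fun l => (lam l 0 j0)^-1 / lam l 0 j)).
  - apply: tensmx_neq0 => //; apply/eqP=> /matrixP/(_ (rshift s j0) (lshift s j))/eqP.
    rewrite block_mxEdl !mxE !eqxx /= -natrD; case: (_ && _);
      rewrite ?(negPf two0) ?oner_eq0 //.
  - by apply: tens_fixed; rewrite trmx1 tstarE !trmx0 oppr0 linearD /= trmxK addrC.
  move=> l; rewrite -[_ / _]mul1r; apply: op_tens;
    first by rewrite mulmx1 mul1mx scale1r.
  rewrite diag_weights !mulmx_block !mul0mx !mulmx0 !addr0 !add0r trmx_delta.
  rewrite mulmxDl mulmxDr !diag_delta !delta_diag scale_block_mx !scaler0 scalerDr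
    !scalerA !mxE.
  by rewrite mulfVK // mulrAC mulVf // mul1r.
exists g^-1%g => l; rewrite (chiV chiM chi1) gE row_mxEr mxE.
by rewrite invfM !invrK.
Qed.

Section Isomorphism.
Variables (h : W -> gT) (t : (s + s).-tuple gT) (base : 'I_m -> F).
Hypothesis hE : forall l w, chi l (h w) = (-1) ^+ sympv (v l) w.
Hypothesis hD : forall w w', h (addw w w') = (h w * h w')%g.
Hypothesis h_inj : injective h.
Hypothesis base0 : forall l, base l != 0.
Hypothesis tE : forall i l, chi l (tnth t i) = base l / mu l 0 i.

Let mu0 l i : mu l 0 i != 0.
Proof. by have := weights_neq0 QQ' (Pu l) (QP l). Qed.

Lemma chi_degree l i j : chi l ((tnth t i)^-1 * tnth t j)%g = mu l 0 i / mu l 0 j.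
Proof.
by rewrite chiM (chiV chiM chi1) !tE invfM invrK mulrACA mulVf ?mul1r.
Qed.

Definition flip (i : 'I_(s + s)) : 'I_(s + s) :=
  match split i with inl j => rshift s j | inr j => lshift s j end.

Lemma flip_lshift j : flip (lshift s j) = rshift s j.
Proof. by rewrite /flip (unsplitK (inl j)). Qed.

Lemma flip_rshift j : flip (rshift s j) = lshift s j.
Proof. by rewrite /flip (unsplitK (inr j)). Qed.

Lemma tstar_entry (B : 'M[F]_(s + s)) i j :
  (tstar F s B i j != 0) = (B (flip j) (flip i) != 0).
Proof.
rewrite -{1}[B]submxK tstarE; case: (split_ordP i) => i' ->;
  case: (split_ordP j) => j' ->;
rewrite ?flip_lshift ?flip_rshift ?block_mxEul ?block_mxEur ?block_mxEdl ?block_mxEdr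
  !mxE //.
by rewrite oppr_eq0.
Qed.

Lemma weights_flip l i : mu l 0 (flip i) = (mu l 0 i)^-1.
Proof.
case: (split_ordP i) => j ->;
  rewrite ?flip_lshift ?flip_rshift row_mxEl row_mxEr mxE //.
by rewrite invrK.
Qed.

(** [tstar] sends position (i, j) to (flip j, flip i), and flipping inverts the weights, so the
    quotient of weights that gives the degree is unchanged. *)
Lemma tstar_stable : stable_grading (tstar F s) (elem_grading F t).
Proof.
move=> g; apply/subvP => _ /memv_imgP[B /mem_elem_grading Bg ->].
apply/mem_elem_grading => i j; rewrite tstar_entry => /Bg <-.
by apply: chi_sep => l; rewrite !chi_degree !weights_flip invrK mulrC.
Qed.

Local Notation E := (tens_grading (pauli_grading F h) (elem_grading F t)).

Lemma tens_grading_eigen l g y : y \in E g -> op l *m y = chi l g *: (y *m op l).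
Proof.
have el : linear (fun y => op l *m y - chi l g *: (y *m op l)).
  move=> c A A'; rewrite mulmxDr mulmxDl -scalemxAr -scalemxAl scalerDr opprD
    scalerBr addrACA.
  by rewrite !scalerA [c * _]mulrC.
suff sub : (E g <= lker (linfun (pack_linear el)))%VS.
  by move/(subvP sub); rewrite memv_ker lfunE /= subr_eq0 => /eqP.
apply/subv_sumP => g' _; apply: tensv_subv => A B AD BE.
rewrite memv_ker lfunE /= subr_eq0; apply/eqP.
rewrite -[g in chi l g](mulKVg g') chiM; apply: op_tens.
  case/memv_sum_lines: AD => c ->; rewrite mulmx_sumr mulmx_suml scaler_sumr.
  apply: eq_bigr => w /eqP <-; rewrite hE -scalemxAr -scalemxAl pauli_comm !scalerA.
  by rewrite mulrC.
apply/matrixP=> i j; rewrite mul_diag_mx mul_mx_diag mxE [RHS]mxE [Y in _ = _ * Y]mxE.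
have [->|/(mem_elem_grading _ _ _ BE) <-] := eqVneq (B i j) 0;
  first by rewrite mul0r !mulr0.
by rewrite chi_degree [RHS]mulrCA mulfVK // mulrC.
Qed.

Lemma mem_tens_grading A B g g' : A \in pauli_grading F h g -> B \in elem_grading F t
  g' ->
  A *t B \in E (g * g')%g.
Proof. by move=> AD BE; apply: (sumv_sup g) => //;
  rewrite -memvE mem_tensv // mulKg. Qed.

Lemma tens_grading_full : (\sum_g E g)%VS = fullv.
Proof.
apply: tensv_full => A B.
have /memv_sumP[a aD ->] : A \in (\sum_g pauli_grading F h g)%VS.
  by rewrite (pauli_grading_sum two0) ?memvf.
rewrite tensmx_suml; apply: memv_suml => g _.
rewrite (matrix_sum_delta B) tensmx_sumr; apply: memv_suml => i _.
rewrite tensmx_sumr; apply: memv_suml => j _; rewrite tensmxZr; apply: memvZ.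
apply: (sumv_sup (g * ((tnth t i)^-1 * tnth t j))%g) => //; rewrite -memvE.
apply: mem_tens_grading; first exact: aD.
apply/mem_elem_grading => i' j'; rewrite mxE; case: (i' =P i) => [->|_];
  last by rewrite eqxx.
by case: (j' =P j) => [->//|_]; rewrite eqxx.
Qed.

Lemma tens_star_grading g y : y \in E g -> tens_star Q Q' y \in E g.
Proof.
suff sub : (E g <= linfun (tens_star Q Q') @^-1: E g)%VS.
  by move/(subvP sub); rewrite -memv_preim lfunE.
apply/subv_sumP => g' _; apply: tensv_subv => A B AD BE.
rewrite -memv_preim lfunE /= tens_starE // -[g](mulKVg g'); apply: mem_tens_grading.
  by rewrite -transpositionE; apply: (subvP (transposition_stable F h g'));
    exact: memv_img.
by apply: (subvP (tstar_stable _)); exact: memv_img.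
Qed.

(** An element of S of degree g in R (x) T is a joint eigenvector, hence comes from [D g]. For the
    converse the image of x in [D g] is split along the tensor grading with summands in S, and
    uniqueness of components in J leaves degree g alone. *)
Lemma graded_isomorphism : graded_supersym_iso D (@tenspart F (2 ^ k) s s) E
  (tensv (skewv (transposition F k)) (skewv (tstar F s))
   + tensv (symv (transposition F k)) (symv (tstar F s)))%VS.
Proof.
pose f' : 'Hom(J, 'M[F]_(2 ^ k * (s + s))) := (linfun to_tens \o f)%VF.
have f'E x : f' x = to_tens (f x) by rewrite comp_lfunE lfunE.
have uf' x : from_tens (f' x) = f x by rewrite f'E (intensK Q'Q).
have imgP U U0 (K : {vspace 'M[F]_(2 ^ k * (s + s))}) : (f @: U)%VS = U0 -> (forall
  y, (y \in K) = (from_tens y \in U0)) -> (f' @: U)%VS = K.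
  move=> fU KU; apply/vspaceP => y; rewrite KU -fU;
    apply/memv_imgP/memv_imgP => -[x xU].
    by move=> ->; exists x; rewrite // uf'.
  by move=> yx; exists x; rewrite // f'E -yx untensK.
have f'_ker : lker f' = 0%VS.
  apply/eqP; rewrite -subv0; apply/subvP => x; rewrite memv_ker memv0 => /eqP fx.
  by apply/eqP/(lker0P f_inj); rewrite -[f x]uf' fx !linear0.
have star_mem := mem_star two0 QQ' Q'Q.
have f'_img U : (f' @: U <= limg f')%VS by apply: limgS; exact: subvf.
set S := (_ + _)%VS in star_mem *.
have f'_lim : limg f' = S by apply: imgP f_lim _.
exists f'; split; last first.
  have sub g : (S :&: E g <= f' @: D g)%VS.
    apply/subvP => y; rewrite memv_cap -f'_lim => /andP[/memv_imgP[x _ ->] xE].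
    apply: memv_img; apply: (joint_eigenvector_mem (gradJ := gradJ) chi_sep) => l.
    by apply/twist_eigenP; rewrite -f'E; exact: tens_grading_eigen.
  move=> g; apply/eqP; rewrite eqEsubv sub andbT subv_cap -{1}f'_lim f'_img /=.
  apply/subvP => _ /memv_imgP[x xg ->].
  have fxS : f' x \in S by rewrite -f'_lim memv_img ?memvf.
  have /memv_sumP[u uE xu] : f' x \in (\sum_g E g)%VS by rewrite tens_grading_full
    memvf.
  have starx : tens_star Q Q' (f' x) = f' x.
    by move: fxS; rewrite star_mem mem_symv /tens_star => /eqP ->; rewrite uf' f'E.
  (* The summands [u g] need not lie in S. Averaging with [tens_star], which preserves each degree
     and fixes the image of x, puts them there. *)
  pose w g := 2%:R^-1 *: (u g + tens_star Q Q' (u g)).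
  have wE g' : w g' \in E g' by apply/memvZ/memvD; rewrite ?tens_star_grading ?uE.
  have wS g' : w g' \in S by apply/memvZ/star_sum_mem.
  have xw : f' x = \sum_g w g.
    rewrite -scaler_sumr big_split /= -linear_sum -xu /= starx.
    exact: half_sum.
  have /fin_all_exists2[z zD zw] g' : exists2 z, z \in D g' & w g' = f' z.
    by apply/memv_imgP; apply: (subvP (sub g')); rewrite memv_cap wS wE.
  have xz : x = \sum_g z g.
    apply: (lker0P f_inj); rewrite -uf' xw (eq_bigr _ (fun g _ => zw g)) -linear_sum.
    by rewrite uf'.
  have <- : w g = f' x; last exact: wE.
  by rewrite zw -(component_unique gradJ zD xz) (component_hom gradJ g xg) eqxx.
split=> // [e|d e x y xd ye].
  case: isoJ => _ _ fe _; apply: imgP (fe e) _ => y.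
  by rewrite !memv_cap star_mem (mem_tenspart QQ').
case: isoJ => _ _ _ /(_ _ _ _ _ xd ye) fm.
rewrite !f'E fm linearZ linearD linearZ /= -!(intensM Q'Q).
by [].
Qed.

End Isomorphism.

End NormalizedGrading.

(** * Elementary gradings of transpose form *)

Section Sorting.
Variables (T : finType) (s : nat) (a : 'I_s -> T).

Definition multiplicity (x : T) : nat := #|[pred j | a j == x]|.

Lemma multiplicity_sum : (\sum_x multiplicity x = s)%N.
Proof.
rewrite -[RHS]card_ord -[RHS]sum1_card (partition_big a predT) //=;
  apply: eq_bigr => x _.
by rewrite /multiplicity -sum1_card.
Qed.

(** The transpose form lists equal degrees consecutively. Both lists contain each value equally
    often, possibly zero times. *)
Lemma grouped_permutation : exists tau : 'S_s,
  [seq a (tau j) | j <- enum 'I_s]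
  = flatten [seq nseq (multiplicity (enum_val j)) (enum_val j) | j <- enum 'I_#|T|].
Proof.
set l := flatten _; have : perm_eq l [tuple a j | j < s].
  apply/allP => x _; apply/eqP;
    rewrite count_flatten -map_comp sumnE big_map big_enum /=.
  rewrite (bigD1 (enum_rank x)) //= big1 ?addn0 => [|j jx]; last first.
    rewrite count_nseq /=; case: eqP => // xj; by rewrite -xj enum_valK eqxx in jx.
  rewrite enum_rankK count_nseq /= eqxx mul1n count_map -size_filter /multiplicity.
  by rewrite cardE enumT /enum_mem.
case/tuple_permP=> tau lE; exists tau; rewrite lE /=.
by apply: eq_map => j; rewrite tnth_mktuple.
Qed.

End Sorting.

(** All of G serves as the list of distinct g_j, absent elements having multiplicity zero; sigma is
    x |-> c x^-1. With q = p o sigma^-1 the second half repeats each partner as often as the first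
    half repeats its element. *)
Lemma paired_transpose_form (gT : finGroupType) (s : nat) (a b : 'I_s -> gT) (c : gT)
  (mult : gT -> nat) :
    abelian [set: gT] -> (forall j, a j * b j = c)%g -> (\sum_x mult x = s)%N ->
    [seq a j | j <- enum 'I_s]
      = flatten [seq nseq (mult (enum_val j)) (enum_val j) | j <- enum 'I_#|gT|] ->
  transpose_form [tuple of [tuple a j | j < s] ++ [tuple b j | j < s]].
Proof.
move=> abG abc sum_mult aE; pose partner (x : gT) := (c * x^-1)%g.
have mulC (x y : gT) : (x * y = y * x)%g by exact: (centsP abG x (in_setT x) y
  (in_setT y)).
have partner_inj : injective partner by move=> x y /mulgI/invg_inj.
have sg_inj : injective (fun j : 'I_#|gT| => enum_rank (partner (enum_val j))).
  by move=> i j /enum_rank_inj/partner_inj/enum_val_inj.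
pose sg := perm sg_inj.
have sgE j : enum_val (sg j) = partner (enum_val j) by rewrite permE enum_rankK.
pose p (j : 'I_#|gT|) := mult (enum_val j).
have sum_p : (\sum_j p j)%N = s.
  rewrite -[RHS]sum_mult (reindex (@enum_val gT predT)) //=.
  exact: onW_bij (enum_val_bij gT).
exists #|gT|, (fun j => enum_val j), sg, p, (fun j => p (sg^-1%g j)); split.
- exact: enum_val_inj.
- by split=> //; rewrite (reindex_inj (@perm_inj _ sg)) -[RHS]sum_p;
  apply: eq_bigr => j _; rewrite permK.
- by move=> i j; rewrite !sgE /partner ![(c * _)%g]mulC !mulKVg.
rewrite /= aE; congr (_ ++ _).
have -> : [seq b j | j <- enum 'I_s] = [seq partner x | x <- [seq a j | j <- enum
  'I_s]].
  by rewrite -map_comp; apply: eq_map => j; rewrite /= /partner -(abc j) mulC mulKg.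
rewrite aE map_flatten -map_comp; congr flatten; apply: eq_map => j /=.
by rewrite map_nseq permK sgE.
Qed.

Theorem theorem7p3 (F : closedFieldType) (charF : [pchar F] =i pred0)
  (gT : finGroupType) (abG : abelian [set: gT])
  (n : nat) (J : superalgebra F)
  (simpleJ : simple_superalgebra J) (typeJ : type_P n J)
  (D : gT -> {vspace J}) (gradJ : is_super_grading D) :
  exists (k q s : nat) (starR : 'End('M[F]_(2 ^ k)))
         (DR : gT -> {vspace 'M[F]_(2 ^ k)}) (t : (s + s).-tuple gT),
    [/\ (2 * n = 2 ^ k * q)%N /\ (s + s = q)%N,
        involution_fine_grading starR DR,
        transpose_form t /\ stable_grading (tstar F s) (elem_grading F t)
      & graded_supersym_iso D (@tenspart F (2 ^ k) s s)
          (tens_grading DR (elem_grading F t))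
          (tensv (skewv starR) (skewv (tstar F s))
           + tensv (symv starR) (symv (tstar F s)))%VS].
Proof.
have [f isoJ] := typeJ; have two0 : 2%:R != 0 :> F by exact: natr_neq0.
(* Simplicity provides a nonzero product, which matrices of size 0 do not have. *)
have n_gt0 : (0 < n)%N.
  rewrite lt0n; apply/eqP=> n0; have [[x [y xy]] _] := simpleJ.
  case/eqP: xy; have f_inj : lker f == 0%VS by case: isoJ => ->.
  apply: (lker0P f_inj); apply/matrixP => i; suff : False by [].
  by move: i; rewrite n0 => -[].
have [m [chi [chiM chi1 chi_sep]]] := separating_characters charF abG.
have [P [Pu PH PN Psign]] := character_conjugations charF n_gt0 gradJ isoJ chiM chi1.
case: n n_gt0 typeJ f isoJ P Pu PH PN Psign => // n n_gt0 typeJ f isoJ P Pu PH PN Psign.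
have N_gt0 : (0 < 4 * #|[set: gT]|)%N by rewrite muln_gt0 cardG_gt0.
have [k [s [v [lam0 [Q0 [Q0' [QQ0 QQ0' QP0 nd]]]]]]] :=
  pauli_normal_form charF N_gt0 (dvdn_mulr _ (dvdnn 4)) PN Psign.
(* Otherwise the identity matrix of size [n.+1] would factor through a space of dimension 0. *)
have s_gt0 : (0 < s)%N.
  rewrite lt0n; apply/eqP=> s0; have := mulmx1_min QQ0'.
  by rewrite s0 muln0.
pose j0 := Ordinal s_gt0.
have [h [hE hD h_inj]] := pauli_degree charF isoJ chiM chi_sep Pu PH QQ0 QQ0' QP0 nd j0.
have [t0 t0E] := weight_degree charF isoJ chiM chi1 Pu PH QQ0 QQ0' QP0 j0.
(* Permuting the basis of the multiplicity space by [tau] groups equal degrees in the first half and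
   permutes the second half in parallel; Q, Q' and the weights are adjusted to match. *)
have [tau tauE] := grouped_permutation (fun j => t0 (lshift s j)).
pose lam l := \row_j lam0 l 0 (tau j).
pose Q := ((1%:M : 'M[F]_(2 ^ k)) *t perm_mx tau) *m Q0.
pose Q' := Q0' *m ((1%:M : 'M[F]_(2 ^ k)) *t (perm_mx tau)^T).
have ptau : perm_mx tau *m (perm_mx tau)^T = 1%:M :> 'M[F]_s.
  by rewrite tr_perm_mx -perm_mxM mulgV perm_mx1.
have ptau' : (perm_mx tau)^T *m perm_mx tau = 1%:M :> 'M[F]_s by exact: mulmx1C.
have QQ' : Q *m Q' = 1%:M.
  rewrite /Q /Q' mulmxA -[_ *m Q0 *m Q0']mulmxA QQ0 mulmx1 tensmx_mul ptau mulmx1.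
  exact: tens11.
have Q'Q : Q' *m Q = 1%:M.
  by rewrite /Q /Q' mulmxA -[Q0' *m _ *m _]mulmxA tensmx_mul ptau' mulmx1 tens11 mulmx1.
have QP l : Q *m P l = (pauli F (v l) *t diag_mx (lam l)) *m Q.
  rewrite /Q -mulmxA QP0 !mulmxA !tensmx_mul mulmx1 mul1mx; congr (_ *t _ *m _).
  apply/matrixP=> i j; rewrite mul_diag_mx -row_permE !mxE.
  by case: eqP => _; rewrite ?mulr1n ?mulr0n ?mulr1 ?mulr0.
pose a j := t0 (lshift s (tau j)); pose b j := t0 (rshift s (tau j)).
pose t := [tuple of [tuple a j | j < s] ++ [tuple b j | j < s]].
have tE i l : chi l (tnth t i) = lam0 l 0 j0 / weights (lam l) 0 i.
  rewrite /t; case: (split_ordP i) => j ->.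
    by rewrite tnth_lshift tnth_mktuple t0E /weights !row_mxEl mxE.
  by rewrite tnth_rshift tnth_mktuple t0E /weights !row_mxEr !mxE.
have lam0_neq0 l j : lam0 l 0 j != 0 by have := weight_neq0 QQ0 (Pu l) (QP0 l).
exists k, (s + s)%N, s, (transposition F k), (pauli_grading F h), t; split.
- split=> //; rewrite mulnDr addnn -mul2n; congr (2 * _)%N.
  (* Matrices inverse to each other on both sides force n = 2^k s. *)
  by apply/eqP; rewrite eqn_leq (mulmx1_min QQ0) (mulmx1_min QQ0').
- exact: transposition_fine_grading.
- split.
    (* On a j and b j the l-th character is lam_{j0} / lam_j and lam_{j0} lam_j; the product is
       lam_{j0}^2 for every j, so its value at j0 serves as the constant. *)
    apply: (@paired_transpose_form gT s a b (t0 (lshift s j0) * t0 (rshift s j0))%g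
      (multiplicity (fun j => t0 (lshift s j))) abG) => [j||].
      apply: chi_sep => l; rewrite !chiM !t0E /weights !row_mxEl !row_mxEr !mxE !invrK.
      by rewrite mulrACA mulVf // mulrACA mulVf.
      exact: multiplicity_sum.
    exact: tauE.
  exact: (tstar_stable chiM chi1 chi_sep (fun l => lam0_neq0 l j0) tE).
exact: (graded_isomorphism charF isoJ chiM chi1 chi_sep Pu PH QQ' Q'Q QP hE h_inj
  (fun l => lam0_neq0 l j0) tE).
Qed.
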